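(* Let $\sigma$ be a measurable function on $\mathfrak X\times\Omega\times[0,\tau]$ such that $T_\sigma:L^2(\mathfrak X)\to L^2(\mathfrak X)$ is nuclear. Then $T_\sigma:L^2(\mathfrak X)\to L^2(\mathfrak X)$ is self-adjoint if and only if there exist sequences $\{g_k\}_{k=1}^\infty$ and $\{f_k\}_{k=1}^\infty$ in $L^2(\mathfrak X)$ such that $$\sum_{k=1}^\infty\|f_k\|_{L^2(\mathfrak X)}\|g_k\|_{L^2(\mathfrak X)}<\infty,$$ and, for every $x\in\mathfrak X$ and almost every $(\omega,s)\in\Omega\times[0,\tau]$, $$\sum_{k=1}^\infty f_k(x)\,\overline{\mathcal H\overline{g_k}(\omega,s)}=\sum_{k=1}^\infty\overline{\mathcal Hf_k(\omega,s)}\;\overline{g_k(x)}$$ and $$\sigma(x,\omega,s)=q^{-(\frac12-is)h_\omega(x)}\sum_{k=1}^\infty f_k(x)\,\overline{\mathcal H\overline{g_k}(\omega,s)}.$$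
   Context: Let $q\ge 2$ be an integer and let $\mathfrak X$ be (the vertex set of) the homogeneous tree of degree $q+1$: the connected graph without loops (cycles) in which every vertex has exactly $q+1$ neighbours. $d(x,y)$ is the number of edges of the geodesic from $x$ to $y$; a reference vertex $o$ is fixed and $|x|=d(o,x)$. $\mathfrak X$ carries the counting measure and $L^p(\mathfrak X)$ is taken with respect to it. $\Omega$ is the set of infinite geodesic rays $\omega=(\omega_0,\omega_1,\dots)$ with $\omega_0=o$. The height function is $h_\omega(x)=\lim_{m\to\infty}(m-d(x,\omega_m))=2|c(x,\omega)|-|x|$, where $c(x,\omega)$ is the last vertex on the geodesic path $[o,x]$ that lies on $\omega$. $\nu$ is the probability measure on $\Omega$ (with the $\sigma$-algebra generated by the sets $E(x)=\{\omega:\omega\text{ passes through }x\}$) with $\nu(E(x))=\frac{q}{(q+1)q^{|x|}}$ for $x\neq o$. Put $\tau=\pi/\log q$ and $d\mu(s)=c_P|c(s)|^{-2}ds$ on $[0,\tau]$, with $c_P=\frac{q\log q}{2\pi(q+1)}$ and $c(z)=\frac{q^{1/2}}{q+1}\,\frac{q^{1/2+iz}-q^{-1/2-iz}}{q^{iz}-q^{-iz}}$. $\Omega\times[0,\tau]$ carries $\nu\otimes\mu$. The Fourier-Helgason transform is $\mathcal Hf(\omega,s)=\sum_{y\in\mathfrak X}f(y)q^{(\frac12+is)h_\omega(y)}$ for finitely supported $f$, extended to $L^2(\mathfrak X)$ as an isometry into $L^2(\Omega\times[0,\tau])$. For measurable $\sigma$ and finitely supported $f$, the pseudo-differential operator with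 symbol $\sigma$ is $T_\sigma f(x)=\int_\Omega\int_0^\tau q^{(\frac12-is)h_\omega(x)}\sigma(x,\omega,s)\mathcal Hf(\omega,s)\,d\nu(\omega)d\mu(s)$. Saying that $T_\sigma$ is an operator of a given class between $L^p$ spaces means that this integral converges absolutely for all finitely supported $f$ and all $x$, and that $T_\sigma$ extends from finitely supported functions to an operator of that class. A bounded linear operator $T:X\to Y$ of complex Banach spaces is nuclear if there are sequences $\{x_n'\}$ in the dual $X'$ and $\{y_n\}$ in $Y$ with $\sum_n\|x_n'\|_{X'}\|y_n\|_Y<\infty$ and $Tx=\sum_n x_n'(x)y_n$ for all $x\in X$. *)

(* Defs.v *)
From HB Require Import structures.
From mathcomp Require Import all_boot all_order all_algebra.
From mathcomp Require Import all_classical all_reals all_analysis.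
From mathcomp Require Import measurable_realfun complex zify ring lra.
Set Implicit Arguments.
Unset Strict Implicit.
Unset Printing Implicit Defensive.
Import Order.TTheory GRing.Theory Num.Theory numFieldNormedType.Exports.
Local Open Scope classical_set_scope.
Local Open Scope ring_scope.
Local Open Scope complex_scope.

(* A cycle of length < 3 is trivial: adj is irreflexive, and [:: x; y] only
   goes back and forth along one edge. *)
Record homogeneous_tree (q : nat) := HomogeneousTree {
  vertex :> choiceType;
  adj : rel vertex;
  tree_order : (2 <= q)%N;
  adj_sym : symmetric adj;
  adj_irr : irreflexive adj;
  tree_connected : forall x y, exists p, path adj x p /\ last x p = y;
  tree_acyclic : forall c, ucycle adj c -> (size c < 3)%N;
  tree_degree : forall x, ([set y | adj x y] #= `I_q.+1)%card }.

Section distance.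
Context {q : nat} {X : homogeneous_tree q}.
Implicit Types x y : X.

Definition joined x y : pred nat :=
  fun n => `[< exists p, [/\ path (@adj q X) x p, last x p = y & size p = n] >].

Lemma joined_ex x y : exists n, joined x y n.
Proof.
have [p [xp py]] := tree_connected x y.
by exists (size p); apply/asboolP; exists p.
Qed.

Definition dist x y : nat := ex_minn (joined_ex x y).

(* w 0, ..., w L is a walk without backtracking *)
Definition nbwalk (w : nat -> X) L :=
  (forall n, (n < L)%N -> adj (w n) (w n.+1)) /\
  (forall n, (n.+1 < L)%N -> w n.+2 <> w n).

Lemma nbwalk_inj w L : nbwalk w L ->
  forall d i, (0 < d)%N -> (i + d <= L)%N -> w i <> w (i + d)%N.
Proof.
move=> [wa wn] d; have [n] := ubnP d; elim: n d => // n IH d dn i d0 iL wij.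
have winj a b : (a < b)%N -> (b < d)%N -> w (i + a)%N <> w (i + b)%N.
  move=> ab bd; have -> : (i + b = (i + a) + (b - a))%N by lia.
  apply: IH; lia.
pose c := [seq w (i + k)%N | k <- iota 0 d].
have sc : size c = d by rewrite size_map size_iota.
have nc k : (k < d)%N -> nth (w 0%N) c k = w (i + k)%N.
  by move=> kd; rewrite (nth_map 0%N) ?size_iota// nth_iota.
have : (size c < 3)%N.
  apply: (@tree_acyclic q X); apply/andP; split; last first.
    apply/(uniqP (w 0%N)) => a b; rewrite !inE sc => ad bd.
    rewrite !nc// => e; case: (ltngtP a b) => // h; exfalso.
      exact: winj h bd e.
    by apply: winj h ad _; rewrite e.
  case: d {IH dn} d0 iL wij winj @c sc nc => // d _ iL wij winj c sc nc.
  have -> : c = w i :: [seq w (i + k)%N | k <- iota 1 d] by rewrite /c /= addn0.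
  rewrite /cycle; apply/(pathP (w 0%N)) => k.
  rewrite size_rcons size_map size_iota ltnS => kd.
  have -> : nth (w 0%N) (w i :: rcons [seq w (i + k)%N | k <- iota 1 d] (w i)) k
     = w (i + k)%N.
    case: k kd => [|k] kd /=; first by rewrite addn0.
    by rewrite nth_rcons size_map size_iota kd (nth_map 0%N) ?size_iota// nth_iota.
  have -> : nth (w 0%N) (rcons [seq w (i + k)%N | k <- iota 1 d] (w i)) k
     = w (i + k).+1.
    rewrite nth_rcons size_map size_iota.
    case: ltngtP kd => // [kd _|-> _].
      by rewrite (nth_map 0%N) ?size_iota// nth_iota// addnA addn1.
    by rewrite wij addnS.
  apply: wa; lia.
rewrite sc; case: d {IH dn winj nc c sc} d0 iL wij => // -[|[|d]]// _ iL.
  rewrite addn1 => e; have := wa i; rewrite -e adj_irr; lia.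
by rewrite addn2 => e _; apply: (wn i); [lia|rewrite -e].
Qed.

Lemma nbwalk_size v n w L : nbwalk v n -> nbwalk w L ->
  v 0%N = w 0%N -> v n = w L -> n = L.
Proof.
elim: n L => [|n IH] [|L]//.
- move=> _ wL e0 e; exfalso; apply: (nbwalk_inj wL (d := L.+1) (i := 0%N)) => //.
  by rewrite -e0 add0n.
- move=> vn _ e0 e; exfalso; apply: (nbwalk_inj vn (d := n.+1) (i := 0%N)) => //.
  by rewrite e0 add0n.
move=> vn wL e0 e; have [e'|e'] := eqVneq (v n) (w L).
  congr S; apply: IH e' => //.
    by case: vn => a b; split=> k h; [apply: a|apply: b]; lia.
  by case: wL => a b; split=> k h; [apply: a|apply: b]; lia.
exfalso.
pose u k := if (k <= L.+1)%N then w k else v (n.+1 - (k - L.+1))%N.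
have : nbwalk u (L.+1 + n.+1).
  case: vn => va vb; case: wL => wa wb; split=> k kL; rewrite /u.
  - case: (leqP k.+1 L.+1) => h; first by rewrite ltnW//; apply: wa.
    have -> : (n.+1 - (k.+1 - L.+1) = n - (k - L.+1))%N by lia.
    have [h'|h'] := leqP k L.+1.
      have -> : k = L.+1 by lia.
      by rewrite subnn subn0 adj_sym -e; apply: va.
    have -> : (n.+1 - (k - L.+1) = (n - (k - L.+1)).+1)%N by lia.
    by rewrite adj_sym; apply: va; lia.
  - have [h|h] := leqP k.+2 L.+1.
      have -> : (k <= L.+1)%N = true by lia.
      by apply: wb.
    have [h'|h'] := leqP k L.+1.
      have [ek|ek] : k = L \/ k = L.+1 by lia.
        have -> : (n.+1 - (k.+2 - L.+1) = n)%N by lia.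
        by rewrite ek; exact/eqP.
      have -> : (n.+1 - (k.+2 - L.+1) = n.-1)%N by lia.
      rewrite ek => e1; apply: (vb n.-1); first by lia.
      by rewrite e1 -e; congr v; lia.
    move=> e1; apply: (vb (n.+1 - (k.+2 - L.+1))%N); first by lia.
    by rewrite e1; congr v; lia.
move=> /nbwalk_inj /(_ (L.+1 + n.+1)%N 0%N); apply => //; rewrite /u leq0n add0n.
have -> : (L.+1 + n.+1 <= L.+1)%N = false by lia.
by have -> : (n.+1 - (L.+1 + n.+1 - L.+1) = 0)%N by lia.
Qed.

Lemma nbwalk_dist w L : nbwalk w L -> dist (w 0%N) (w L) = L.
Proof.
move=> wL; rewrite /dist; case: ex_minnP => n /asboolP[p [wp pl pn]] mn.
pose v k := nth (w 0%N) (w 0%N :: p) k.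
have vlast k : (k <= n)%N -> v k = last (w 0%N) (take k p).
  move=> kn; rewrite -nth_last size_take pn.
  have -> : (if (k < n)%N then k else n) = k by case: ltnP; lia.
  by case: k kn => [|k] kn; rewrite /v ?take0//= nth_take.
apply: (@nbwalk_size v n w L) => //; last by rewrite vlast// -pn take_size.
split=> k kn; first by apply: (pathP _ wp); rewrite pn.
move=> ek; have : (n <= n - 2)%N; last by lia.
apply: mn; apply/asboolP; exists (take k p ++ drop k.+2 p).
have dk : drop k p = v k.+1 :: v k.+2 :: drop k.+2 p.
  by rewrite (drop_nth (w 0%N)) ?pn; [rewrite (drop_nth (w 0%N)) ?pn|lia].
move: wp pl; rewrite -{1 2}(cat_take_drop k p) dk cat_path last_cat /=.
rewrite -vlast; last by lia.
move=> /and4P[p1 _ _ p2] pl; split.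
- by rewrite cat_path p1 -vlast -?ek//; lia.
- by rewrite last_cat -vlast -?ek//; lia.
- by rewrite size_cat size_take size_drop pn; case: ltnP; lia.
Qed.

Lemma dist_sym x y : dist x y = dist y x.
Proof.
suff H a b : (dist a b <= dist b a)%N by apply/eqP; rewrite eqn_leq !H.
rewrite {2}/dist; case: ex_minnP => n /asboolP[p [bp pl pn]] _.
rewrite /dist; case: ex_minnP => m _; apply; apply/asboolP.
exists (rev (belast b p)); split; last by rewrite size_rev size_belast.
- rewrite -pl rev_path; apply: sub_path bp => u v /=.
  by rewrite adj_sym.
- by case: p {bp pn} pl => [|c p] //= _; rewrite rev_cons last_rcons.
Qed.

Lemma adj_avoid x y : exists z : X, adj x z /\ z <> y.
Proof.
apply: contrapT => H.
have sub : [set z : X | adj x z] `<=` [set y].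
  by move=> z /= xz; apply: contrapT => zy; apply: H; exists z.
have q2 := tree_order X.
suff : (q.+1 <= 1)%N by lia.
rewrite -card_le_II -(card_le_eql (tree_degree x)).
apply: card_le_trans (subset_card_le sub) _.
by rewrite (card_le_eql card_set1).
Qed.

(* The last factor is |m - n|, written with truncated subtractions. *)
Record ray (o : X) := Ray {
  ray_fun :> nat -> X;
  ray_start : ray_fun 0%N = o;
  ray_geodesic : forall m n, dist (ray_fun m) (ray_fun n) =
    ((m - n) + (n - m))%N }.

Lemma ray_exists o : exists r : ray o, True.
Proof.
have /choice[next nextP] : forall p : X * X, exists z, adj p.2 z /\ z <> p.1.
  by move=> p; exact: adj_avoid.
have [s0 [os0 _]] := adj_avoid o o.
pose st k := iter k (fun p => (p.2, next p)) (o, s0).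
pose w k := (st k).1.
have wS k : w k.+1 = (st k).2 by [].
have wadj k : adj (w k) (w k.+1).
  by case: k => [|k] //; rewrite !wS; have [] := nextP (st k).
have wnb k : w k.+2 <> w k by rewrite wS; have [] := nextP (st k).
have wd m d : dist (w m) (w (m + d)%N) = d.
  rewrite -{1}(addn0 m); apply: (@nbwalk_dist (fun k => w (m + k)%N)).
  by split=> k _; rewrite !addnS.
unshelve eexists (@Ray o w _ _) => //.
move=> m n; have [mn|nm] := leqP m n.
  by rewrite -{1}(subnKC mn) wd; lia.
by rewrite dist_sym -{1}(subnKC (ltnW nm)) wd; lia.
Qed.
End distance.

Section boundary.
Context {q : nat} {X : homogeneous_tree q}.

HB.instance Definition _ (o : X) := gen_eqMixin (ray o).
HB.instance Definition _ (o : X) := gen_choiceMixin (ray o).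
HB.instance Definition _ (o : X) :=
  isPointed.Build (ray o) (projT1 (cid (ray_exists o))).

Definition cylinder (o x : X) : set (ray o) := [set w | exists n, w n = x].

Definition boundary (o : X) := g_sigma_algebraType (range (@cylinder o)).
HB.instance Definition _ (o : X) := Measurable.on (boundary o).

Definition height {R : realType} {o : X} (w : boundary o) (x : X) : R :=
  limn (fun m => m%:R - (dist x ((w : ray o) m))%:R : R).
End boundary.

(* the real-valued modulus of a complex number *)
Notation normc := (@Normc.normc _).

Section complex_analysis.
Context {R : realType}.

(* q ^ z = q ^ (Re z) * exp (i * Im z * ln q) *)
Definition qpow (q : nat) (z : R[i]) : R[i] :=
  (q%:R `^ complex.Re z)%:C *
  (cos (complex.Im z * ln q%:R) +i* sin (complex.Im z * ln q%:R)).

Context d (T : measurableType d).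
Implicit Types (D : set T) (f : T -> R[i]).

Definition cmeasurable_fun D f :=
  measurable_fun D (fun x => complex.Re (f x)) /\
  measurable_fun D (fun x => complex.Im (f x)).

Context (mu : {measure set T -> \bar R}).
(* absolute convergence of the integral of f over D *)
Definition cintegrable D f :=
  cmeasurable_fun D f /\ (\int[mu]_(x in D) (normc (f x))%:E < +oo)%E.

Definition cintegral D f : R[i] :=
  Rintegral mu D (fun x => complex.Re (f x)) +i*
  Rintegral mu D (fun x => complex.Im (f x)).
End complex_analysis.

Section l2.
Context {R : realType} {V : choiceType}.
Implicit Types (f : V -> R[i]).

(* squared norm of L^2 with respect to the counting measure of V *)
Definition sqnorm f : \bar R := (\esum_(x in [set: V]) (normc (f x) ^+ 2)%:E)%E.
Definition square_summable : {pred V -> R[i]} := fun f => `[< (sqnorm f < +oo)%E >].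

Lemma sqnorm_ge0 f : (0 <= sqnorm f)%E.
Proof. by apply: esum_ge0 => x _; rewrite lee_fin sqr_ge0. Qed.
Lemma normc_ge0 (z : R[i]) : 0 <= normc z.
Proof. by case: z => a b /=; exact: sqrtr_ge0. Qed.

Lemma sqnormZ (a : R[i]) f :
  (sqnorm (fun x => (a * f x)%R) = (normc a ^+ 2)%:E * sqnorm f)%E.
Proof.
have le (b : R[i]) h : (sqnorm (fun x => (b * h x)%R) <= (normc b ^+ 2)%:E * sqnorm h)%E.
  apply: ge_ereal_sup => _ [A [fA _] <-].
  under eq_fsbigr do rewrite Normc.normcM exprMn EFinM.
  rewrite -ge0_mule_fsumr; last by move=> x; rewrite lee_fin sqr_ge0.
  rewrite lee_wpmul2l ?lee_fin ?sqr_ge0//.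
  by apply: ereal_sup_ubound; exists A.
apply/eqP; rewrite eq_le le /=.
have [->|a0] := eqVneq a 0; first by rewrite Normc.normc0 expr0n mul0e sqnorm_ge0.
have na : normc a != 0 by apply: contra a0 => /eqP /Normc.eq0_normc ->.
have -> : sqnorm f = sqnorm (fun x => (a^-1 * (a * f x))%R).
  by congr sqnorm; apply/funext => x; rewrite mulKf.
apply: (@le_trans _ _ ((normc a ^+ 2)%:E * ((normc a^-1 ^+ 2)%:E *
    sqnorm (fun x => a * f x)%R))%E).
  by rewrite lee_wpmul2l ?lee_fin ?sqr_ge0// le.
by rewrite muleA -EFinM -exprMn Normc.normcV mulfV// expr1n mul1e.
Qed.

Lemma sqnormD_le (s : R) f g : 0 < s ->
  (sqnorm (fun x => (f x + g x)%R)
     <= (1 + s)%:E * sqnorm f + (1 + s^-1)%:E * sqnorm g)%E.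
Proof.
move=> s0; have s1 : 0 <= 1 + s by rewrite addr_ge0 ?ltW.
have s2 : 0 <= 1 + s^-1 by rewrite addr_ge0 ?invr_ge0 ?ltW.
have E (r : R) h : 0 <= r -> (r%:E * sqnorm h =
    \esum_(x in [set: V]) (r * normc (h x) ^+ 2)%:E)%E.
  move=> r0; pose a : R[i] := (Num.sqrt r)%:C.
  have na : normc a ^+ 2 = r by rewrite /a /= expr0n addr0 sqr_sqrtr ?sqr_ge0// sqr_sqrtr.
  rewrite -{1}na -sqnormZ; apply: eq_esum => x _.
  by rewrite Normc.normcM exprMn na.
rewrite !E// -esumD; last 2 first.
- by move=> x _; rewrite lee_fin mulr_ge0// sqr_ge0.
- by move=> x _; rewrite lee_fin mulr_ge0// sqr_ge0.
apply: le_esum => x _; rewrite -EFinD lee_fin.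
have h := le_normcD (f x) (g x).
apply: (@le_trans _ _ ((normc (f x) + normc (g x)) ^+ 2)).
  by rewrite ler_sqr ?nnegrE ?addr_ge0 ?normc_ge0.
set a := normc (f x); set b := normc (g x).
rewrite -subr_ge0.
have -> : (1 + s) * a ^+ 2 + (1 + s^-1) * b ^+ 2 - (a + b) ^+ 2
   = (s * a - b) ^+ 2 / s by field; rewrite gt_eqF.
by rewrite divr_ge0 ?sqr_ge0 ?ltW.
Qed.

Lemma sqnorm_eq0 f : sqnorm f = 0%E -> forall x, f x = 0.
Proof.
move=> f0 x; apply: Normc.eq0_normc; apply/eqP.
rewrite -sqrf_eq0 eq_le sqr_ge0 andbT -lee_fin.
rewrite [leRHS](_ : _ = sqnorm f); last by rewrite f0.
apply: ereal_sup_ubound; exists [set x]; first by split => //; exact: finite_set1.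
by rewrite fsbig_set1.
Qed.

Lemma square_summable_submod : submod_closed square_summable.
Proof.
split=> [|a f g].
  apply/asboolP; rewrite /sqnorm esum1 ?ltry// => x _.
  by rewrite Normc.normc0 expr0n.
move=> /asboolP f2 /asboolP g2; apply/asboolP.
apply: le_lt_trans (@sqnormD_le 1 _ _ ltr01) _.
rewrite invr1; apply: lte_add_pinfty; last exact: lte_mul_pinfty.
apply: lte_mul_pinfty => //.
have -> : sqnorm (a *: f) = ((normc a ^+ 2)%:E * sqnorm f)%E by exact: sqnormZ.
by apply: lte_mul_pinfty; rewrite ?lee_fin ?sqr_ge0.
Qed.

HB.instance Definition _ :=
  GRing.isSubmodClosed.Build _ _ square_summable square_summable_submod.
End l2.

Section l2_type.
Context (R : realType) (V : choiceType).

Record l2 := L2 { l2_fun :> V -> R[i]; l2_in : l2_fun \in square_summable }.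

HB.instance Definition _ := [isSub for l2_fun].
HB.instance Definition _ := [Choice of l2 by <:].
HB.instance Definition _ := [SubChoice_isSubLmodule of l2 by <:].

Implicit Types f g : l2.

Definition l2norm f : R := Num.sqrt (fine (sqnorm f)).

Lemma sqnorm_fin f : sqnorm f = (l2norm f ^+ 2)%:E.
Proof.
have /asboolP f2 := l2_in f; rewrite /l2norm.
rewrite sqr_sqrtr ?fine_ge0 ?sqnorm_ge0// fineK// ge0_fin_numE//.
exact: sqnorm_ge0.
Qed.

Lemma l2norm_ge0 f : 0 <= l2norm f. Proof. exact: sqrtr_ge0. Qed.

Lemma l2norm_eq0 f : l2norm f = 0 -> f = 0.
Proof.
move=> f0; apply: val_inj; apply/funext => x /=.
by apply: sqnorm_eq0; rewrite sqnorm_fin f0 expr0n.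
Qed.

Lemma l2normD f g : l2norm (f + g) <= l2norm f + l2norm g.
Proof.
have [/l2norm_eq0 ->|f0] := eqVneq (l2norm f) 0.
  by rewrite add0r lerDr l2norm_ge0.
have [/l2norm_eq0 ->|g0] := eqVneq (l2norm g) 0.
  by rewrite addr0 lerDl l2norm_ge0.
have fp : 0 < l2norm f by rewrite lt_neqAle eq_sym f0 l2norm_ge0.
have gp : 0 < l2norm g by rewrite lt_neqAle eq_sym g0 l2norm_ge0.
rewrite -ler_sqr ?nnegrE ?addr_ge0 ?l2norm_ge0// -lee_fin -sqnorm_fin.
apply: le_trans (@sqnormD_le R V (l2norm g / l2norm f) f g _) _.
  by rewrite divr_gt0.
rewrite !sqnorm_fin -!EFinM -EFinD lee_fin le_eqVlt; apply/orP; left; apply/eqP.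
by field; rewrite ?f0 ?g0.
Qed.

Lemma l2normZ (a : R[i]) f : l2norm (a *: f) = normc a * l2norm f.
Proof.
have an := normc_ge0 a.
rewrite /l2norm.
have -> : sqnorm (a *: f) = ((normc a ^+ 2) * l2norm f ^+ 2)%:E.
  by rewrite EFinM -sqnorm_fin -sqnormZ.
by rewrite /= -exprMn sqrtr_sqr ger0_norm ?mulr_ge0 ?l2norm_ge0// /l2norm.
Qed.

Lemma l2normC_D f g : (l2norm (f + g))%:C <= (l2norm f)%:C + (l2norm g)%:C :> R[i].
Proof. by rewrite -rmorphD lecR l2normD. Qed.
Lemma l2normC_Z (a : R[i]) f : (l2norm (a *: f))%:C = `|a| * (l2norm f)%:C.
Proof. by rewrite l2normZ rmorphM. Qed.
Lemma l2normC_eq0 f : (l2norm f)%:C = 0 :> R[i] -> f = 0.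
Proof. by move=> [/l2norm_eq0]. Qed.

HB.instance Definition _ :=
  Lmodule_isNormed.Build R[i] l2 l2normC_D l2normC_Z l2normC_eq0.

Lemma l2conj_subproof f : (fun x => (f x)^*%C) \in square_summable.
Proof.
have /asboolP f2 := l2_in f; apply/asboolP.
rewrite [ltLHS](_ : _ = sqnorm f)//.
by apply: eq_esum => x _; case: (f x) => a b /=; rewrite sqrrN.
Qed.
Definition l2conj f : l2 := L2 (l2conj_subproof f).

(* sum of an absolutely summable family *)
Definition rsum (a : V -> R) : R :=
  fine (\esum_(x in [set: V]) (a^\+ x)%:E) -
  fine (\esum_(x in [set: V]) (a^\- x)%:E).
Definition csum (a : V -> R[i]) : R[i] :=
  rsum (fun x => complex.Re (a x)) +i* rsum (fun x => complex.Im (a x)).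
Definition l2dot f g : R[i] := csum (fun x => f x * (g x)^*%C).
Definition selfadjoint (T : l2 -> l2) := forall f g, l2dot (T f) g = l2dot f (T g).
End l2_type.

(* c has poles at 0 and tau, where |c|^-2 vanishes. Here division by zero
   gives harish_chandra_c 0 = 0, hence again normc _ ^- 2 = 0. *)
Section plancherel_constants.
Context (R : realType) (q : nat).

Definition tau : R := pi / ln q%:R.

Definition harish_chandra_c (z : R[i]) : R[i] :=
  let i := 0 +i* 1 in
  (q%:R `^ 2^-1 / q.+1%:R)%:C *
  ((qpow q (2^-1 + i * z) - qpow q (- 2^-1 - i * z)) /
   (qpow q (i * z) - qpow q (- (i * z)))).

Definition plancherel_const : R := q%:R * ln q%:R / (2 * pi * q.+1%:R).

Definition plancherel_density (s : R) : R :=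
  plancherel_const * normc (harish_chandra_c s%:C) ^- 2.
End plancherel_constants.

Section plancherel.
Context (R : realType) (q : nat).
Local Notation tau := (tau R q).
Local Notation cP := (plancherel_const R q).
Local Notation density := (@plancherel_density R q).

(* The measure mu of [0, tau], seen as a measure of R. *)
Definition plancherel : set (measurableTypeR R) -> \bar R :=
  fun A => (\int[lebesgue_measure]_(s in A `&` `[0%R, tau]) (density s)%:E)%E.

Let t (s : R) := s * ln q%:R.
Let a : R := q%:R `^ 2^-1.
Let b : R := q%:R `^ (- 2^-1).

Lemma qpowE (x y : R) : qpow q (x +i* y) =
  (q%:R `^ x * cos (y * ln q%:R)) +i* (q%:R `^ x * sin (y * ln q%:R)).
Proof. by rewrite /qpow /=; simpc. Qed.

Let sqnormc (z : R[i]) : normc z ^+ 2 = complex.Re z ^+ 2 + complex.Im z ^+ 2.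
Proof. by case: z => x y /=; rewrite sqr_sqrtr// addr_ge0 ?sqr_ge0. Qed.

Let num_den s : density s = cP / (a / q.+1%:R) ^+ 2 *
  (2 * sin (t s)) ^+ 2 / (((a - b) * cos (t s)) ^+ 2 + ((a + b) * sin (t s)) ^+ 2).
Proof.
have half : (2^-1 : R[i]) = (2^-1 : R)%:C by rewrite fmorphV rmorph_nat.
have is_ : (0 +i* 1) * s%:C = 0 +i* s by simpc.
rewrite /plancherel_density /harish_chandra_c !Normc.normcM Normc.normcV is_ half.
have -> : (2^-1)%:C + 0 +i* s = 2^-1 +i* s by simpc.
have -> : - (2^-1)%:C - 0 +i* s = (- 2^-1) +i* (- s) by simpc.
have -> : - (0 +i* s) = 0 +i* (- s) :> R[i] by simpc.
rewrite !qpowE -/a -/b powRr0 !mulNr cosN sinN !mul1r -/(t s).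
rewrite !exprMn !exprVn !sqnormc /=.
have -> : (a * cos (t s) - b * cos (t s)) ^+ 2 +
    (a * sin (t s) - b * - sin (t s)) ^+ 2 =
    (a - b) ^+ 2 * cos (t s) ^+ 2 + (a + b) ^+ 2 * sin (t s) ^+ 2 by ring.
have -> : (cos (t s) - cos (t s)) ^+ 2 + (sin (t s) - - sin (t s)) ^+ 2 =
    2 ^+ 2 * sin (t s) ^+ 2 by ring.
rewrite expr0n addr0 !invfM !invrK; move: (_ + _)^-1 a^-1 => D ia; ring.
Qed.

Let ab : 1 < q%:R :> R -> 0 < a - b.
Proof.
move=> q_gt1; have a1 : 1 < a.
  by rewrite /a powR12_sqrt// -[ltLHS]sqrtr1 ltr_sqrt ?q_gt1// (lt_trans _ q_gt1).
rewrite /b powRN -/a subr_gt0; apply: (lt_trans _ a1).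
by rewrite invf_lt1// (lt_trans _ a1).
Qed.

Let den_gt0 s : 1 < q%:R :> R ->
  0 < ((a - b) * cos (t s)) ^+ 2 + ((a + b) * sin (t s)) ^+ 2.
Proof.
move=> q_gt1; have ab0 := ab q_gt1.
have b0 : 0 <= b by exact: powR_ge0.
apply: (@lt_le_trans _ _ ((a - b) ^+ 2)); first by rewrite exprn_gt0.
rewrite !exprMn -[leLHS]mulr1 -(cos2Dsin2 (t s)) mulrDr lerD2l.
rewrite ler_wpM2r ?sqr_ge0// ler_sqr ?nnegrE; lra.
Qed.

Lemma continuous_density : continuous density.
Proof.
have [q1|q_gt1] := leqP q 1%N.
  have -> : density = cst 0; last by move=> s; exact: cvg_cst.
  apply/funext => s; rewrite /plancherel_density /plancherel_const.
  have -> : ln q%:R = 0 :> R.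
    by case: q q1 => [|[|n]] q1; [rewrite ln0|rewrite ln1|].

  by rewrite mulr0 !mul0r.
have {}q_gt1 : 1 < q%:R :> R by rewrite ltr1n.
have -> : density = (fun s => cP / (a / q.+1%:R) ^+ 2 * (2 * sin (t s)) ^+ 2 /
    (((a - b) * cos (t s)) ^+ 2 + ((a + b) * sin (t s)) ^+ 2)).
  by apply/funext => s; exact: num_den.
move=> s.
have ct : {for s, continuous t} by exact: mulrr_continuous.
have csin : {for s, continuous (fun s => sin (t s))}.
  by apply: continuous_comp => //; exact: continuous_sin.
have ccos : {for s, continuous (fun s => cos (t s))}.
  by apply: continuous_comp => //; exact: continuous_cos.
apply: cvgM; first by apply: cvgMl_tmp; rewrite expr2; apply: cvgM; apply: cvgMl_tmp.
apply: cvgV; first by rewrite gt_eqF// den_gt0.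
by apply: cvgD; apply: cvgM; apply: cvgMl_tmp.
Qed.

Lemma density_ge0 s : 0 <= density s.
Proof.
rewrite mulr_ge0 ?invr_ge0 ?exprn_ge0 ?normc_ge0//.
rewrite /plancherel_const divr_ge0 ?mulr_ge0 ?pi_ge0//.
by case: q => [|n]; [rewrite ln0|rewrite ln_ge0// ler1n].
Qed.

Let plancherel0 : plancherel set0 = 0%E.
Proof. by rewrite /plancherel set0I integral_set0. Qed.

Let plancherel_ge0 A : (0 <= plancherel A)%E.
Proof. by apply: integral_ge0 => s _; rewrite lee_fin density_ge0. Qed.

Let measurable_density (D : set (measurableTypeR R)) :
  measurable_fun D (EFin \o density).
Proof.
apply/measurable_EFinP; apply: measurable_funTS.
exact: continuous_measurable_fun continuous_density.
Qed.

Let plancherel_sigma_additive : semi_sigma_additive plancherel.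
Proof.
move=> /= F mF tF mUF; rewrite /plancherel; apply: cvg_toP.
  apply: ereal_nondecreasing_is_cvgn => m n mn.
  apply: lee_sum_nneg_natr => // k _ _.
  by apply: integral_ge0 => /= x Fkx; rewrite lee_fin density_ge0.
rewrite setI_bigcupl ge0_integral_bigcup//=.
- by move=> k; apply: (measurableI _ _ (mF k)); exact: measurable_itv.
- by move=> x _; rewrite lee_fin density_ge0.
- exact: trivIset_setIr.
Qed.

HB.instance Definition _ := isMeasure.Build _ _ _ plancherel
  plancherel0 plancherel_ge0 plancherel_sigma_additive.

Let plancherel_fin : fin_num_fun plancherel.
Proof.
move=> A mA; rewrite ge0_fin_numE ?plancherel_ge0//.
apply: (@le_lt_trans _ _ (\int[lebesgue_measure]_(s in `[0%R, tau]) (density s)%:E)%E).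
  apply: ge0_subset_integral => //; first exact: measurableI.
    by move=> x _; rewrite lee_fin density_ge0.
apply: integrable_lty; first exact: measurable_itv.
apply: continuous_compact_integrable; first exact: segment_compact.
exact: continuous_subspaceT continuous_density.
Qed.

HB.instance Definition _ := @Measure_isFinite.Build _ _ _ plancherel plancherel_fin.
End plancherel.
Arguments plancherel R q A : clear implicits.

Section operators.
Context {R : realType}.
Implicit Types U W : normedModType R[i].

Definition opnorm U (phi : U -> R[i]^o) : R :=
  sup [set normc (phi x) | x in [set x : U | `|x| <= 1]].

Definition nuclear U W (T : {linear U -> W}) :=
  continuous T /\
  exists (phi : nat -> {linear U -> R[i]^o}) (y : nat -> W),
    [/\ forall n, continuous (phi n),
        (\sum_(n <oo) (opnorm (phi n) * complex.Re `|y n|)%:E < +oo)%E &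
        forall x, series (fun n => phi n x *: y n) @ \oo --> T x].

Definition sums_to (u : nat -> R[i]) (l : R[i]) :=
  series (u : nat -> R[i]^o) @ \oo --> (l : R[i]^o).
End operators.

Section helgason.
Context {R : realType} {q : nat} {X : homogeneous_tree q} {o : X}.
Local Notation phase_space := (boundary o * measurableTypeR R)%type.

Definition finitely_supported (f : X -> R[i]) := finite_set [set y | f y != 0].

(* The Fourier-Helgason transform of a finitely supported function. *)
Definition fourier0 (f : X -> R[i]) (ws : phase_space) : R[i] :=
  \sum_(y \in [set: X])
    f y * qpow q ((2^-1 +i* ws.2) * (height ws.1 y)%:C).

Definition phase : set phase_space := [set: boundary o] `*` `[0%R, tau R q].

Context (nu : probability (boundary o) R).

Definition pmeas := (nu \x plancherel R q)%E.
HB.instance Definition _ := Measure.on pmeas.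

(* F is a representative of the extension of fourier0 to f by continuity, as a
   map from L^2(X) to L^2(phase). *)
Definition is_fourier (f : l2 R X) (F : phase_space -> R[i]) :=
  cmeasurable_fun phase F /\
  forall phi : nat -> l2 R X,
    (forall n, finitely_supported (phi n)) -> phi @ \oo --> f ->
    (\int[pmeas]_(ws in phase) ((normc (fourier0 (phi n) ws - F ws)) ^+ 2)%:E)%E
      @[n --> \oo] --> 0%E.

(* some representative; two of them agree almost everywhere *)
Definition fourier (f : l2 R X) : phase_space -> R[i] :=
  xget (fun=> 0) [set F | is_fourier f F].

(* X is countable and discrete, so that joint measurability on X * phase is
   measurability of all sections. *)
Definition measurable_symbol (sigma : X -> phase_space -> R[i]) :=
  forall x, cmeasurable_fun phase (sigma x).

Definition psdo_integrand (sigma : X -> phase_space -> R[i]) (f : X -> R[i])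
    (x : X) (ws : phase_space) : R[i] :=
  qpow q ((2^-1 -i* ws.2) * (height ws.1 x)%:C) *
  sigma x ws * fourier0 f ws.

(* The integral defining T_sigma converges absolutely on finitely supported
   functions, and T extends T_sigma. *)
Definition extends_psdo (sigma : X -> phase_space -> R[i])
    (T : l2 R X -> l2 R X) :=
  forall f : l2 R X, finitely_supported f -> forall x,
    cintegrable pmeas phase (psdo_integrand sigma f x) /\
    T f x = cintegral pmeas phase (psdo_integrand sigma f x).
End helgason.

(* Main.v *)
Require Import Defs.
From mathcomp Require Import all_boot all_order all_algebra.
From mathcomp Require Import all_classical all_reals all_analysis.
From mathcomp Require Import measurable_realfun complex zify ring lra.
Set Implicit Arguments.
Unset Strict Implicit.
Unset Printing Implicit Defensive.
Import Order.TTheory GRing.Theory Num.Theory numFieldNormedType.Exports.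
Local Open Scope classical_set_scope.
Local Open Scope ring_scope.
Local Open Scope complex_scope.

(* Write K(x, y) = T delta_y (x). The transform of delta_y is the function
   e_y(w, s) = q^((1/2 + is) h_w(y)), so the definition of T_sigma reads
     K(x, y) = int a_x e_y,  where  a_x(w, s) = q^((1/2 - is) h_w(x)) sigma(x, w, s).
   The functions e_y are orthonormal, and an integrable function whose product
   with each of them has integral zero vanishes almost everywhere. Hence, for v
   in l2, a_x is the conjugate of H v if and only if v is the conjugate of the
   row K(x, .). If K(x, y) = sum_k f_k(x) g_k(y), which nuclearity provides, the
   L^2 continuity of H and absolute summability show that the two series of the
   statement converge almost everywhere to the conjugates of H (conj K(x, .)) and
   of H K(., x), respectively; they agree exactly when K is hermitian, i.e. when
   T is self-adjoint.

   Orthonormality: the integral of e_x times the conjugate of e_y over the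
   boundary is the spherical function of d(x, y), whose integral against the
   Plancherel density is elementary. Completeness: suppose that F e_y has integral
   zero for all y. The sum of e_y over the neighbours y of x is
   2 q^(1/2) cos (s log q) e_x, so F e_y g(s) has integral zero for every polynomial
   g in cos (s log q), and by Bernstein approximation for every indicator g of an
   interval; finally, for an edge z' - z with |z| = |z'| + 1, the indicator of the
   cylinder of z times a nowhere vanishing function of s is a combination of e_z
   and e_z' with coefficients depending on s only. *)

(** * Distances and heights *)

(** The conjugations are arranged so that [conj (H (conj g))] integrated against [e_y] returns
    [g(y)]. The series with terms [f_k(x) conj (H (conj g_k))] therefore encodes [y -> K(x, y)], and
    the one with terms [conj (H f_k) conj (g_k(x))] encodes [y -> conj K(y, x)]. The obstacle is
    that [H] on l2 is a choice of representatives, linear only almost everywhere. Termwise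
    transforms are handled through L^2 bounds: when the norms are summable, a series converges both
    almost everywhere and in L^2, to the same limit. As the phase space has finite measure and each
    [e_y] is bounded, L^2 errors control all the pairings, and no constant has to be sharp. The
    integrals of the spherical functions are elementary because the inverse of
    [|q^(1/2+is) - q^(-1/2-is)|^2] is a multiple of a Poisson kernel, with geometrically decaying
    cosine coefficients. These are found from a linear recursion; their boundedness singles out the
    decaying solution. *)

Section tree_geometry.
Context {q : nat} {X : homogeneous_tree q}.
Implicit Types u v x y z : X.

Lemma geodesic_walk v x :
  exists w : nat -> X, [/\ nbwalk w (dist v x), w 0%N = v & w (dist v x) = x].
Proof.
rewrite /dist; case: ex_minnP => n /asboolP[p [vp pl pn]] mn.
pose w k := nth v (v :: p) k.
have wlast k : (k <= n)%N -> w k = last v (take k p).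
  move=> kn; rewrite -nth_last size_take pn.
  have -> : (if (k < n)%N then k else n) = k by case: ltnP; lia.
  by case: k kn => [|k] kn; rewrite /w ?take0//= nth_take.
exists w; split=> //; last by rewrite wlast// -pn take_size.
split=> k kn; first by apply: (pathP _ vp); rewrite pn.
(* A return [w k.+2 = w k] could be cut out of the path, leaving one shorter by two edges. *)
move=> ek; have : (n <= n - 2)%N; last by lia.
apply: mn; apply/asboolP; exists (take k p ++ drop k.+2 p).
have dk : drop k p = w k.+1 :: w k.+2 :: drop k.+2 p.
  by rewrite (drop_nth v) ?pn; [rewrite (drop_nth v) ?pn|lia].
move: vp pl; rewrite -{1 2}(cat_take_drop k p) dk cat_path last_cat /=.
rewrite -wlast; last by lia.
move=> /and4P[p1 _ _ p2] pl; split.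
- by rewrite cat_path p1 -wlast -?ek//; lia.
- by rewrite last_cat -wlast -?ek//; lia.
- by rewrite size_cat size_take size_drop pn; case: ltnP; lia.
Qed.

Lemma distxx v : dist v v = 0%N.
Proof. by apply: (@nbwalk_dist _ _ (fun=> v) 0); split. Qed.

Lemma dist_eq0 v x : dist v x = 0%N -> x = v.
Proof. by have [w [_ w0 wx]] := geodesic_walk v x; move=> d0; rewrite -wx d0. Qed.

Lemma dist1 v x : adj v x -> dist v x = 1%N.
Proof.
move=> vx; pose w k := if k is 0%N then v else x.
by apply: (@nbwalk_dist _ _ w 1); split => -[].
Qed.

(** [p] is the last vertex but one of the geodesic from [v]. To any other neighbour that geodesic
    extends without backtracking, so the distance grows. *)
Lemma toward v x : x <> v -> exists p, [/\ adj x p, dist v x = (dist v p).+1 &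
  forall y, adj x y -> y <> p -> dist v y = (dist v x).+1].
Proof.
move=> xv; have [w [wL w0 wx]] := geodesic_walk v x.
have L0 : (0 < dist v x)%N by rewrite lt0n; apply/eqP => /dist_eq0.
move: (dist v x) L0 wL wx => [//|L] _ wL wx.
exists (w L); split.
- by rewrite adj_sym -wx; case: wL => + _; apply.
- rewrite -w0 (@nbwalk_dist _ _ w L)//.
  by case: wL => a b; split=> k h; [apply: a|apply: b]; lia.
move=> y xy yw; pose w' k := if (k <= L.+1)%N then w k else y.
have -> : v = w' 0%N by rewrite /w' w0.
have -> : y = w' L.+2 by rewrite /w' ltnn.
apply: (@nbwalk_dist _ _ w' L.+2); case: wL => a b; split=> k h; rewrite /w'.
  have [kL|kL] := ltnP k L.+1; first by rewrite ltnW//; exact: a.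
  have -> : k = L.+1 by lia.
  by rewrite leqnn wx.
have [kL|kL] := ltnP k.+1 L.+1.
  have -> : (k <= L.+1)%N by lia.
  exact: b.
have -> : k = L by lia.
by rewrite leqnSn.
Qed.

Lemma dist_adj v x y : adj x y ->
  dist v y = (dist v x).+1 \/ dist v x = (dist v y).+1.
Proof.
move=> xy; have [<-|/eqP xv] := eqVneq x v.
  by left; rewrite distxx (dist1 xy).
have [p [xp dp H]] := toward xv.
have [->|/eqP yp] := eqVneq y p; first by right.
by left; exact: H.
Qed.

Lemma closer_unique v x y z : adj x y -> adj x z ->
  dist v x = (dist v y).+1 -> dist v x = (dist v z).+1 -> y = z.
Proof.
move=> xy xz dy dz.
have xv : x <> v by move=> e; move: dy; rewrite e distxx.
have [p [xp dp H]] := toward xv.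
have E t : adj x t -> dist v x = (dist v t).+1 -> t = p.
  by move=> xt dt; apply: contrapT => tp; have := H t xt tp; lia.
by rewrite (E y)// (E z).
Qed.

(** The edge [a b] leads away from [u] and towards [v], so the geodesic from [u] to [v] crosses it.
    The induction moves the edge one step back, to [c a]: were [c] nearer to [v] than [a], the
    vertex [a] would have two neighbours nearer to [v]. *)
Lemma dist_through_edge u v a b : adj a b ->
  dist u b = (dist u a).+1 -> dist v a = (dist v b).+1 ->
  dist u v = ((dist u a).+1 + dist b v)%N.
Proof.
move: {1}(dist u a) (erefl (dist u a)) => n; elim: n a b => [|n IH] a b na ab ub va.
  by rewrite -(dist_eq0 (esym na)) distxx dist_sym va dist_sym.
have au : a <> u by move=> e; move: na; rewrite e distxx.
have [c [ac dc H]] := toward au.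
have cb : c <> b by move=> e; rewrite e in dc; lia.
have vc : dist v c = (dist v a).+1.
  have [//|vc] := dist_adj v ac.
  by case: cb; apply: (closer_unique ac ab vc).
rewrite (IH c a) //; [rewrite (dist_sym a) va (dist_sym b); lia|lia|].
by rewrite adj_sym.
Qed.

Lemma dist_triangle x y z : (dist x z <= dist x y + dist y z)%N.
Proof.
move: {2}(dist y z) (erefl (dist y z)) => n; elim: n z => [|n IH] z dn.
  by rewrite (dist_eq0 dn); lia.
have zy : z <> y by move=> e; move: dn; rewrite e distxx.
have [p [zp dp _]] := toward zy.
have := IH p; have := dist_adj x zp; lia.
Qed.

Lemma parent_exists o z : z <> o -> exists z', adj z' z /\ dist o z = (dist o z').+1.
Proof. by move=> /toward[p [zp dp _]]; exists p; rewrite adj_sym. Qed.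

End tree_geometry.

(** * Heights as eventually constant sequences along a ray *)

Section heights.
Context {R : realType} {q : nat} {X : homogeneous_tree q} {o : X}.
Implicit Types (w : boundary o) (x y z : X).
Local Notation pt w n := ((w : ray o) n).
Local Notation height w x := (@height q X R o w x).

Lemma ray_dist0 w n : dist o (pt w n) = n.
Proof.
by have := @ray_geodesic q X o w 0 n; rewrite ray_start; lia.
Qed.

Lemma ray_adj w n : adj (pt w n) (pt w n.+1).
Proof.
have /toward[p [np dp _]] : pt w n.+1 <> pt w n.
  by move=> e; have := ray_dist0 w n; rewrite -e ray_dist0; lia.
have := dp; rewrite ray_geodesic => e.
have /dist_eq0 <- : dist (pt w n) p = 0%N by lia.
by rewrite adj_sym.
Qed.

(** The distance cannot decrease along the ray for ever. Once it has increased it keeps increasing: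
    at a later decrease the previous and the next vertex of the ray would both be nearer to [x],
    hence equal, and the ray would turn back. *)
Lemma ray_leaves w x : exists N, forall m, (N <= m)%N ->
  (dist x (pt w m) + N = dist x (pt w N) + m)%N.
Proof.
have [N NP] : exists N, dist x (pt w N.+1) = (dist x (pt w N)).+1.
  apply: contrapT => H.
  have D N : dist x (pt w N) = (dist x (pt w N.+1)).+1.
    have [e|//] := dist_adj x (ray_adj w N).
    by case: H; exists N.
  have : forall N, (dist x (pt w N) + N = dist x (pt w 0%N))%N.
    by elim=> [|N IH]; [rewrite addn0|rewrite -IH (D N); lia].
  by move=> /(_ (dist x (pt w 0%N)).+1); lia.
have U n : dist x (pt w (N + n)%N.+1) = (dist x (pt w (N + n)%N)).+1.
  elim: n => [|n IH]; first by rewrite addn0.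
  rewrite addnS; have [//|e] := dist_adj x (ray_adj w (N + n)%N.+1).
  have := @closer_unique q X x (pt w (N + n)%N.+1) (pt w (N + n)%N.+2) (pt w (N + n)%N).
  rewrite (adj_sym (pt w (N + n)%N.+1) (pt w (N + n)%N)) !ray_adj => /(_ isT isT e IH) e'.
  by have := ray_dist0 w (N + n)%N.+2; rewrite e' ray_dist0; lia.
exists N => m Nm; rewrite -(subnKC Nm).
elim: (m - N)%N => [|n IH]; first by rewrite addn0.
by rewrite addnS U; lia.
Qed.

Lemma heightE w x N : (forall m, (N <= m)%N ->
    (dist x (pt w m) + N = dist x (pt w N) + m)%N) ->
  height w x = N%:R - (dist x (pt w N))%:R.
Proof.
move=> H; rewrite /Defs.height; apply: lim_near_cst => //.
near=> m.
have Nm : (N <= m)%N by near: m; exact: nbhs_infty_ge.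
have := congr1 (fun n => n%:R : R) (H m Nm); rewrite !natrD; lra.
Unshelve. all: by end_near.
Qed.

Lemma heightP w x : exists N, forall m, (N <= m)%N ->
  height w x = m%:R - (dist x (pt w m))%:R.
Proof.
have [N NP] := ray_leaves w x; exists N => m Nm; apply: heightE => k mk.
by have := NP m Nm; have := NP k (leq_trans Nm mk); lia.
Qed.

Lemma height_root w : height w o = 0.
Proof. by have [N /(_ N (leqnn N))->] := heightP w o; rewrite ray_dist0 subrr. Qed.

Lemma cylinderP w z : cylinder z w <-> pt w (dist o z) = z.
Proof.
by split=> [[n nz]|<-]; [rewrite -nz ray_dist0|exists (dist o z)].
Qed.

(** The hypothesis puts [z] on the geodesic from [o] to the [m]-th vertex. A step from that vertex
    towards [z] also approaches [o], so it goes back along the ray. *)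
Lemma ray_cylinder w z m : (dist o (pt w m) = dist o z + dist z (pt w m))%N ->
  cylinder z w.
Proof.
elim: m => [|m IH] e.
  have /dist_eq0 ez : dist z (pt w 0%N) = 0%N by move: e; rewrite ray_dist0; lia.
  by exists 0%N.
have [/dist_eq0 ez|/eqP zm] := eqVneq (dist z (pt w m.+1)) 0%N; first by exists m.+1.
have /toward[p [wp dp _]] : pt w m.+1 <> z by move=> e'; rewrite e' distxx in zm.
have op : dist o (pt w m.+1) = (dist o p).+1.
  have := dist_triangle o z p; have := dist_adj o wp; lia.
have ep : p = pt w m.
  apply: (closer_unique wp _ op); first by rewrite adj_sym ray_adj.
  by rewrite !ray_dist0.
by apply: IH; rewrite -ep; lia.
Qed.

(** Otherwise the edge [z' z] would lie on the geodesic from [o] to a vertex of the ray, and the ray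
    would pass through [z]. *)
Lemma ray_away w z' z m : adj z' z -> dist o z = (dist o z').+1 ->
  ~ cylinder z w -> dist z (pt w m) = (dist z' (pt w m)).+1.
Proof.
move=> zz oz nz; rewrite ![dist _ (pt w m)]dist_sym.
have [//|e] := dist_adj (pt w m) zz.
case: nz; apply: (@ray_cylinder w z m).
by rewrite (dist_through_edge zz oz e) oz.
Qed.

Lemma height_off_cylinder w z' z : adj z' z -> dist o z = (dist o z').+1 ->
  ~ cylinder z w -> height w z = height w z' - 1.
Proof.
move=> zz oz nz; have [N NP] := heightP w z; have [M MP] := heightP w z'.
rewrite (NP (maxn N M) (leq_maxl _ _)) (MP (maxn N M) (leq_maxr _ _)).
by rewrite (ray_away _ zz oz nz) -natr1; ring.
Qed.

Lemma ray_cylinder_toward w z' z m : adj z' z -> dist o z = (dist o z').+1 ->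
  cylinder z w -> (dist o z <= m)%N -> dist z (pt w m) = (m - dist o z)%N /\
  dist z' (pt w m) = (dist z (pt w m)).+1.
Proof.
move=> zz oz /cylinderP ez zm.
have dz : dist z (pt w m) = (m - dist o z)%N by rewrite -{1}ez ray_geodesic; lia.
split=> //; rewrite ![dist _ (pt w m)]dist_sym.
have [|//] := dist_adj (pt w m) zz; rewrite dist_sym dz.
have := dist_triangle o z' (pt w m); rewrite ray_dist0 (dist_sym (pt w m)); lia.
Qed.

(** When [x] is on the side of [z'], the geodesic from [x] to a far vertex of a ray through [z]
    crosses the edge [z' z]. The height then depends on [x] only through its distance to [z]. *)
Lemma height_on_cylinder w x z' z : adj z' z -> dist o z = (dist o z').+1 ->
  cylinder z w -> dist x z = (dist x z').+1 ->
  height w x = (dist o z)%:R - (dist x z)%:R.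
Proof.
move=> zz oz wz xz; have [N NP] := heightP w x.
pose m := maxn N (dist o z).
rewrite (NP m (leq_maxl _ _)).
have [d1 d2] := ray_cylinder_toward zz oz wz (leq_maxr _ _ : (_ <= m)%N).
have e : dist (pt w m) z' = (dist (pt w m) z).+1 by rewrite !(dist_sym (pt w m)).
rewrite (dist_through_edge zz xz e) d1 -xz.
rewrite natrD natrB ?leq_maxr//; ring.
Qed.

Lemma height_cylinder w z : cylinder z w -> height w z = (dist o z)%:R.
Proof.
move=> /cylinderP wz; have [N NP] := heightP w z.
pose m := maxn N (dist o z).
rewrite (NP m (leq_maxl _ _)) -{1}wz ray_geodesic.
have -> : (dist o z - m + (m - dist o z) = m - dist o z)%N.
  by have := leq_maxr N (dist o z); lia.
by rewrite natrB ?leq_maxr//; ring.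
Qed.

Lemma height_nbrs w y : exists p, [/\ adj y p, height w p = height w y + 1 &
  forall z, adj y z -> z <> p -> height w z = height w y - 1].
Proof.
have [N NP] := ray_leaves w y.
have yfar m : (N < m)%N -> y <> pt w m.
  by move=> Nm e; have := NP m (ltnW Nm); rewrite -e distxx; lia.
have [p [yp dp _]] := toward (yfar N.+1 (ltnSn N)).
(* The neighbour chosen for one vertex of the ray serves for all later ones: otherwise the triangle
   inequality through [p] would contradict the growth of the distance from [y]. *)
have pP m : (N < m)%N -> dist (pt w m) y = (dist (pt w m) p).+1.
  move=> Nm; rewrite -(subnKC Nm); elim: (m - N.+1)%N => [|k IH]; first by rewrite addn0.
  rewrite addnS; have [e|//] := dist_adj (pt w (N.+1 + k)%N.+1) yp.
  have := dist_triangle p (pt w (N.+1 + k)%N) (pt w (N.+1 + k)%N.+1).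
  rewrite (dist1 (ray_adj w _)) !(dist_sym p) e.
  have := NP (N.+1 + k)%N; have := NP (N.+1 + k)%N.+1.
  rewrite !(dist_sym y); lia.
exists p; split=> // [|z yz zp].
  have [M MP] := heightP w y; have [L LP] := heightP w p.
  pose m := maxn N.+1 (maxn M L).
  have mM : (M <= m)%N by rewrite /m; lia.
  have mL : (L <= m)%N by rewrite /m; lia.
  have mN : (N < m)%N by rewrite /m; lia.
  by rewrite (MP m mM) (LP m mL) (dist_sym y) (pP m mN) dist_sym -natr1; ring.
have [M MP] := heightP w y; have [L LP] := heightP w z.
pose m := maxn N.+1 (maxn M L).
have mM : (M <= m)%N by rewrite /m; lia.
have mL : (L <= m)%N by rewrite /m; lia.
have mN : (N < m)%N by rewrite /m; lia.
rewrite (MP m mM) (LP m mL) (dist_sym y) (dist_sym z).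
have [->|e] := dist_adj (pt w m) yz; first by rewrite -natr1; ring.
by case: zp; apply: (closer_unique yz yp e (pP m mN)).
Qed.
End heights.

(** * Complex integrals *)

Section complex_integral.
Context {R : realType} d (T : measurableType d) (mu : {measure set T -> \bar R}).
Context (D : set T) (mD : measurable D).
Implicit Types (f g : T -> R[i]) (z c : R[i]).

Lemma normcE z : normc z = Num.sqrt (complex.Re z ^+ 2 + complex.Im z ^+ 2).
Proof. by case: z. Qed.

Lemma sqr_normcE z : normc z ^+ 2 = complex.Re z ^+ 2 + complex.Im z ^+ 2.
Proof. by rewrite normcE sqr_sqrtr// addr_ge0 ?sqr_ge0. Qed.

Lemma Re_le_normc z : `|complex.Re z| <= normc z.
Proof.
by rewrite -ler_sqr ?nnegrE ?normc_ge0// sqr_normcE (real_normK (num_real _)) lerDl sqr_ge0.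
Qed.

Lemma Im_le_normc z : `|complex.Im z| <= normc z.
Proof.
by rewrite -ler_sqr ?nnegrE ?normc_ge0// sqr_normcE (real_normK (num_real _)) lerDr sqr_ge0.
Qed.

Lemma normc_le_ReIm z : normc z <= `|complex.Re z| + `|complex.Im z|.
Proof.
rewrite -ler_sqr ?nnegrE ?normc_ge0 ?addr_ge0// sqr_normcE sqrrD !(real_normK (num_real _)).
by rewrite addrAC lerDl mulrn_wge0// mulr_ge0.
Qed.

Lemma ReM z c : complex.Re (z * c) =
  complex.Re z * complex.Re c - complex.Im z * complex.Im c.
Proof. by case: z c => [? ?] [? ?]. Qed.

Lemma ImM z c : complex.Im (z * c) =
  complex.Re z * complex.Im c + complex.Im z * complex.Re c.
Proof. by case: z c => [? ?] [? ?]. Qed.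

Lemma ReD z c : complex.Re (z + c) = complex.Re z + complex.Re c.
Proof. by case: z c => [? ?] [? ?]. Qed.

Lemma ImD z c : complex.Im (z + c) = complex.Im z + complex.Im c.
Proof. by case: z c => [? ?] [? ?]. Qed.

Lemma normcJ z : normc z^*%C = normc z.
Proof. by case: z => a b /=; rewrite sqrrN. Qed.

Lemma conjcM z c : (z * c)^*%C = z^*%C * c^*%C. Proof. exact: rmorphM. Qed.
Lemma conjcD z c : (z + c)^*%C = z^*%C + c^*%C. Proof. exact: rmorphD. Qed.
Lemma conjcB z c : (z - c)^*%C = z^*%C - c^*%C. Proof. exact: rmorphB. Qed.
Lemma conjcX z n : (z ^+ n)^*%C = z^*%C ^+ n. Proof. exact: rmorphXn. Qed.

Lemma ReJ z : complex.Re z^*%C = complex.Re z. Proof. by case: z. Qed.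
Lemma ImJ z : complex.Im z^*%C = - complex.Im z. Proof. by case: z. Qed.

Lemma cmeasurable_cst c : cmeasurable_fun D (fun=> c).
Proof. by split; exact: measurable_cst. Qed.

Lemma cmeasurableD f g : cmeasurable_fun D f -> cmeasurable_fun D g ->
  cmeasurable_fun D (fun x => f x + g x).
Proof.
move=> [f1 f2] [g1 g2]; split.
  by under eq_fun do rewrite ReD; exact: measurable_funD.
by under eq_fun do rewrite ImD; exact: measurable_funD.
Qed.

Lemma cmeasurableM f g : cmeasurable_fun D f -> cmeasurable_fun D g ->
  cmeasurable_fun D (fun x => f x * g x).
Proof.
move=> [f1 f2] [g1 g2]; split.
  by under eq_fun do rewrite ReM; apply: measurable_funB; exact: measurable_funM.
by under eq_fun do rewrite ImM; apply: measurable_funD; exact: measurable_funM.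
Qed.

Lemma cmeasurableJ f : cmeasurable_fun D f -> cmeasurable_fun D (fun x => (f x)^*%C).
Proof.
move=> [f1 f2]; split; first by under eq_fun do rewrite ReJ.
by under eq_fun do rewrite ImJ; exact: measurable_funN.
Qed.

Lemma cmeasurableB f g : cmeasurable_fun D f -> cmeasurable_fun D g ->
  cmeasurable_fun D (fun x => f x - g x).
Proof.
move=> mf mg; under eq_fun do rewrite -mulN1r.
by apply: cmeasurableD => //; apply: cmeasurableM => //; exact: cmeasurable_cst.
Qed.

Lemma cmeasurable_sum (I : Type) (s : seq I) (F : I -> T -> R[i]) :
  (forall i, cmeasurable_fun D (F i)) ->
  cmeasurable_fun D (fun x => \sum_(i <- s) F i x).
Proof.
move=> mF; elim: s => [|i s IH].
  by under eq_fun do rewrite big_nil; exact: cmeasurable_cst.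
by under eq_fun do rewrite big_cons; exact: cmeasurableD.
Qed.

Lemma measurable_normc f : cmeasurable_fun D f ->
  measurable_fun D (fun x => normc (f x)).
Proof.
move=> [f1 f2]; under eq_fun do rewrite normcE.
apply: (measurableT_comp (continuous_measurable_fun (@sqrt_continuous R))).
by apply: measurable_funD; exact: measurable_funX.
Qed.

Lemma cintegrableP f : cintegrable mu D f <->
  mu.-integrable D (EFin \o (fun x => complex.Re (f x))) /\
  mu.-integrable D (EFin \o (fun x => complex.Im (f x))).
Proof.
split=> [[mf fi]|[iR iI]].
  have iN : mu.-integrable D (EFin \o (fun x => normc (f x))).
    apply/integrableP; split; first exact/measurable_EFinP/measurable_normc.
    under eq_integral do rewrite /= ger0_norm ?normc_ge0//.
    exact: fi.
  case: mf => mR mI; split; apply: le_integrable iN => //.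
  - exact/measurable_EFinP.
  - by move=> x _ /=; rewrite lee_fin [leRHS]ger0_norm ?normc_ge0// Re_le_normc.
  - exact/measurable_EFinP.
  - by move=> x _ /=; rewrite lee_fin [leRHS]ger0_norm ?normc_ge0// Im_le_normc.
have mf : cmeasurable_fun D f.
  by split; apply/measurable_EFinP; [case/integrableP: iR|case/integrableP: iI].
split=> //.
have := integrableD mD (integrable_abse iR) (integrable_abse iI).
move=> /integrableP[ms]; apply: le_lt_trans; apply: ge0_le_integral => //.
- by move=> x _; rewrite lee_fin normc_ge0.
- exact/measurable_EFinP/measurable_normc.
- by apply: measurableT_comp.
- by move=> x _ /=; rewrite lee_fin [leRHS]ger0_norm ?addr_ge0// normc_le_ReIm.
Qed.

Lemma cintegrableD f g : cintegrable mu D f -> cintegrable mu D g ->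
  cintegrable mu D (fun x => f x + g x).
Proof.
move=> /cintegrableP[f1 f2] /cintegrableP[g1 g2]; apply/cintegrableP; split.
  by under eq_fun do rewrite ReD; exact: (integrableD mD f1 g1).
by under eq_fun do rewrite ImD; exact: (integrableD mD f2 g2).
Qed.

Lemma cintegralD f g : cintegrable mu D f -> cintegrable mu D g ->
  cintegral mu D (fun x => f x + g x) = cintegral mu D f + cintegral mu D g.
Proof.
move=> /cintegrableP[f1 f2] /cintegrableP[g1 g2]; rewrite /cintegral.
under eq_fun do rewrite ReD; under [X in _ +i* Rintegral _ _ X]eq_fun do rewrite ImD.
by rewrite !RintegralD.
Qed.

Lemma cintegrableM_bounded f g M : cintegrable mu D f -> cmeasurable_fun D g ->
  (forall x, D x -> normc (g x) <= M) ->
  cintegrable mu D (fun x => f x * g x).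
Proof.
move=> [mf fi] mg gM; split; first exact: cmeasurableM.
apply: (@le_lt_trans _ _ (\int[mu]_(x in D) (`|M|%:E * (normc (f x))%:E))%E).
  apply: ge0_le_integral => //.
  - by move=> x _; rewrite lee_fin normc_ge0.
  - by apply/measurable_EFinP/measurable_normc; exact: cmeasurableM.
  - by apply: measurable_funeM; exact/measurable_EFinP/measurable_normc.
  - move=> x Dx; rewrite -EFinM lee_fin Normc.normcM mulrC ler_wpM2r ?normc_ge0//.
    exact: le_trans (gM x Dx) (ler_norm _).
rewrite ge0_integralZl//; first exact: lte_mul_pinfty.
  exact/measurable_EFinP/measurable_normc.
by move=> x _; rewrite lee_fin normc_ge0.
Qed.

Lemma cintegrableZ c f : cintegrable mu D f -> cintegrable mu D (fun x => c * f x).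
Proof.
move=> fi; under eq_fun do rewrite mulrC.
by apply: cintegrableM_bounded fi (cmeasurable_cst c) (fun x _ => lexx _).
Qed.

Lemma cintegralZ c f : cintegrable mu D f ->
  cintegral mu D (fun x => c * f x) = c * cintegral mu D f.
Proof.
move=> /cintegrableP[f1 f2]; rewrite /cintegral.
have Zi (r : R) (g : T -> R) : mu.-integrable D (EFin \o g) -> mu.-integrable D (EFin \o (fun x => r * g x)).
  by move=> gi; exact: (integrableZl mD r gi).
under eq_fun do rewrite ReM; under [X in _ +i* Rintegral _ _ X]eq_fun do rewrite ImM.
rewrite RintegralB ?RintegralD ?RintegralZl//; try exact: Zi.
by case: c => a b /=; simpc.
Qed.

Lemma cintegralB f g : cintegrable mu D f -> cintegrable mu D g ->
  cintegral mu D (fun x => f x - g x) = cintegral mu D f - cintegral mu D g.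
Proof.
move=> fi gi; under eq_fun do rewrite -mulN1r.
by rewrite cintegralD ?cintegralZ ?mulN1r//; exact: cintegrableZ.
Qed.

Lemma cintegrableB f g : cintegrable mu D f -> cintegrable mu D g ->
  cintegrable mu D (fun x => f x - g x).
Proof.
move=> fi gi; under eq_fun do rewrite -mulN1r.
by apply: cintegrableD => //; exact: cintegrableZ.
Qed.

Lemma cintegrable0 : cintegrable mu D (fun=> 0).
Proof.
split; first exact: cmeasurable_cst.
by rewrite integral0_eq// => x _; rewrite Normc.normc0.
Qed.

Lemma cintegral0 : cintegral mu D (fun=> 0) = 0.
Proof. by rewrite /cintegral !Rintegral_cst// !mul0r. Qed.

Lemma cintegrable_sum (I : Type) (s : seq I) (F : I -> T -> R[i]) :
  (forall i, cintegrable mu D (F i)) ->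
  cintegrable mu D (fun x => \sum_(i <- s) F i x).
Proof.
move=> iF; elim: s => [|i s IH].
  by under eq_fun do rewrite big_nil; exact: cintegrable0.
by under eq_fun do rewrite big_cons; exact: cintegrableD.
Qed.

Lemma cintegral_sum (I : Type) (s : seq I) (F : I -> T -> R[i]) :
  (forall i, cintegrable mu D (F i)) ->
  cintegral mu D (fun x => \sum_(i <- s) F i x) = \sum_(i <- s) cintegral mu D (F i).
Proof.
move=> iF; elim: s => [|i s IH].
  by under eq_fun do rewrite big_nil; rewrite big_nil cintegral0.
under eq_fun do rewrite big_cons; rewrite big_cons cintegralD ?IH//.
exact: cintegrable_sum.
Qed.

Lemma cintegrableJ f : cintegrable mu D f -> cintegrable mu D (fun x => (f x)^*%C).
Proof.
move=> [mf fi]; split; first exact: cmeasurableJ.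
by under eq_integral do rewrite normcJ.
Qed.

Lemma cintegralJ f : cintegrable mu D f ->
  cintegral mu D (fun x => (f x)^*%C) = (cintegral mu D f)^*%C.
Proof.
move=> /cintegrableP[f1 f2]; rewrite /cintegral.
under eq_fun do rewrite ReJ; under [X in _ +i* Rintegral _ _ X]eq_fun do rewrite ImJ -mulN1r.
by rewrite RintegralZl//= mulN1r.
Qed.

Lemma cintegrable_eq f g : {in D, f =1 g} -> cintegrable mu D f -> cintegrable mu D g.
Proof.
move=> fg [[f1 f2] fi]; split.
  split; [apply: eq_measurable_fun f1|apply: eq_measurable_fun f2];
    by move=> x xD; rewrite fg.
have -> : (\int[mu]_(x in D) (normc (g x))%:E = \int[mu]_(x in D) (normc (f x))%:E)%E.
  by apply: eq_integral => x xD; rewrite fg.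
exact: fi.
Qed.

Lemma cintegral_eq f g : {in D, f =1 g} -> cintegral mu D f = cintegral mu D g.
Proof.
by move=> fg; rewrite /cintegral; congr (_ +i* _); apply: eq_Rintegral => x xD; rewrite fg.
Qed.

Lemma cintegral_ae f g : cmeasurable_fun D f -> cmeasurable_fun D g ->
  {ae mu, forall x, D x -> f x = g x} -> cintegral mu D f = cintegral mu D g.
Proof.
move=> [f1 f2] [g1 g2] fg; rewrite /cintegral /Rintegral.
congr (fine _ +i* fine _); apply: ae_eq_integral => //; try exact/measurable_EFinP.
  by apply: filterS fg => x H Dx; rewrite /= H.
by apply: filterS fg => x H Dx; rewrite /= H.
Qed.

(** The factor 2 comes from bounding the real and the imaginary part separately; it is harmless in
    limit arguments. *)
Lemma normc_cintegral_le f : cintegrable mu D f ->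
  ((normc (cintegral mu D f))%:E <= 2%:E * \int[mu]_(x in D) (normc (f x))%:E)%E.
Proof.
move=> fi; have [mf nf] := fi; have [f1 f2] := (cintegrableP f).1 fi.
have H (g : T -> R) : mu.-integrable D (EFin \o g) -> (forall x, `|g x| <= normc (f x)) ->
    (`|Rintegral mu D g|%:E <= \int[mu]_(x in D) (normc (f x))%:E)%E.
  move=> ig gn; rewrite EFin_normr_Rintegral//.
  apply: le_trans (le_abse_integral mu mD _) _; first by case/integrableP: ig.
  apply: ge0_le_integral => //.
  - by apply: measurableT_comp => //; case/integrableP: ig.
  - exact/measurable_EFinP/measurable_normc.
  - by move=> x _; rewrite lee_fin.
apply: (@le_trans _ _ (`|Rintegral mu D (fun x => complex.Re (f x))| +
    `|Rintegral mu D (fun x => complex.Im (f x))|)%:E).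
  by rewrite lee_fin (le_trans (normc_le_ReIm _))//.
rewrite EFinD mule_natl mule2n; apply: leeD; apply: H => // x.
  exact: Re_le_normc.
exact: Im_le_normc.
Qed.
End complex_integral.

(** * Integration against the Plancherel density *)

Section plancherel_measure.
Context (R : realType) (q : nat) (q_gt1 : (1 < q)%N).
Local Notation leb := (@lebesgue_measure R).
Local Notation tau := (tau R q).
Local Notation density := (@plancherel_density R q).
Local Notation planch := (plancherel R q).
Local Notation qR := (q%:R : R).
Local Notation seg := `[0%R, tau]%classic.

Lemma qR_gt1 : 1 < qR. Proof. by rewrite ltr1n. Qed.
Lemma qR_gt0 : 0 < qR. Proof. exact: lt_trans ltr01 qR_gt1. Qed.
Lemma qR_neq0 : qR != 0. Proof. by rewrite gt_eqF// qR_gt0. Qed.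
Lemma lnq_gt0 : 0 < ln qR. Proof. by rewrite ln_gt0// qR_gt1. Qed.
Lemma tau_gt0 : 0 < tau. Proof. by rewrite divr_gt0// ?pi_gt0// lnq_gt0. Qed.

Lemma measurable_density_on D : measurable_fun D (EFin \o density).
Proof.
apply/measurable_EFinP; apply: measurable_funTS.
exact: continuous_measurable_fun (@continuous_density R q).
Qed.

Let density_ge0E s : (0 <= (density s)%:E)%E.
Proof. by rewrite lee_fin density_ge0. Qed.

Let integral_plancherel_indic E : measurable E ->
  (\int[planch]_x (\1_E x)%:E = \int[leb]_(s in seg) ((\1_E s)%:E * (density s)%:E))%E.
Proof.
move=> mE; rewrite integral_indic//= setIT /plancherel.
rewrite [LHS]integral_mkcond/= [RHS]integral_mkcond/=.
apply: eq_integral => x _; rewrite !patchE in_setI indicE.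
by case: (x \in E) => /=; case: ifPn; rewrite ?mul1e ?mul0e.
Qed.

Import HBNNSimple.

Let integral_plancherel_nnsfun (f : {nnsfun (measurableTypeR R) >-> R}) :
  (\int[planch]_x (f x)%:E = \int[leb]_(s in seg) ((f s)%:E * (density s)%:E))%E.
Proof.
under [LHS]eq_integral do rewrite fimfunE -fsumEFin//.
rewrite [LHS]ge0_integral_fsum//; last 2 first.
  - by move=> r; exact/measurable_EFinP/measurableT_comp.
  - by move=> n x _; rewrite EFinM nnfun_muleindic_ge0.
under [RHS]eq_integral.
  move=> x xD; rewrite fimfunE -fsumEFin// muleC ge0_mule_fsumr; last first.
    by move=> r; rewrite EFinM nnfun_muleindic_ge0.
  over.
rewrite [RHS]ge0_integral_fsum//; last 2 first.
  - move=> r; apply: emeasurable_funM; first exact: measurable_density_on.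
    by apply/measurable_EFinP/measurable_funTS/measurableT_comp.
  - by move=> n x _; rewrite mule_ge0// EFinM nnfun_muleindic_ge0.
apply: eq_fsbigr => r _.
rewrite integralZl_indic_nnsfun//= integral_plancherel_indic//.
under [RHS]eq_integral do rewrite muleC EFinM -muleA.
have [r0|r0] := leP 0 r.
  rewrite ge0_integralZl//; first apply: emeasurable_funM => //.
  - exact/measurable_EFinP/measurable_funTS/measurable_indic.
  - exact: measurable_density_on.
  - by move=> x _; rewrite mule_ge0// lee_fin.
rewrite preimage_nnfun0// !integral0_eq ?mule0// => x _.
  by rewrite indic0 ?mul0e ?mule0.
by rewrite indic0 ?mul0e ?mule0.
Qed.

(** As usual for a measure given by a density: indicators, then simple functions, then monotone
    limits. *)
Lemma ge0_integral_plancherel (f : measurableTypeR R -> \bar R) :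
  measurable_fun setT f -> (forall x, 0 <= f x)%E ->
  (\int[planch]_x f x = \int[leb]_(s in seg) (f s * (density s)%:E))%E.
Proof.
move=> mf f0.
pose f_ := nnsfun_approx measurableT mf.
transitivity (lim (\int[planch]_x (f_ n x)%:E @[n --> \oo])%E).
  rewrite -monotone_convergence//=.
  - apply: eq_integral => ? /[!inE] xD; apply/esym/cvg_lim => //=.
    exact: cvg_nnsfun_approx.
  - by move=> n; exact/measurable_EFinP/measurable_funTS.
  - by move=> n ? _; rewrite lee_fin.
  - by move=> ? _ ? ? mn; rewrite lee_fin; exact/lefP/nd_nnsfun_approx.
transitivity (lim (\int[leb]_(x in seg) ((f_ n x)%:E * (density x)%:E) @[n --> \oo])%E).
  by apply: congr_lim; apply/funext => n /=; exact: integral_plancherel_nnsfun.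
rewrite -monotone_convergence//=.
- apply: eq_integral => x /[!inE] xD; apply/cvg_lim => //=.
  apply: cvgeZr => //; exact: cvg_nnsfun_approx.
- move=> n; apply: emeasurable_funM; last exact: measurable_density_on.
  exact/measurable_EFinP/measurable_funTS.
- by move=> n x _; rewrite mule_ge0// lee_fin.
- move=> x _ m n mn; rewrite lee_wpmul2r//.
  by rewrite lee_fin; exact/lefP/nd_nnsfun_approx.
Qed.

Lemma Rintegral_plancherel (g : measurableTypeR R -> R) : measurable_fun setT g ->
  Rintegral planch setT g = Rintegral leb seg (fun s => g s * density s).
Proof.
move=> mg; rewrite /Rintegral; congr fine.
have mg' : measurable_fun setT (EFin \o g) by exact/measurable_EFinP.
rewrite integralE [RHS]integralE; congr (_ - _)%E.
  rewrite ge0_integral_plancherel//; last exact: measurable_funepos.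
  apply: eq_integral => x _; rewrite !funeposE /= EFinM.
  by rewrite maxe_pMl ?lee_fin ?density_ge0// mul0e.
rewrite ge0_integral_plancherel//; last exact: measurable_funeneg.
apply: eq_integral => x _; rewrite !funenegE /=.
have -> : ((- (g x * density x))%:E = (- g x)%:E * (density x)%:E)%E.
  by rewrite -EFinM mulNr.
by rewrite maxe_pMl ?lee_fin ?density_ge0// mul0e.
Qed.
End plancherel_measure.

(** * The Plancherel measure and the spherical functions *)

Section spherical_functions.
Context (R : realType) (q : nat) (q_gt1 : (1 < q)%N).
Local Notation leb := (@lebesgue_measure R).
Local Notation tau := (tau R q).
Local Notation density := (@plancherel_density R q).
Local Notation planch := (plancherel R q).
Local Notation qR := (q%:R : R).
Local Notation seg := `[0%R, tau]%classic.
Implicit Types (s : R) (k : int) (n : nat).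

Let t s := s * ln qR.
(** The squared modulus of [q^(1/2+is) - q^(-1/2-is)], which occurs in the numerator of [c]. Its
    inverse is a multiple of the Poisson kernel of parameter [1/q] at the angle [2 * t s]. *)
Let D s := qR + qR^-1 - 2 * cos (2 * t s).

Let qgt1 := qR_gt1 R q_gt1.
Let qgt0 := qR_gt0 R q_gt1.
Let qn0 := qR_neq0 R q_gt1.
Let lgt0 := lnq_gt0 R q_gt1.
Let ln0 : ln qR != 0. Proof. by rewrite gt_eqF. Qed.

(** The formula persists at the poles of [c]: with [0^-1 = 0] the rules for inverting products
    remain valid there, and both sides vanish. *)
Lemma density_trig s : density s =
  2 * ln qR * q.+1%:R / pi * sin (t s) ^+ 2 / D s.
Proof.
have half : (2^-1 : R[i]) = (2^-1 : R)%:C by rewrite fmorphV rmorph_nat.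
have is_ : (0 +i* 1) * s%:C = 0 +i* s :> R[i] by simpc.
rewrite /plancherel_density /harish_chandra_c !Normc.normcM Normc.normcV is_ half.
have -> : (2^-1)%:C + 0 +i* s = 2^-1 +i* s :> R[i] by simpc.
have -> : - (2^-1)%:C - 0 +i* s = (- 2^-1) +i* (- s) :> R[i] by simpc.
have -> : - (0 +i* s) = 0 +i* (- s) :> R[i] by simpc.
rewrite !qpowE powRr0 !mulNr cosN sinN !mul1r -/(t s) powRN.
set a := qR `^ 2^-1.
have a2 : a ^+ 2 = qR by rewrite /a powR12_sqrt ?ltW// sqr_sqrtr// ltW.
have a0 : a != 0 by apply: contra_eq_neq a2 => ->; rewrite expr0n eq_sym.
rewrite !exprMn !exprVn !sqr_normcE /=.
have c2 : cos (2 * t s) = cos (t s) ^+ 2 - sin (t s) ^+ 2.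
  by rewrite mulr_natl mulr2n cosD !expr2.
have cs := cos2Dsin2 (t s).
have -> : (a * cos (t s) - a^-1 * cos (t s)) ^+ 2 +
    (a * sin (t s) - a^-1 * - sin (t s)) ^+ 2 = D s.
  rewrite /D c2 -a2.
  have -> : a ^+ 2 + (a ^+ 2)^-1 = (a ^+ 2 + (a ^+ 2)^-1) * (cos (t s) ^+ 2 + sin (t s) ^+ 2).
    by rewrite cs mulr1.
  by field.
have -> : (cos (t s) - cos (t s)) ^+ 2 + (sin (t s) - - sin (t s)) ^+ 2 =
    2 ^+ 2 * sin (t s) ^+ 2 by ring.
rewrite expr0n addr0.
rewrite !invfM !invrK /plancherel_const ?exprMn ?exprVn ?a2; move: (D s)^-1 => Di.
have p0 : pi != 0 :> R by rewrite gt_eqF// pi_gt0.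
have q1 : 1 + qR != 0 by rewrite gt_eqF// addr_gt0.
rewrite -{1}a2; move: (pi : R) p0 => P p0; field; rewrite a0 q1 p0.
by [].
Qed.

Lemma D_gt0 s : 0 < D s.
Proof.
have := cos_le1 (2 * t s); rewrite /D => c1.
apply: (@lt_le_trans _ _ (qR + qR^-1 - 2)); last by lra.
have -> : qR + qR^-1 - 2 = (qR - 1) ^+ 2 / qR by field.
by rewrite divr_gt0// exprn_gt0// subr_gt0.
Qed.
Let D_neq0 s : D s != 0. Proof. by rewrite gt_eqF// D_gt0. Qed.

Let cosk k s := cos (k%:~R * t s).
(** Up to a factor these are Fourier coefficients of a Poisson kernel, whence the geometric law
    [I (k + 2) = I k / q] for [k >= -1] that [Istep] establishes. *)
Let I k := Rintegral leb seg (fun s => cosk k s / D s).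

Let cont_cosk k : continuous (cosk k).
Proof.
move=> s; apply: continuous_comp; last exact: continuous_cos.
by apply: continuous_comp; [exact: mulrr_continuous|exact: mulrl_continuous].
Qed.

Let cont_D : continuous D.
Proof.
move=> s; apply: cvgB; first exact: cvg_cst.
by apply: cvgMl_tmp; exact: (cont_cosk (k := 2)).
Qed.

Lemma continuous_integrable_seg (f : R -> R) : continuous f ->
  leb.-integrable seg (EFin \o f).
Proof.
move=> cf; apply: continuous_compact_integrable; first exact: segment_compact.
exact: continuous_subspaceT.
Qed.

Let cont_ck k : continuous (fun s => cosk k s / D s).
Proof.
move=> s; apply: cvgM; first exact: cont_cosk.
by apply: cvgV => //; exact: cont_D.
Qed.

Lemma sin_natpi n : sin (n%:R * pi) = 0 :> R.
Proof.
elim: n => [|n IH]; first by rewrite mul0r sin0.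
by rewrite -natr1 mulrDl mul1r sinD IH mul0r add0r sinpi mulr0.
Qed.

Let integral_cosk n : Rintegral leb seg (cosk n.+1%:Z) = 0.
Proof.
pose c : R := n.+1%:R * ln qR.
have c0 : c != 0 by rewrite mulf_neq0// pnatr_eq0.
have cE s : cosk n.+1%:Z s = cos (c * s) by rewrite /cosk /t /c; congr cos; ring.
have dF s : is_derive s 1 (fun s => c^-1 * sin (c * s)) (cosk n.+1%:Z s).
  rewrite cE.
  have d1 : is_derive s 1 (fun s => c * s) c.
    by apply: is_derive_eq; rewrite /= [LHS]mulr1.
  have d2 := @is_derive1_comp R sin (fun s => c * s) s (cos (c * s)) c (is_derive_sin _) d1.
  have d3 := @is_deriveZ R R R (sin \o (fun s => c * s)) c^-1 s 1 _ d2.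
  apply: is_derive_eq d3 _.
  by rewrite [_ * c]mulrC; apply: mulKf.
have cF : continuous (fun s => c^-1 * sin (c * s)).
  by move=> s; apply: differentiable_continuous; apply/derivable1_diffP; case: (dF s).
rewrite /Rintegral (@continuous_FTC2 _ (cosk n.+1%:Z) (fun s => c^-1 * sin (c * s))).
- rewrite mulr0 sin0 mulr0 sube0 /= /Defs.tau.
  have -> : c * (pi / ln qR) = n.+1%:R * pi by rewrite /c; field.
  by rewrite sin_natpi mulr0.
- exact: tau_gt0.
- exact: continuous_subspaceT.
- split.
  + by move=> s _; case: (dF s).
  + by apply: cvg_at_right_filter; exact: cF.
  + by apply: cvg_at_left_filter; exact: cF.
- by move=> s _; rewrite derive1E; case: (dF s).
Qed.

Let Isym k : I (- k) = I k.
Proof.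
by apply: eq_Rintegral => s _; rewrite /cosk rmorphN mulNr cosN.
Qed.

(** The left-hand side amounts to multiplying the integrand by [D], because [2 cos(2t) cos(kt) =
    cos((k+2)t) + cos((k-2)t)]. *)
Let Irec k : (qR + qR^-1) * I k - I (k + 2) - I (k - 2) = Rintegral leb seg (cosk k).
Proof.
have iI j : leb.-integrable seg (EFin \o (fun s => cosk j s / D s)).
  by apply: continuous_integrable_seg; exact: cont_ck.
have iZ (r : R) : leb.-integrable seg (EFin \o (fun s => r * (cosk k s / D s))).
  by apply: continuous_integrable_seg => s; apply: cvgMl_tmp; exact: cont_ck.
rewrite /I -RintegralZl// -RintegralB// -RintegralB//; last first.
  apply: continuous_integrable_seg => s; apply: cvgB; last exact: cont_ck.
  by apply: cvgMl_tmp; exact: cont_ck.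
apply: eq_Rintegral => s _.
have e1 : cosk (k + 2) s = cosk k s * cos (2 * t s) - sin (k%:~R * t s) * sin (2 * t s).
  by rewrite /cosk rmorphD /= mulrDl cosD.
have e2 : cosk (k - 2) s = cosk k s * cos (2 * t s) + sin (k%:~R * t s) * sin (2 * t s).
  by rewrite /cosk rmorphB /= mulrBl cosB.
rewrite e1 e2; set S := sin _ * sin _.
transitivity (cosk k s * (D s * (D s)^-1)); last by rewrite mulfV ?mulr1.
move: (D s)^-1 => Di; rewrite /D; ring.
Qed.

Let I_bounded : exists C, forall k, `|I k| <= C.
Proof.
exists (Rintegral leb seg (fun s => (D s)^-1)) => k.
have iI : leb.-integrable seg (EFin \o (fun s => cosk k s / D s)).
  by apply: continuous_integrable_seg; exact: cont_ck.
apply: le_trans (le_normr_Rintegral _ iI) _ => //.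
apply: le_Rintegral => //.
- exact: (integrable_norm iI).
- by apply: continuous_integrable_seg => s; apply: cvgV => //; exact: cont_D.
- move=> s _; rewrite normrM [in `|_^-1|]gtr0_norm ?invr_gt0 ?D_gt0//.
  by rewrite ler_piMl ?cos_max// invr_ge0 ltW// D_gt0.
Qed.

(* e k := I (k + 2) - I k / q satisfies e k = q e (k - 2) for k <> 0, and is bounded. *)
Let Istep n : I (n.+1%:Z) = qR^-1 * I (n.+1%:Z - 2).
Proof.
pose e k := I (k + 2) - qR^-1 * I k.
have eS m : e (m.+1%:Z) = qR * e (m.+1%:Z - 2).
  have := Irec m.+1%:Z; rewrite integral_cosk /e subrK => H.
  have -> : I (m.+1%:Z + 2) = (qR + qR^-1) * I m.+1%:Z - I (m.+1%:Z - 2) by lra.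
  by field.
have eI j : e (n.+1%:Z - 2 + 2 * j%:Z) = qR ^+ j * e (n.+1%:Z - 2).
  elim: j => [|j IH]; first by rewrite mulr0 addr0 expr0 mul1r.
  have -> : n.+1%:Z - 2 + 2 * j.+1%:Z = (n + j.*2).+1%:Z by lia.
  rewrite eS exprS -mulrA -IH; congr (_ * e _); lia.
have [C IC] := I_bounded.
suff e0 : e (n.+1%:Z - 2) = 0.
  by move: e0; rewrite /e subrK => /eqP; rewrite subr_eq0 => /eqP.
apply/eqP; rewrite -normr_eq0; apply: contraT => e0.
have {}e0 : 0 < `|e (n.+1%:Z - 2)| by rewrite lt_neqAle eq_sym e0 normr_ge0.
have eC k : `|e k| <= 2 * C.
  rewrite /e (le_trans (ler_normB _ _))// mulr_natl mulr2n lerD// normrM.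
  apply: le_trans (IC k); rewrite ler_piMl// gtr0_norm ?invr_gt0//.
  by rewrite invf_le1// ltW.
have : forall j, j%:R * `|e (n.+1%:Z - 2)| <= 2 * C.
  move=> j; apply: le_trans (eC (n.+1%:Z - 2 + 2 * j%:Z)).
  rewrite eI normrM ler_wpM2r// normrX gtr0_norm//.
  apply: (@le_trans _ _ (2 ^+ j)); last by apply: lerXn2r; rewrite ?nnegrE ?ler0n ?ler_nat.
  by rewrite -natrX ler_nat ltnW// ltn_expl.
move=> /(_ (Num.truncn (2 * C / `|e (n.+1%:Z - 2)|)).+1).
rewrite -ler_pdivlMr//; have := truncnS_gt (2 * C / `|e (n.+1%:Z - 2)|).
by move=> /lt_le_trans /[apply]; rewrite ltxx.
Qed.

Let r : R := qR `^ (- 2^-1).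

(* The pair (phi_n(s), phi_(n+1)(s)) of spherical functions; the recursion says that they
   are radial eigenfunctions of the adjacency operator. *)
Fixpoint spherical2 n s : R * R :=
  if n is m.+1 then
    let p := spherical2 m s in (p.2, 2 * qR `^ (- 2^-1) * cos (s * ln qR) * p.2 - p.1 / qR)
  else (1, qR / q.+1%:R * (2 * qR `^ (- 2^-1) * cos (s * ln qR))).
Definition spherical n s := (spherical2 n s).1.

Lemma spherical0 s : spherical 0 s = 1. Proof. by []. Qed.
Lemma spherical1 s : spherical 1 s =
  qR / q.+1%:R * (2 * qR `^ (- 2^-1) * cos (s * ln qR)).
Proof. by []. Qed.
Lemma sphericalSS n s : spherical n.+2 s =
  2 * qR `^ (- 2^-1) * cos (s * ln qR) * spherical n.+1 s - spherical n s / qR.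
Proof. by []. Qed.

Lemma continuous_spherical n : continuous (spherical n).
Proof.
have ct : continuous (fun s => 2 * qR `^ (- 2^-1) * cos (s * ln qR)).
  move=> s; apply: cvgMl_tmp; apply: continuous_comp; last exact: continuous_cos.
  exact: mulrr_continuous.
suff [] : continuous (spherical n) /\ continuous (spherical n.+1) by [].
elim: n => [|n [IH1 IH2]].
  split; first by move=> s; exact: cvg_cst.
  by move=> s; apply: cvgMl_tmp; exact: ct.
split=> // s; apply: cvgB; first by apply: cvgM; [exact: ct|exact: IH2].
by apply: cvgMr_tmp; exact: IH1.
Qed.

Let r2 : r ^+ 2 = qR^-1.
Proof. by rewrite /r powRN powR12_sqrt ?ltW// exprVn sqr_sqrtr// ltW. Qed.

(** After multiplication by [sin t] and removal of [r^n], the three-term recursion is the one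
    satisfied by sines of multiples of [t]; the spherical function is thus a multiple of
    [U_n - U_(n-2) / q] in Chebyshev polynomials of the second kind. The argument [n t - t] makes
    sense at [n = 0] too, where the sine is [- sin t]. *)
Let spherical_sin n s : spherical n s * sin (t s) = qR / q.+1%:R * r ^+ n *
  (sin ((n.+1)%:R * t s) - qR^-1 * sin (n%:R * t s - t s)).
Proof.
have q1 : 1 + qR != 0 by rewrite gt_eqF// addr_gt0.
pose F m := sin ((m.+1)%:R * t s) - qR^-1 * sin (m%:R * t s - t s).
have prod y : 2 * cos (t s) * sin y = sin (y + t s) + sin (y - t s).
  by rewrite sinD sinB; ring.
have FR m : 2 * cos (t s) * F m.+1 = F m.+2 + F m.
  have nS (k : nat) : k.+1%:R * t s = k%:R * t s + t s by rewrite -natr1 mulrDl mul1r.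
  have -> : 2 * cos (t s) * F m.+1 = 2 * cos (t s) * sin (m.+2%:R * t s)
    - qR^-1 * (2 * cos (t s) * sin (m.+1%:R * t s - t s)) by rewrite /F; ring.
  by rewrite !prod /F !nS !addrK; ring.
suff [] : spherical n s * sin (t s) = qR / q.+1%:R * r ^+ n * F n /\
  spherical n.+1 s * sin (t s) = qR / q.+1%:R * r ^+ n.+1 * F n.+1 by [].
elim: n => [|n [IH1 IH2]].
  rewrite spherical0 spherical1 -/r -/(t s) /F !mul0r !mul1r subrr sub0r sinN sin0.
  have -> : sin (2%:R * t s) = 2 * (cos (t s) * sin (t s)).
    by rewrite mulr_natl sin_mulr2n mulr_natl.
  rewrite expr0 expr1 -natr1.
  by split; field; rewrite ?qn0 ?[qR + 1]addrC.
split=> //; rewrite sphericalSS mulrBl -/r -/(t s) -[_ * spherical _ _ * _]mulrA IH2.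
rewrite [_ / qR * _]mulrAC IH1 -r2.
have -> : F n.+2 = 2 * cos (t s) * F n.+1 - F n by rewrite FR addrK.
rewrite !exprS; ring.
Qed.

Lemma integral_spherical n :
  Rintegral planch setT (spherical n) = (n == 0)%:R.
Proof.
rewrite Rintegral_plancherel//; last first.
  exact: continuous_measurable_fun (@continuous_spherical n).
(* The factor [2 ln q (q+1) / pi] of the density, times [q / (q+1)] and [r^n] from [spherical_sin],
   times the [1/2] in the product formula for two sines. *)
pose C := ln qR * qR / pi * r ^+ n.
have E s : spherical n s * density s =
    C * (cosk n s / D s - cosk (n%:Z + 2) s / D s
      - qR^-1 * (cosk (n%:Z - 2) s / D s) + qR^-1 * (cosk n s / D s)).
  rewrite density_trig.
  have -> : spherical n s * (2 * ln qR * q.+1%:R / pi * sin (t s) ^+ 2 / D s) =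
    2 * ln qR * q.+1%:R / pi * sin (t s) / D s * (spherical n s * sin (t s)) by ring.
  set x := n%:R * t s.
  have k1 : (n%:Z + 2)%:~R * t s = x + t s + t s.
    by rewrite /x; move: (t s) => y; rewrite rmorphD /=; ring.
  have k2 : (n%:Z - 2)%:~R * t s = x - t s - t s.
    by rewrite /x; move: (t s) => y; rewrite rmorphB /=; ring.
  have k0 : n.+1%:R * t s = x + t s by rewrite -natr1 mulrDl mul1r.
  rewrite spherical_sin /cosk k0 k1 k2 -/x.
  have c1 : cos x = cos (x + t s) * cos (t s) + sin (x + t s) * sin (t s).
    by rewrite -cosB addrK.
  have c2 : cos x = cos (x - t s) * cos (t s) - sin (x - t s) * sin (t s).
    by rewrite -cosD subrK.
  rewrite cosD cosB {1}c1 c2; move: (D s)^-1 => Di.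
  have q1 : 1 + qR != 0 by rewrite gt_eqF// addr_gt0.
  have p0 : pi != 0 :> R by rewrite gt_eqF// pi_gt0.
  rewrite /C -natr1; move: (pi : R) p0 => P p0.
  by field; rewrite qn0 p0 q1.
have iI j : leb.-integrable seg (EFin \o (fun s => cosk j s / D s)).
  by apply: continuous_integrable_seg; exact: cont_ck.
have iZ j (x : R) : leb.-integrable seg (EFin \o (fun s => x * (cosk j s / D s))).
  by apply: continuous_integrable_seg => s; apply: cvgMl_tmp; exact: cont_ck.
have iB1 : leb.-integrable seg (EFin \o
    (fun s => cosk n s / D s - cosk (n%:Z + 2) s / D s)).
  by apply: continuous_integrable_seg => s; apply: cvgB; exact: cont_ck.
have iB2 : leb.-integrable seg (EFin \o
    (fun s => cosk n s / D s - cosk (n%:Z + 2) s / D s - qR^-1 * (cosk (n%:Z - 2) s / D s))).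
  apply: continuous_integrable_seg => s; apply: cvgB.
    by apply: cvgB; exact: cont_ck.
  by apply: cvgMl_tmp; exact: cont_ck.
have iB3 : leb.-integrable seg (EFin \o
    (fun s => cosk n s / D s - cosk (n%:Z + 2) s / D s
      - qR^-1 * (cosk (n%:Z - 2) s / D s) + qR^-1 * (cosk n s / D s))).
  apply: continuous_integrable_seg => s; apply: cvgD.
    apply: cvgB; last by apply: cvgMl_tmp; exact: cont_ck.
    by apply: cvgB; exact: cont_ck.
  by apply: cvgMl_tmp; exact: cont_ck.
under eq_Rintegral do rewrite E.
rewrite RintegralZl// RintegralD// !RintegralB// !RintegralZl//.
rewrite -!/(I _); case: n @C E iB1 iB2 iB3 => [|n] C _ _ _ _.
  (* For [n = 0] the recursion at [k = 0] expresses [I 0] by the length [tau] of the interval; here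
     the Plancherel constant makes the total mass 1. *)
  have I2 : I 2 = qR^-1 * I 0 by have := Istep 1.
  have Im2 : I (- 2) = I 2 by rewrite Isym.
  have := Irec 0; rewrite !add0r Im2 I2.
  have -> : cosk 0 = cst 1 by apply/funext => s; rewrite /cosk mul0r cos0.
  have lm : leb seg = tau%:E.
    apply: eq_trans (lebesgue_measure_itv _) _.
    by rewrite /= lte_fin tau_gt0// oppr0 adde0.
  rewrite Rintegral_cst// => e0.
  have /= e := etrans e0 (etrans (mul1r _) (congr1 fine lm)).
  have p0 : pi != 0 :> R by rewrite gt_eqF// pi_gt0.
  rewrite /C expr0 mulr1; move: e; rewrite /Defs.tau.
  move: (pi : R) p0 => P p0 e.
  have -> : I 0 - qR^-1 * I 0 - qR^-1 * (qR^-1 * I 0) + qR^-1 * I 0 =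
     qR^-1 * ((qR + qR^-1) * I 0 - qR^-1 * I 0 - qR^-1 * I 0) by field.
  by rewrite e; field; rewrite qn0 p0 ln0.
(* For positive index the four coefficients cancel in pairs, since steps of two have ratio [1/q]. *)
have -> : I (n.+1%:Z + 2) = qR^-1 * I n.+1%:Z.
  by have := Istep n.+2; congr (I _ = _ * I _); lia.
rewrite (Istep n) /=; move: (I _) => y; ring.
Qed.
End spherical_functions.

(** * Orthonormality of the functions q^((1/2 + is) h(x)) *)

Section qpow_theory.
Context {R : realType} (q : nat) (q_gt0 : (0 < q)%N).
Implicit Types (z w : R[i]) (s : R).
Local Notation qR := (q%:R : R).

Let q0 : qR != 0. Proof. by rewrite pnatr_eq0 -lt0n. Qed.

Lemma qpowD z w : qpow q (z + w) = qpow q z * qpow q w.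
Proof.
case: z w => [a b] [c d]; rewrite /qpow /= mulrDl cosD sinD powRD ?q0 ?implybT//.
by simpc; congr (_ +i* _); ring.
Qed.

Lemma qpow0 : qpow q (0 : R[i]) = 1.
Proof. by rewrite /qpow /= powRr0 mul0r cos0 sin0 mul1r. Qed.

Lemma qpowN z : qpow q (- z) = (qpow q z)^-1.
Proof.
have e : qpow q z * qpow q (- z) = 1 by rewrite -qpowD subrr qpow0.
have zn : qpow q z != 0 by apply: contra_eq_neq e => ->; rewrite mul0r eq_sym oner_eq0.
by apply: (mulfI zn); rewrite e mulfV.
Qed.

Lemma qpow_neq0 z : qpow q z != 0.
Proof.
have e : qpow q z * qpow q (- z) = 1 by rewrite -qpowD subrr qpow0.
by apply: contra_eq_neq e => ->; rewrite mul0r eq_sym oner_eq0.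
Qed.

Lemma normc_qpow z : normc (qpow q z) = qR `^ complex.Re z.
Proof.
rewrite /qpow Normc.normcM !normcE /= expr0n addr0 cos2Dsin2 sqrtr1 mulr1 sqrtr_sqr.
by rewrite ger0_norm// powR_ge0.
Qed.

Lemma qpow_mulrn z n : qpow q (z *+ n) = qpow q z ^+ n.
Proof. by elim: n => [|n IH]; rewrite ?mulr0n ?qpow0// mulrS qpowD IH exprS. Qed.

(* Locked: otherwise rewriting a conjugate of a product unfolds it. *)
Definition zq s : R[i] := locked (qpow q (2^-1 +i* s)).

Lemma zq_qpow s : zq s = qpow q (2^-1 +i* s). Proof. by rewrite /zq -lock. Qed.

Arguments zq : simpl never.

Lemma zq_neq0 s : zq s != 0. Proof. by rewrite zq_qpow qpow_neq0. Qed.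
Lemma zqJ_neq0 s : (zq s)^*%C != 0. Proof. by rewrite conjc_eq0 zq_neq0. Qed.

Lemma normcX z n : normc (z ^+ n) = normc z ^+ n.
Proof.
by elim: n => [|n IH]; rewrite ?expr0 ?Normc.normc1// !exprS Normc.normcM IH.
Qed.

Lemma normc_zq s : normc (zq s) = Num.sqrt qR.
Proof. by rewrite zq_qpow normc_qpow /= powR12_sqrt// ler0n. Qed.

Lemma zqE s : zq s =
  (Num.sqrt qR * cos (s * ln qR)) +i* (Num.sqrt qR * sin (s * ln qR)).
Proof. by rewrite zq_qpow /qpow /= powR12_sqrt ?ler0n//; simpc. Qed.

Lemma zqM_conj s : zq s * (zq s)^*%C = q%:R.
Proof.
have -> : (q%:R : R[i]) = qR%:C by rewrite rmorph_nat.
have s2 : Num.sqrt qR * Num.sqrt qR = qR by rewrite -expr2 sqr_sqrtr// ler0n.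
rewrite zqE -[in RHS]s2; set c := cos _; set d := sin _; simpc.
have cd : c * c + d * d = 1 by rewrite -!expr2 cos2Dsin2.
congr (_ +i* _); last by ring.
by rewrite -[RHS]mulr1 -cd; ring.
Qed.

Lemma zqD_conj s : zq s + (zq s)^*%C = (2 * Num.sqrt qR * cos (s * ln qR))%:C.
Proof. by rewrite zqE; simpc; congr (_ +i* _); ring. Qed.
End qpow_theory.

Arguments zq : simpl never.
Arguments qpow : simpl never.

(** * The functions [e_x] and their recursions along edges *)

Section helgason_kernel.
Context {R : realType} {q : nat} {X : homogeneous_tree q} {o : X}.
Implicit Types (w : boundary o) (x y z : X) (ws : boundary o * measurableTypeR R).
Local Notation height w x := (@height q X R o w x).
Local Notation zq := (@zq R q).
Local Notation qR := (q%:R : R).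

Lemma tree_gt0 : (0 < q)%N. Proof. exact: ltn_trans (tree_order X). Qed.
Let q0 := tree_gt0.

Definition kernel x ws : R[i] :=
  locked (qpow q ((2^-1 +i* ws.2) * (height ws.1 x)%:C)).

Lemma kernelE x ws : kernel x ws = qpow q ((2^-1 +i* ws.2) * (height ws.1 x)%:C).
Proof. by rewrite /kernel -lock. Qed.

Lemma fourier0E (f : X -> R[i]) ws :
  fourier0 f ws = \sum_(y \in [set: X]) f y * kernel y ws.
Proof. by apply: eq_fsbigr => y _; rewrite kernelE. Qed.

Lemma kernel_root ws : kernel o ws = 1.
Proof. by rewrite kernelE height_root mulr0 qpow0. Qed.

Lemma kernel_shift x y ws n : height ws.1 x = height ws.1 y + n%:R ->
  kernel x ws = kernel y ws * zq ws.2 ^+ n.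
Proof.
by rewrite !kernelE zq_qpow => ->; rewrite rmorphD mulrDr qpowD// rmorph_nat mulr_natr qpow_mulrn.
Qed.

Lemma kernel_off z' z ws : adj z' z -> dist o z = (dist o z').+1 ->
  ~ cylinder z ws.1 -> kernel z ws = (zq ws.2)^-1 * kernel z' ws.
Proof.
move=> zz oz nz; have h := height_off_cylinder (R := R) zz oz nz.
rewrite (@kernel_shift z' z _ 1%N); last by rewrite h subrK.
by rewrite expr1 mulrCA mulVf ?mulr1 ?zq_neq0.
Qed.

Lemma kernel_on x z' z ws : adj z' z -> dist o z = (dist o z').+1 ->
  cylinder z ws.1 -> dist x z = (dist x z').+1 ->
  kernel x ws = zq ws.2 ^+ dist o z * (zq ws.2)^-1 ^+ dist x z.
Proof.
move=> zz oz wz xz.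
have h := height_on_cylinder (R := R) zz oz wz xz.
have : kernel o ws * zq ws.2 ^+ dist o z = kernel x ws * zq ws.2 ^+ dist x z.
  rewrite !kernelE zq_qpow height_root mulr0 qpow0// mul1r h.
  rewrite rmorphB !rmorph_nat mulrBr !mulr_natr qpowD// qpowN// !qpow_mulrn// mulfVK//.
  by rewrite expf_neq0// qpow_neq0.
by rewrite kernel_root mul1r => ->; rewrite -mulrA -exprMn mulfV ?expr1n ?mulr1// zq_neq0.
Qed.

Lemma kernel_cylinder z ws : cylinder z ws.1 -> kernel z ws = zq ws.2 ^+ dist o z.
Proof.
move=> wz; rewrite (@kernel_shift z o _ (dist o z)); first by rewrite kernel_root mul1r.
by rewrite height_root add0r height_cylinder.
Qed.

Definition cyl_indic z ws : R[i] := (\1_(cylinder z) ws.1)%:C.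

(** Off the cylinder the height drops by one from [z'] to [z], and the correction term is absent. On
    it the two heights are [|z|] and [|z| - 1], so the correction is [zq^|z| - zq^(|z|-2)].
    Measurability, the boundary integrals and completeness all start from this identity. *)
Lemma kernel_child z' z ws : adj z' z -> dist o z = (dist o z').+1 ->
  kernel z ws = (zq ws.2)^-1 * kernel z' ws +
    cyl_indic z ws * (zq ws.2 ^+ dist o z * (1 - (zq ws.2)^-1 ^+ 2)).
Proof.
move=> zz oz; rewrite /cyl_indic indicE.
have zn := zq_neq0 q0 ws.2.
have [/set_mem wz|/negP nz] := boolP (ws.1 \in cylinder z); last first.
  rewrite mul0r addr0; apply: kernel_off => // wz; apply: nz; exact: mem_set.
rewrite mul1r kernel_cylinder// (@kernel_on z' z' z)// ?distxx ?(dist1 zz)//.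
rewrite ?expr1; move: (zq _ ^+ dist o z) => Y; by field.
Qed.

(** One neighbour, towards the end of the ray, contributes the factor [zq]; the other [q] contribute
    [zq^-1] each, and [q * zq^-1] is the conjugate of [zq]. *)
Lemma kernel_nbrs y ws :
  \sum_(z \in [set z | adj y z]) kernel z ws =
  (zq ws.2 + (zq ws.2)^*%C) * kernel y ws.
Proof.
have zn := zq_neq0 q0 ws.2.
have [p [yp hp hz]] := height_nbrs (R := R) ws.1 y.
have cN := tree_degree y.
have fN : finite_set [set z | adj y z] by apply/finite_setP; exists q.+1.
have kp : kernel p ws = zq ws.2 * kernel y ws.
  by rewrite (@kernel_shift p y _ 1%N)// expr1 mulrC.
have kz z : adj y z -> z <> p -> kernel z ws = (zq ws.2)^-1 * kernel y ws.
  move=> yz zp; rewrite (@kernel_shift y z _ 1%N) ?expr1; last by rewrite (hz z)// subrK.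
  by rewrite mulrCA mulVf ?mulr1.
rewrite fsbig_finite// (bigD1_seq p) ?finmap.fset_uniq//; last first.
  by rewrite in_fset_set// mem_set.
rewrite kp big_seq_cond (eq_bigr (fun=> (zq ws.2)^-1 * kernel y ws)); last first.
  move=> z /andP[+ /eqP zp]; rewrite in_fset_set// => /set_mem yz; exact: kz.
rewrite -big_seq_cond big_const_seq iter_addr_0.
have pN : p \in finmap.enum_fset (fset_set [set z | adj y z]).
  by rewrite in_fset_set// mem_set.
set N := finmap.enum_fset _ in pN *; have -> : count (fun z => z != p) N = q.
  have := count_predC (pred1 p) N.
  rewrite count_uniq_mem; last exact: finmap.fset_uniq.
  rewrite [X in (nat_of_bool X + _)%N](pN : _ = true).
  by rewrite [RHS](card_fset_set cN) add1n => -[].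
rewrite -mulr_natl -(zqM_conj q ws.2) mulrDl; congr (_ + _).
by rewrite mulrACA mulfV// mul1r.
Qed.

Lemma normc_kernel_le x ws : normc (kernel x ws) <= Num.sqrt qR ^+ dist o x.
Proof.
have q1 : 1 <= Num.sqrt qR by rewrite -[leLHS]sqrtr1 ler_sqrt ?ler1n// ltr0n.
move: {2}(dist o x) (erefl (dist o x)) => n; elim: n x => [|n IH] x dx.
  by rewrite dx expr0 (dist_eq0 dx) kernel_root Normc.normc1.
have [x' [xx ox]] : exists x', adj x' x /\ dist o x = (dist o x').+1.
  by apply: parent_exists => xo; rewrite xo distxx in dx.
have [wx|nx] := pselect (cylinder x ws.1).
  by rewrite kernel_cylinder// normcX normc_zq.
rewrite (kernel_off xx ox nx) Normc.normcM Normc.normcV normc_zq//.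
have dx' : dist o x' = n by lia.
rewrite dx -[leRHS]mul1r ler_pM ?invr_ge0 ?normc_ge0//.
- by rewrite invf_le1// (lt_le_trans ltr01).
apply: le_trans (IH x' dx') _; rewrite dx'; apply: ler_weXn2l => //.
Qed.
End helgason_kernel.

Arguments kernel : simpl never.

Section bounded_integrable.
Context {R : realType} d (T : measurableType d) (mu : {measure set T -> \bar R}).
Context (D : set T) (mD : measurable D) (muD : (mu D < +oo)%E).

Lemma cintegrable_cst (c : R[i]) : cintegrable mu D (fun=> c).
Proof.
split; first exact: cmeasurable_cst.
by rewrite integral_cst// lte_mul_pinfty// ?lee_fin ?normc_ge0.
Qed.

Lemma cintegrable_bounded (f : T -> R[i]) M : cmeasurable_fun D f ->
  (forall x, D x -> normc (f x) <= M) -> cintegrable mu D f.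
Proof.
move=> mf fM; have := cintegrableM_bounded mD (cintegrable_cst 1) mf fM.
by apply: cintegrable_eq => x _; rewrite mul1r.
Qed.

Lemma cintegral_cst (c : R[i]) : cintegral mu D (fun=> c) = c * (fine (mu D))%:C.
Proof.
by rewrite /cintegral !Rintegral_cst//; case: c => a b /=; simpc.
Qed.
End bounded_integrable.

Section complex_fubini.
Context {R : realType} d1 d2 (T1 : measurableType d1) (T2 : measurableType d2).
Context (m1 : {finite_measure set T1 -> \bar R}) (m2 : {finite_measure set T2 -> \bar R}).

Lemma cmeasurable_section (F : T1 * T2 -> R[i]) y :
  cmeasurable_fun setT F -> cmeasurable_fun setT (fun x => F (x, y)).
Proof.
by move=> [m n]; split;
  [apply: (measurableT_comp m)|apply: (measurableT_comp n)]; exact: pair2_measurable.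
Qed.

Lemma Rintegral_fubini (f : T1 * T2 -> R) M : measurable_fun setT f ->
  (forall z, `|f z| <= M) ->
  Rintegral (m1 \x m2)%E setT f = Rintegral m2 setT (fun y => Rintegral m1 setT (fun x => f (x, y))).
Proof.
move=> mf fM.
have m12 : ((m1 \x m2)%E setT < +oo)%E.
  rewrite -setXTT product_measure1E//.
  by rewrite lte_mul_pinfty// ?measure_ge0// ?fin_num_measure// ltey_eq fin_num_measure.
have fi : (m1 \x m2)%E.-integrable setT (EFin \o f).
  apply: (@le_integrable _ _ _ _ _ measurableT _ (EFin \o cst M)) => //.
  - exact/measurable_EFinP.
  - by move=> z _ /=; rewrite lee_fin (le_trans (fM z))// ler_norm.
  - exact: ((cintegrableP _ measurableT _).1 (cintegrable_cst measurableT m12 M%:C)).1.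
rewrite /Rintegral -(integral21_prod_meas1 fi); congr fine.
apply: eq_integral => y _; rewrite /fubini_G fineK//.
apply: integrable_fin_num => //.
apply: (@le_integrable _ _ _ _ _ measurableT _ (EFin \o cst M)) => //.
- apply/measurable_EFinP; apply: (measurableT_comp mf); exact: pair2_measurable.
- by move=> x _ /=; rewrite lee_fin (le_trans (fM _))// ler_norm.
- exact: finite_measure_integrable_cst.
Qed.

Lemma cintegral_fubini (F : T1 * T2 -> R[i]) M : cmeasurable_fun setT F ->
  (forall z, normc (F z) <= M) ->
  cintegral (m1 \x m2)%E setT F =
  cintegral m2 setT (fun y => cintegral m1 setT (fun x => F (x, y))).
Proof.
move=> [mR mI] FM; rewrite /cintegral; congr (_ +i* _).
  by apply: (@Rintegral_fubini _ M) => // z; exact: le_trans (Re_le_normc _) (FM z).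
by apply: (@Rintegral_fubini _ M) => // z; exact: le_trans (Im_le_normc _) (FM z).
Qed.
End complex_fubini.

Section orthonormality.
Context {R : realType} {q : nat} {X : homogeneous_tree q} {o : X}.
Context (nu : probability (boundary o) R).
Context (nu_cylinder : forall x : X, x <> o ->
  nu (cylinder x) = (q%:R / (q.+1%:R * q%:R ^+ dist o x))%:E).
Implicit Types (x y z : X) (s : R).
Local Notation phase_space := (boundary o * measurableTypeR R)%type.
Local Notation planch := (plancherel R q).
Local Notation zq := (@zq R q).
Local Notation qR := (q%:R : R).
Local Notation kernel := (@kernel R q X o).
Local Notation sph := (@spherical R q).

Let q0 : (0 < q)%N := @tree_gt0 q X.
Let q1 : (1 < q)%N := tree_order X.

Lemma measurable_cylinder z : measurable (cylinder z : set (boundary o)).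
Proof. by apply: sub_sigma_algebra; exists z. Qed.

Lemma cmeasurable_snd (D : set phase_space) (f : R -> R[i]) :
  cmeasurable_fun setT (f : measurableTypeR R -> R[i]) ->
  cmeasurable_fun D (fun ws : phase_space => f ws.2).
Proof.
by move=> [m n]; split; apply: measurable_funTS;
  [apply: (measurableT_comp m)|apply: (measurableT_comp n)].
Qed.

Lemma cmeasurable_continuous (f : R -> R[i]) :
  continuous (fun s => complex.Re (f s)) -> continuous (fun s => complex.Im (f s)) ->
  cmeasurable_fun setT (f : measurableTypeR R -> R[i]).
Proof. by move=> c1 c2; split; exact: continuous_measurable_fun. Qed.

Let ct : continuous (fun s : R => s * ln qR).
Proof. exact: mulrr_continuous. Qed.

Lemma cmeasurable_zq : cmeasurable_fun setT (zq : measurableTypeR R -> R[i]).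
Proof.
apply: cmeasurable_continuous.
  rewrite (_ : (fun s => _) = (fun s => Num.sqrt qR * cos (s * ln qR))); last first.
    by apply/funext => s; rewrite zqE.
  move=> s; apply: cvgMl_tmp; apply: continuous_comp; first exact: ct.
  exact: continuous_cos.
rewrite (_ : (fun s => _) = (fun s => Num.sqrt qR * sin (s * ln qR))); last first.
  by apply/funext => s; rewrite zqE.
move=> s; apply: cvgMl_tmp; apply: continuous_comp; first exact: ct.
exact: continuous_sin.
Qed.

(** Since [zq] has constant modulus, its inverse is a scaled conjugate and inherits measurability
    from it. *)
Lemma zqVE s : (zq s)^-1 = qR^-1%:C * (zq s)^*%C.
Proof.
apply: (mulfI (zq_neq0 q0 s)); rewrite mulfV ?zq_neq0//.
rewrite mulrCA zqM_conj -(rmorph_nat (real_complex R)) -rmorphM /= mulVf//.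
by rewrite pnatr_eq0 -lt0n.
Qed.

Lemma zqJVE s : ((zq s)^*%C)^-1 = qR^-1%:C * zq s.
Proof.
apply: (mulfI (zqJ_neq0 q0 s)); rewrite mulfV ?zqJ_neq0//.
rewrite mulrCA [_^*%C * _]mulrC zqM_conj -(rmorph_nat (real_complex R)) -rmorphM /=.
by rewrite mulVf// pnatr_eq0 -lt0n.
Qed.

Lemma cmeasurable_zqV : cmeasurable_fun setT (fun s : measurableTypeR R => (zq s)^-1).
Proof.
under eq_fun do rewrite zqVE.
apply: cmeasurableM; first exact: cmeasurable_cst.
by apply: cmeasurableJ; exact: cmeasurable_zq.
Qed.

Lemma cmeasurableX d (T : measurableType d) (D : set T) (f : T -> R[i]) n :
  cmeasurable_fun D f -> cmeasurable_fun D (fun t => f t ^+ n).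
Proof.
move=> mf; elim: n => [|n IH].
  by under eq_fun do rewrite expr0; exact: cmeasurable_cst.
by under eq_fun do rewrite exprS; exact: cmeasurableM.
Qed.

Lemma cmeasurable_cyl_indic z (D : set phase_space) :
  cmeasurable_fun D (@cyl_indic R q X o z).
Proof.
split; apply: measurable_funTS; last exact: measurable_cst.
apply: (measurableT_comp (measurable_indic (measurable_cylinder z))).
exact: measurable_fst.
Qed.

(** By [kernel_child] each kernel is built from finitely many cylinder indicators and functions of
    [s], so the limit that defines the height need not be touched. *)
Lemma cmeasurable_kernel x : cmeasurable_fun setT (kernel x).
Proof.
move: {2}(dist o x) (erefl (dist o x)) => n; elim: n x => [|n IH] x dx.
  rewrite (dist_eq0 dx); rewrite (_ : kernel o = fun=> 1).
    exact: cmeasurable_cst.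
  by apply/funext => ws; exact: kernel_root.
have [x' [xx ox]] : exists x', adj x' x /\ dist o x = (dist o x').+1.
  by apply: parent_exists => xo; rewrite xo distxx in dx.
rewrite (_ : kernel x = fun ws => (zq ws.2)^-1 * kernel x' ws +
    cyl_indic x ws * (zq ws.2 ^+ dist o x * (1 - (zq ws.2)^-1 ^+ 2))); last first.
  by apply/funext => ws; exact: kernel_child.
have mz : cmeasurable_fun setT (fun ws : phase_space => zq ws.2).
  by apply: cmeasurable_snd; exact: cmeasurable_zq.
have mzV : cmeasurable_fun setT (fun ws : phase_space => (zq ws.2)^-1).
  by apply: (@cmeasurable_snd _ (fun s => (zq s)^-1)); exact: cmeasurable_zqV.
apply: cmeasurableD => //; apply: cmeasurableM => //.
- by apply: IH; lia.
- exact: cmeasurable_cyl_indic.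
- apply: cmeasurableM => //; first exact: cmeasurableX.
  by apply: cmeasurableB => //; exact: cmeasurableX.
Qed.

Lemma kernel_bounded x : exists M, forall ws, normc (kernel x ws) <= M.
Proof. by eexists => ws; exact: normc_kernel_le. Qed.

(** With [W = zq^-1], the second-order recursion has characteristic roots [W] and its conjugate.
    Splitting off the conjugate root leaves a geometric sequence of ratio [W], which is the
    inhomogeneous term. In this form the recursion matches [sph_int_step]. *)
Lemma spherical_step n s : (sph n.+1 s)%:C =
  ((zq s)^*%C)^-1 * (sph n s)%:C +
  (qR / q.+1%:R)%:C * ((zq s)^-1 ^+ n.+1 * (1 - ((zq s)^*%C)^-1 ^+ 2)).
Proof.
pose W := (zq s)^-1; have WJ : ((zq s)^*%C)^-1 = W^*%C by rewrite /W conjc_inv.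
rewrite WJ -/W.
have sq0 : Num.sqrt qR != 0 by rewrite gt_eqF// sqrtr_gt0 ltr0n.
have sq2 : Num.sqrt qR ^+ 2 = qR by rewrite sqr_sqrtr// ler0n.
have WW : W * W^*%C = (qR^-1)%:C.
  by rewrite /W -WJ -invfM zqM_conj fmorphV rmorph_nat.
have WD : W + W^*%C = (2 * qR `^ (- 2^-1) * cos (s * ln qR))%:C.
  rewrite -WJ /W zqVE zqJVE -mulrDr addrC zqD_conj -rmorphM /=.
  congr (_%:C); rewrite powRN powR12_sqrt ?ler0n// -{1}sq2; field; exact: sq0.
have q1n : 1 + qR != 0 by rewrite gt_eqF// addr_gt0 ?ltr01// ltr0n.
pose k : R[i] := (qR / q.+1%:R)%:C.
have kE : k * (1 + (qR^-1)%:C) = 1.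
  rewrite /k -(rmorph1 (real_complex R)) -rmorphD -rmorphM /=; congr (_%:C).
  by rewrite -natr1; field; rewrite [_ + 1]addrC q1n pnatr_eq0 -lt0n q0.
have S1 : (sph 1 s)%:C = k * (W + W^*%C) by rewrite WD /k spherical1 !rmorphM.
have SS m : (sph m.+2 s)%:C = (W + W^*%C) * (sph m.+1 s)%:C - (sph m s)%:C * (W * W^*%C).
  by rewrite WD WW sphericalSS rmorphB !rmorphM.
elim: n => [|n IH].
  rewrite S1 expr1 -/k spherical0 rmorph1 mulr1.
  transitivity (k * (1 + W * W^*%C) * W^*%C + k * (W * (1 - W^*%C ^+ 2))).
    by ring.
  by rewrite WW kE mul1r.
rewrite SS exprS -/k in IH *.
have -> : (W + W^*%C) * (sph n.+1 s)%:C - (sph n s)%:C * (W * W^*%C) =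
  W^*%C * (sph n.+1 s)%:C + W * ((sph n.+1 s)%:C - W^*%C * (sph n s)%:C) by ring.
rewrite {2}IH !exprS; move: (W ^+ n) (W^*%C) => Wn Wc; ring.
Qed.

Let nu_lty : (nu [set: boundary o] < +oo)%E.
Proof. exact: le_lt_trans (probability_le1 nu measurableT) (ltry _). Qed.

Definition sph_int x y s : R[i] :=
  cintegral nu setT (fun w : boundary o => kernel x (w, s) * (kernel y (w, s))^*%C).

Lemma cintegrable_kernelM x y s : cintegrable nu setT
  (fun w : boundary o => kernel x (w, s) * (kernel y (w, s))^*%C).
Proof.
have [M1 H1] := kernel_bounded x; have [M2 H2] := kernel_bounded y.
apply: (@cintegrable_bounded _ _ _ _ _ measurableT _ _ (M1 * M2)).
- exact: nu_lty.
- apply: (@cmeasurable_section _ _ _ _ _ (fun ws => kernel x ws * (kernel y ws)^*%C)).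
  by apply: cmeasurableM; [|apply: cmeasurableJ]; exact: cmeasurable_kernel.
- by move=> w _; rewrite Normc.normcM normcJ ler_pM ?normc_ge0.
Qed.

Lemma sph_intJ x y s : sph_int y x s = (sph_int x y s)^*%C.
Proof.
rewrite /sph_int -cintegralJ//; last exact: cintegrable_kernelM.
by apply: cintegral_eq => w _; rewrite conjcM conjcK mulrC.
Qed.

Lemma cintegral_cyl z s : z <> o ->
  cintegral nu setT (fun w : boundary o => @cyl_indic R q X o z (w, s)) =
  (qR / (q.+1%:R * qR ^+ dist o z))%:C.
Proof.
move=> zo; rewrite /cintegral /cyl_indic /= Rintegral_cst// mul0r; congr (_ +i* _).
rewrite /Rintegral integral_indic ?setIT//; last exact: measurable_cylinder.
by rewrite [X in fine X](nu_cylinder zo).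
Qed.

Lemma cintegrable_cyl z s :
  cintegrable nu setT (fun w : boundary o => @cyl_indic R q X o z (w, s)).
Proof.
apply: (@cintegrable_bounded _ _ _ _ _ measurableT _ _ 1).
- exact: nu_lty.
- by apply: (@cmeasurable_section _ _ _ _ _ (cyl_indic z)); exact: cmeasurable_cyl_indic.
- move=> w _; rewrite /cyl_indic normcE /= expr0n addr0 sqrtr_sqr indicE.
  by case: (_ \in _); rewrite ?normr1 ?normr0.
Qed.

(** As [x] is on the side of [z'], the kernel at [x] does not depend on the ray within the cylinder
    of [z]. The correction term of [kernel_child] therefore integrates to a constant times the
    measure of the cylinder, and the powers [q^|z|] cancel. *)
Lemma sph_int_step x z' z s : adj z' z -> dist o z = (dist o z').+1 ->
  dist x z = (dist x z').+1 ->
  sph_int x z s = ((zq s)^*%C)^-1 * sph_int x z' s +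
    (qR / q.+1%:R)%:C * ((zq s)^-1 ^+ dist x z * (1 - ((zq s)^*%C)^-1 ^+ 2)).
Proof.
move=> zz oz xz.
have zo : z <> o by move=> e; rewrite e distxx in oz.
pose c := (zq s) ^+ dist o z * (zq s)^-1 ^+ dist x z *
  ((zq s)^*%C ^+ dist o z * (1 - ((zq s)^*%C)^-1 ^+ 2)).
have E : {in setT, (fun w : boundary o => kernel x (w, s) * (kernel z (w, s))^*%C) =1
  (fun w => ((zq s)^*%C)^-1 * (kernel x (w, s) * (kernel z' (w, s))^*%C) +
     c * cyl_indic z (w, s))}.
  move=> w _; rewrite (kernel_child (w, s) zz oz) conjcD !conjcM conjcB conjc1.
  rewrite !conjcX !conjc_inv mulrDr mulrCA; congr (_ + _).
  rewrite /cyl_indic conjc_real indicE.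
  have [/set_mem wz|_] := boolP (w \in cylinder z); last by rewrite mul0r !mulr0.
  by rewrite /= !mulr1 mul1r (kernel_on (ws := (w, s)) zz oz wz xz).
rewrite /sph_int (cintegral_eq _ E) cintegralD//; last 2 first.
- by apply: cintegrableZ => //; exact: cintegrable_kernelM.
- by apply: cintegrableZ => //; exact: cintegrable_cyl.
rewrite cintegralZ//; last exact: cintegrable_cyl.
rewrite cintegralZ//; last exact: cintegrable_kernelM.
rewrite cintegral_cyl//; congr (_ + _).
have -> : c = (zq s * (zq s)^*%C) ^+ dist o z *
    ((zq s)^-1 ^+ dist x z * (1 - ((zq s)^*%C)^-1 ^+ 2)) by rewrite /c exprMn; ring.
rewrite mulrAC; congr (_ * _); rewrite zqM_conj -(rmorph_nat (real_complex R)).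
rewrite -rmorphXn -rmorphM /=; congr (_%:C).
have qn : qR ^+ dist o z != 0 by rewrite expf_neq0// pnatr_eq0 -lt0n.
by move: (qR ^+ _) qn => Y Y0; field; rewrite Y0 [1 + _]addrC natr1 pnatr_eq0.
Qed.

(** From the parent to [x] the squared modulus is divided by [q] off the cylinder of [x] and
    multiplied by [q] on it; the measure of the cylinder makes the two effects balance. *)
Lemma sph_int_diag x s : sph_int x x s = 1.
Proof.
move: {2}(dist o x) (erefl (dist o x)) => n; elim: n x => [|n IH] x dx.
  rewrite (dist_eq0 dx) /sph_int (@cintegral_eq _ _ _ nu setT _ (fun=> 1)).
    by rewrite cintegral_cst// mul1r (congr1 fine (probability_setT nu)).
  by move=> w _; rewrite kernel_root mul1r conjc1.
have [x' [xx ox]] : exists x', adj x' x /\ dist o x = (dist o x').+1.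
  by apply: parent_exists => xo; rewrite xo distxx in dx.
have xo : x <> o by move=> e; rewrite e distxx in dx.
(* On the cylinder the squared moduli at [x] and its parent are [q^|x|] and [q^(|x|-1)], so the
   excess over the uniform factor [1/q] is [q^|x| - q^(|x|-2)]. *)
pose c : R[i] := (qR ^+ dist o x * (1 - (qR^-1) ^+ 2))%:C.
have zz : (zq s)^-1 * ((zq s)^*%C)^-1 = (qR^-1)%:C.
  by rewrite -invfM zqM_conj fmorphV rmorph_nat.
have qn : qR != 0 by rewrite pnatr_eq0 -lt0n.
have E : {in setT, (fun w : boundary o => kernel x (w, s) * (kernel x (w, s))^*%C) =1
  (fun w => (qR^-1)%:C * (kernel x' (w, s) * (kernel x' (w, s))^*%C) +
     c * cyl_indic x (w, s))}.
  move=> w _; rewrite /cyl_indic indicE /=.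
  have [/set_mem wz|/negP nx] := boolP (w \in cylinder x); last first.
    have nw : ~ cylinder x (w, s).1 by move=> h; apply: nx; exact: mem_set.
    rewrite mulr0 addr0 (kernel_off xx ox nw) conjcM conjc_inv -zz.
    by rewrite mulrACA.
  have wz' : cylinder x (w, s).1 by [].
  have kz m : zq s ^+ m * (zq s ^+ m)^*%C = (qR ^+ m)%:C.
    by rewrite conjcX -exprMn zqM_conj rmorphXn /= rmorph_nat.
  have e : kernel x' (w, s) = zq s ^+ dist o x'.
    rewrite (kernel_on (ws := (w, s)) xx ox wz') ?distxx ?(dist1 xx)//.
    by rewrite expr1 ox exprSr mulfK ?zq_neq0.
  rewrite mulr1 (kernel_cylinder wz') e !kz -rmorphM -rmorphD /=; congr (_%:C).
  by rewrite ox exprS; field.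
rewrite /sph_int (cintegral_eq _ E) cintegralD//; last 2 first.
- by apply: cintegrableZ => //; exact: cintegrable_kernelM.
- by apply: cintegrableZ => //; exact: cintegrable_cyl.
rewrite cintegralZ//; last exact: cintegrable_kernelM.
rewrite cintegralZ//; last exact: cintegrable_cyl.
rewrite -/(sph_int x' x' s) IH; last by lia.
rewrite cintegral_cyl// mulr1 -rmorphM -rmorphD -(rmorph1 (real_complex R)) /=.
congr (_%:C); have Yn : qR ^+ dist o x != 0 by rewrite expf_neq0.
rewrite -natr1; move: (qR ^+ _) Yn => Y Y0.
by field; rewrite qn Y0 gt_eqF// addr_gt0 ?ltr01// ltr0n.
Qed.

(* The recursion is run on the endpoint that the other one is not below. *)
Lemma sph_intE x y s : sph_int x y s = (sph (dist x y) s)%:C.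
Proof.
have step a b : (forall c, (dist o a + dist o c < dist o a + dist o b)%N ->
      sph_int a c s = (sph (dist a c) s)%:C) ->
    forall b', adj b' b -> dist o b = (dist o b').+1 -> dist a b = (dist a b').+1 ->
    sph_int a b s = (sph (dist a b) s)%:C.
  move=> IH b' bb ob ab; rewrite (sph_int_step s bb ob ab) IH; last by lia.
  by rewrite ab spherical_step.
move: {2}(dist o x + dist o y)%N (leqnn (dist o x + dist o y)) => n.
elim: n x y => [|n IH] x y xyn.
  have ex : x = o by apply: dist_eq0; lia.
  have ey : y = o by apply: dist_eq0; lia.
  by rewrite ex ey distxx sph_int_diag.
have [<-|/eqP yx] := eqVneq y x; first by rewrite distxx sph_int_diag.
have [ey|/eqP yo] := eqVneq y o.
  have [x' [xx ox]] : exists x', adj x' x /\ dist o x = (dist o x').+1.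
    by apply: parent_exists => xo; rewrite ey xo in yx.
  rewrite sph_intJ dist_sym (step y x _ x')// ?conjc_real// ?ey//.
  by move=> c h; apply: IH; rewrite ey in xyn *; lia.
have [y' [yy oy]] := parent_exists yo.
have [xy|xy] := dist_adj x yy.
  by apply: (step x y _ y') => // c h; apply: IH; lia.
have dxy : dist o x = (dist o y + dist y x)%N.
  by rewrite (dist_through_edge yy oy xy) oy.
have xo : x <> o by move=> e; move: dxy; rewrite e distxx oy; lia.
have [x' [xx ox]] := parent_exists xo.
have yx' : dist y x = (dist y x').+1.
  have [//|h] := dist_adj y xx.
  have := dist_through_edge xx ox h; have := dist_sym x y.
  have : dist y x <> 0%N by move=> /dist_eq0 e; apply: yx.
  lia.
rewrite sph_intJ dist_sym (step y x _ x')// ?conjc_real//.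
by move=> c h; apply: IH; lia.
Qed.

Theorem kernel_orthonormal x y :
  cintegral (nu \x planch)%E setT (fun ws => kernel x ws * (kernel y ws)^*%C) =
  (x == y)%:R.
Proof.
have [M1 H1] := kernel_bounded x; have [M2 H2] := kernel_bounded y.
rewrite (@cintegral_fubini _ _ _ _ _ _ _ _ (M1 * M2)); last 2 first.
- by apply: cmeasurableM; [|apply: cmeasurableJ]; exact: cmeasurable_kernel.
- by move=> w; rewrite Normc.normcM normcJ ler_pM ?normc_ge0.
rewrite (@cintegral_eq _ _ _ planch setT _ (fun s => (sph (dist x y) s)%:C)).
  rewrite /cintegral /= Rintegral_cst// mul0r integral_spherical//.
  have -> : (dist x y == 0)%N = (x == y).
    by apply/eqP/eqP => [/dist_eq0 -> //|->]; rewrite distxx.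
  by rewrite -(rmorph_nat (real_complex R)).
by move=> s _; exact: sph_intE.
Qed.
End orthonormality.

(** * Completeness of the functions q^((1/2 + is) h(x)) *)

Section vanishing_integrals.
Context {R : realType} d (T : measurableType d) (mu : {measure set T -> \bar R}).
Context (D : set T) (mD : measurable D).

(** The pi-lambda argument for the signed set function [A -> int_(D & A) h]. Its vanishing on the
    whole of [D] lets the family of null sets contain the full space and complements. *)
Lemma vanishing_dynkin (h : T -> R) : mu.-integrable D (EFin \o h) ->
  (\int[mu]_(x in D) (h x)%:E = 0)%E ->
  forall G, setI_closed G -> G `<=` measurable ->
  (forall A, G A -> \int[mu]_(x in D `&` A) (h x)%:E = 0)%E ->
  forall A, <<s G >> A -> measurable A /\ (\int[mu]_(x in D `&` A) (h x)%:E = 0)%E.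
Proof.
move=> hi h0 G GI Gm GH A sA.
suff : <<s G >> `<=` [set A | measurable A /\ (\int[mu]_(x in D `&` A) (h x)%:E = 0)%E].
  by move=> /(_ _ sA).
apply: lambda_system_subset; [by []| | |by []]; last first.
  by move=> B GB; split; [exact: Gm|exact: GH].
apply/dynkin_lambda_system; split => //.
- by split; [exact: measurableT|rewrite setIT].
- move=> B [mB B0]; split; first exact: measurableC.
  have : (\int[mu]_(x in (D `&` B) `|` (D `&` ~` B)) (h x)%:E = 0)%E.
    by rewrite -setIUr setUv setIT.
  rewrite integral_setU.
  - by rewrite B0 add0e.
  - exact: measurableI.
  - by apply: measurableI => //; exact: measurableC.
  - by rewrite -setIUr setUv setIT; exact: measurable_int hi.
  - by apply/disj_setPS => x [[_ Bx] [_ nBx]].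
- move=> F tF FH; split; first by apply: bigcup_measurable => k _; have [] := FH k.
  rewrite setI_bigcupr integral_bigcup//.
  - by rewrite eseries0// => k _ _; have [] := FH k.
  - exact: trivIset_setIl.
  - by move=> k; apply: measurableI => //; have [] := FH k.
  - rewrite -setI_bigcupr; apply: integrableS hi => //.
    by apply: measurableI => //; apply: bigcup_measurable => k _; have [] := FH k.
Qed.

(** Dominated convergence with dominating function [M |F|]: a vanishing integral passes to bounded
    almost everywhere limits of the test functions. [key] treats the real and the imaginary part
    alike. *)
Lemma cintegral_eq0_limit (F : T -> R[i]) (g_ : nat -> T -> R[i]) (g : T -> R[i]) (M : R) :
  cintegrable mu D F ->
  (forall n, cmeasurable_fun D (g_ n)) -> cmeasurable_fun D g ->
  (forall n x, D x -> normc (g_ n x) <= M) ->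
  {ae mu, forall x, D x -> (normc (g_ n x - g x) @[n --> \oo] --> (0 : R))} ->
  (forall n, cintegral mu D (fun x => F x * g_ n x) = 0) ->
  cintegral mu D (fun x => F x * g x) = 0.
Proof.
move=> Fi mgn mg gM gc g0; have [mF Ff] := Fi.
have iN : mu.-integrable D (EFin \o (fun x => normc (F x))).
  apply/integrableP; split; first exact/measurable_EFinP/measurable_normc.
  by under eq_integral do rewrite /= ger0_norm ?normc_ge0//.
have Fn : mu.-integrable D (EFin \o (fun x => normc (F x) * M)).
  exact: (integrableZr mD M iN).
have key (f_ : nat -> T -> R) (f : T -> R) :
    (forall n, measurable_fun D (f_ n)) -> measurable_fun D f ->
    (forall n x, D x -> `|f_ n x| <= normc (F x * g_ n x)) ->
    (forall n x, D x -> `|f_ n x - f x| <= normc (F x * (g_ n x - g x))) ->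
    (forall n, Rintegral mu D (f_ n) = 0) -> Rintegral mu D f = 0.
  move=> mfn mf fb fc f0; rewrite /Rintegral.
  have fM n x : D x -> `|f_ n x| <= normc (F x) * M.
    move=> Dx; apply: le_trans (fb n x Dx) _.
    by rewrite Normc.normcM ler_wpM2l ?normc_ge0// gM.
  have [|||||_ _] := @dominated_convergence _ _ _ mu D mD (fun n => EFin \o f_ n) (EFin \o f)
    (EFin \o (fun x => normc (F x) * M)).
  - by move=> n; exact/measurable_EFinP.
  - exact/measurable_EFinP.
  - apply: filterS gc => x cx Dx; apply: cvg_EFin; first exact: nearW.
    have c0 : normc (F x) * normc (g_ n x - g x) @[n --> \oo] --> (0 : R).
      by rewrite -(mulr0 (normc (F x))); apply: cvgMl_tmp; exact: cx.
    apply/cvgrPdist_lt => e e0; move/cvgrPdist_lt: c0 => /(_ e e0).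
    apply: filterS => n; rewrite sub0r normrN ger0_norm ?mulr_ge0 ?normc_ge0//.
    by apply: le_lt_trans; rewrite distrC -Normc.normcM; exact: fc.
  - exact: Fn.
  - by apply: aeW => x n Dx /=; rewrite lee_fin fM.
  - move=> h; suff -> : (\int[mu]_(x in D) (EFin \o f) x = 0)%E by [].
    apply: (cvg_unique _ h); first exact: ereal_hausdorff.
    rewrite (_ : [sequence _]_n = cst 0%E); first exact: cvg_cst.
    apply/funext => n /=.
    have fi : mu.-integrable D (EFin \o f_ n).
      apply: le_integrable Fn => //; first exact/measurable_EFinP.
      by move=> x Dx /=; rewrite lee_fin (le_trans (fM n x Dx))// ler_norm.
    by rewrite -[LHS]fineK ?integrable_fin_num//; congr EFin; exact: f0.
rewrite /cintegral; congr (_ +i* _).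
  apply: (key (fun n x => complex.Re (F x * g_ n x))).
  - by move=> n; have [] := cmeasurableM mF (mgn n).
  - by have [] := cmeasurableM mF mg.
  - by move=> n x _; exact: Re_le_normc.
  - move=> n x _; apply: le_trans (Re_le_normc _).
    by rewrite mulrBr ReD; case: (F x * g x) => a b /=; rewrite lexx.
  - by move=> n; have := g0 n; rewrite /cintegral => -[].
apply: (key (fun n x => complex.Im (F x * g_ n x))).
- by move=> n; have [] := cmeasurableM mF (mgn n).
- by have [] := cmeasurableM mF mg.
- by move=> n x _; exact: Im_le_normc.
- move=> n x _; apply: le_trans (Im_le_normc _).
  by rewrite mulrBr ImD; case: (F x * g x) => a b /=; rewrite lexx.
- by move=> n; have := g0 n; rewrite /cintegral => -[].
Qed.
End vanishing_integrals.

(** * Bernstein approximation *)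

Section bernstein.
Context {R : realType}.
Implicit Types (u : R) (h : nat -> R).

(* The mean of [h] under the binomial law of parameters [n] and [u], i.e. the
   Bernstein polynomial with nodes [h], by conditioning on the first trial. *)
Fixpoint bernstein n h u : R :=
  if n is m.+1 then (1 - u) * bernstein m h u + u * bernstein m (h \o succn) u
  else h 0%N.

Lemma bernstein_le n h1 h2 u : 0 <= u <= 1 ->
  (forall k, (k <= n)%N -> h1 k <= h2 k) -> bernstein n h1 u <= bernstein n h2 u.
Proof.
move=> /andP[u0 u1]; elim: n h1 h2 => [|n IH] h1 h2 h12 /=; first exact: h12.
apply: lerD; apply: ler_wpM2l; rewrite ?subr_ge0//; apply: IH => k kn.
  by apply: h12; exact: leqW.
exact: h12.
Qed.

Lemma bernsteinD n h1 h2 u :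
  bernstein n (fun k => h1 k + h2 k) u = bernstein n h1 u + bernstein n h2 u.
Proof.
elim: n h1 h2 => [|n IH] h1 h2 //=; rewrite -/bernstein.
by rewrite IH [bernstein n (_ \o _) u](IH (h1 \o succn) (h2 \o succn)); ring.
Qed.

Lemma bernsteinZ n c h u : bernstein n (fun k => c * h k) u = c * bernstein n h u.
Proof.
elim: n h => [|n IH] h //=.
by rewrite IH [bernstein n (_ \o _) u](IH (h \o succn)); ring.
Qed.

Lemma bernstein_cst n c u : bernstein n (fun=> c) u = c.
Proof.
elim: n => [//|n IH] /=.
by rewrite [bernstein n (_ \o _) u](_ : _ = c) ?IH//; ring.
Qed.

(** The second moment of the binomial law about [c]. All [c] are treated at once because
    conditioning on the first trial shifts [c] by one. *)
Lemma bernstein_sqr n c u : bernstein n (fun k => (k%:R - c) ^+ 2) u =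
  (n%:R * u - c) ^+ 2 + n%:R * (u * (1 - u)).
Proof.
elim: n c => [|n IH] c /=; first by rewrite !mul0r addr0.
rewrite IH [bernstein n (_ \o _) u](_ : _ = bernstein n (fun k => (k%:R - (c - 1)) ^+ 2) u).
  by rewrite IH -natr1; ring.
by congr bernstein; apply/funext => k /=; rewrite -natr1; congr (_ ^+ 2); ring.
Qed.

Lemma bernstein_norm_le n h u M : 0 <= u <= 1 ->
  (forall k, (k <= n)%N -> `|h k| <= M) -> `|bernstein n h u| <= M.
Proof.
move=> u01 hM; rewrite ler_norml -{1}(bernstein_cst n (- M) u) -{2}(bernstein_cst n M u).
by apply/andP; split; apply: bernstein_le => // k kn; have := hM k kn;
  rewrite ler_norml => /andP[].
Qed.

(** Chebyshev's inequality in Bernstein's proof of the approximation theorem. The values [h n k] are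
    arbitrary, so that a function may be sampled at nodes other than [k/n]; only closeness to [l]
    when [k/n] is near [u] is asked for. *)
Lemma bernstein_cvg (h : nat -> nat -> R) (u l M : R) : 0 <= u <= 1 ->
  (forall n k, (k <= n)%N -> `|h n k| <= M) -> `|l| <= M ->
  (forall e, 0 < e -> exists2 del, 0 < del & forall n k, (0 < n)%N -> (k <= n)%N ->
    `|k%:R / n%:R - u| < del -> `|h n k - l| <= e) ->
  bernstein n (h n) u @[n --> \oo] --> l.
Proof.
move=> u01 hM lM hl; have M0 : 0 <= M by apply: le_trans lM.
have /andP[u0 u1] := u01.
apply/cvgrPdist_le => e e0.
have e2 : 0 < e / 2 by rewrite divr_gt0.
have [del del0 Hd] := hl _ e2.
(* Chosen so that [2 M <= C (k/n - u)^2] whenever [k/n] is at distance at least [del] from [u]; the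
   mean of this bound is at most [C / n]. *)
pose C := 2 * M / del ^+ 2.
have C0 : 0 <= C by rewrite divr_ge0 ?mulr_ge0 ?exprn_ge0// ltW.
near=> n.
have n0 : (0 < n)%N by near: n; exact: nbhs_infty_gt.
have nC : C / n%:R <= e / 2.
  rewrite ler_pdivrMr ?ltr0n// mulrC -ler_pdivrMr//.
  by near: n; exact: nbhs_infty_ger.
have nR : n%:R != 0 :> R by rewrite pnatr_eq0 -lt0n.
have bnd k : (k <= n)%N ->
    `|h n k - l| <= e / 2 + C / n%:R ^+ 2 * (k%:R - n%:R * u) ^+ 2.
  move=> kn.
  have -> : C / n%:R ^+ 2 * (k%:R - n%:R * u) ^+ 2 = C * (k%:R / n%:R - u) ^+ 2.
    by field.
  have [near_|far] := ltP `|k%:R / n%:R - u| del.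
    by rewrite (le_trans (Hd n k n0 kn near_))// lerDl mulr_ge0// sqr_ge0.
  apply: (@le_trans _ _ (2 * M)).
    by rewrite (le_trans (ler_normB _ _))// mulr_natl mulr2n lerD// hM.
  have -> : 2 * M = C * del ^+ 2 by rewrite /C mulfVK// expf_neq0// gt_eqF.
  apply: (@le_trans _ _ (C * (k%:R / n%:R - u) ^+ 2)); last by rewrite lerDr ltW.
  rewrite ler_wpM2l// -(real_normK (num_real (_ - u))).
  by apply: lerXn2r; rewrite ?nnegrE// ltW.
rewrite distrC -[l in X in `|X|](bernstein_cst n l u) -mulN1r -bernsteinZ -bernsteinD.
pose a k := h n k + -1 * l.
pose b k := e / 2 + C / n%:R ^+ 2 * (k%:R - n%:R * u) ^+ 2.
have ab k : (k <= n)%N -> `|a k| <= b k by move=> kn; rewrite /a mulN1r; exact: bnd.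
have Bb : bernstein n b u <= e.
  rewrite /b bernsteinD bernstein_cst bernsteinZ bernstein_sqr subrr expr0n add0r.
  have -> : C / n%:R ^+ 2 * (n%:R * (u * (1 - u))) = C / n%:R * (u * (1 - u)) by field.
  have u2 : u * (1 - u) <= 1 by nra.
  have Cn : 0 <= C / n%:R by rewrite divr_ge0.
  rewrite [leRHS](splitr e) lerD2l (le_trans _ nC)//.
  by rewrite -[leRHS]mulr1 ler_wpM2l.
apply: le_trans Bb; rewrite ler_norml; apply/andP; split.
  have -> : - bernstein n b u = bernstein n (fun k => -1 * b k) u.
    by rewrite bernsteinZ mulN1r.
  apply: bernstein_le => // k kn.
  by rewrite mulN1r; have := ab k kn; rewrite ler_norml => /andP[].
by apply: bernstein_le => // k kn; have := ab k kn; rewrite ler_norml => /andP[].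
Unshelve. all: by end_near.
Qed.
End bernstein.

Section completeness.
Context {R : realType} {q : nat} {X : homogeneous_tree q} {o : X}.
Context (nu : probability (boundary o) R).
Implicit Types (x y z : X) (s : R).
Local Notation phase_space := (boundary o * measurableTypeR R)%type.
Local Notation zq := (@zq R q).
Local Notation qR := (q%:R : R).
Local Notation kernel := (@kernel R q X o).
Local Notation tau := (tau R q).
Local Notation mu := (pmeas nu).
Local Notation D := (phase : set phase_space).
Local Notation I := (cintegral mu D).
Implicit Types (F G : phase_space -> R[i]) (ws : phase_space).

Let q0 : (0 < q)%N := @tree_gt0 q X.
Let q1 : (1 < q)%N := tree_order X.

Lemma measurable_phase : measurable D.
Proof. by apply: measurableX => //; exact: measurable_itv. Qed.
Let mD := measurable_phase.

Lemma pmeas_phase_fin : (mu D < +oo)%E.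
Proof.
have ms : measurable (`[0%R, tau]%classic : set (measurableTypeR R)) by exact: measurable_itv.
rewrite /pmeas /phase (product_measure1E _ _ measurableT ms).
by rewrite lte_mul_pinfty ?measure_ge0 ?fin_num_measure// ltey_eq fin_num_measure.
Qed.

Let cosl s := cos (s * ln qR).
(** The variable of the Bernstein polynomials: it maps [[0, tau]] decreasingly onto [[0, 1]]. *)
Let u s := (1 + cosl s) / 2.

Let cont_cosl : continuous cosl.
Proof.
move=> s; apply: continuous_comp; last exact: continuous_cos.
exact: mulrr_continuous.
Qed.

Lemma cmeasurable_real_snd (E : set phase_space) (g : R -> R) : continuous g ->
  cmeasurable_fun E (fun ws => (g ws.2)%:C).
Proof.
move=> cg; apply: (@cmeasurable_snd R q X o E (fun s => (g s)%:C)).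
by apply: cmeasurable_continuous => //= s; exact: cvg_cst.
Qed.

Lemma normc_real (a : R) : normc a%:C = `|a|.
Proof. by rewrite normcE /= expr0n addr0 sqrtr_sqr. Qed.

Definition poly_null F := cintegrable mu D F /\
  forall k, I (fun ws => F ws * ((cosl ws.2) ^+ k)%:C) = 0.

Let cont_cosX k : continuous (fun s => cosl s ^+ k).
Proof.
elim: k => [|k IH] s; first by under eq_fun do rewrite expr0; exact: cvg_cst.
by under eq_fun do rewrite exprS; apply: cvgM; [exact: cont_cosl|exact: IH].
Qed.

Let int_cosX F k : cintegrable mu D F ->
  cintegrable mu D (fun ws => F ws * ((cosl ws.2) ^+ k)%:C).
Proof.
move=> Fi; apply: (@cintegrableM_bounded _ _ _ _ _ mD _ _ 1 Fi).
  by apply: (@cmeasurable_real_snd _ (fun s => cosl s ^+ k)); exact: cont_cosX.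
by move=> ws _; rewrite normc_real normrX exprn_ile1//; exact: cos_max.
Qed.

Lemma poly_null_eq F G : F =1 G -> poly_null F -> poly_null G.
Proof. by move=> /funext ->. Qed.

Lemma poly_nullD F G : poly_null F -> poly_null G -> poly_null (fun ws => F ws + G ws).
Proof.
move=> [Fi F0] [Gi G0]; split; first exact: cintegrableD.
move=> k; have E : {in D, (fun ws => (F ws + G ws) * ((cosl ws.2) ^+ k)%:C) =1
    (fun ws => F ws * ((cosl ws.2) ^+ k)%:C + G ws * ((cosl ws.2) ^+ k)%:C)}.
  by move=> ws _; rewrite mulrDl.
rewrite (cintegral_eq _ E); apply: etrans (cintegralD mD (int_cosX k Fi) (int_cosX k Gi)) _.
by rewrite (F0 k) (G0 k) addr0.
Qed.

Lemma poly_nullZ c F : poly_null F -> poly_null (fun ws => c * F ws).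
Proof.
move=> [Fi F0]; split; first exact: cintegrableZ.
move=> k; have E : {in D, (fun ws => c * F ws * ((cosl ws.2) ^+ k)%:C) =1
    (fun ws => c * (F ws * ((cosl ws.2) ^+ k)%:C))}.
  by move=> ws _; rewrite mulrA.
rewrite (cintegral_eq _ E); apply: etrans (cintegralZ mD c (int_cosX k Fi)) _.
by rewrite (F0 k) mulr0.
Qed.

Lemma poly_null_cos F : poly_null F -> poly_null (fun ws => F ws * (cosl ws.2)%:C).
Proof.
move=> [Fi F0]; split; first by exact: (int_cosX 1 Fi).
move=> k; rewrite -[RHS](F0 k.+1); apply: cintegral_eq => ws _.
by rewrite -mulrA -rmorphM exprS.
Qed.

Lemma poly_null_u F : poly_null F -> poly_null (fun ws => F ws * (u ws.2)%:C).
Proof.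
move=> F0.
apply: (@poly_null_eq (fun ws => (2^-1)%:C * F ws + (2^-1)%:C * (F ws * (cosl ws.2)%:C))).
  by move=> ws; rewrite /u !(rmorphM, rmorphD) rmorph1 /=; ring.
by apply: poly_nullD; apply: poly_nullZ => //; exact: poly_null_cos.
Qed.

Lemma poly_null_bernstein n h F : poly_null F ->
  poly_null (fun ws => F ws * (bernstein n h (u ws.2))%:C).
Proof.
elim: n h F => [|n IH] h F F0.
  apply: (@poly_null_eq (fun ws => (h 0%N)%:C * F ws)); last exact: poly_nullZ.
  by move=> ws; rewrite mulrC.
apply: (@poly_null_eq (fun ws => (F ws * (bernstein n h (u ws.2))%:C +
   -1 * (F ws * (bernstein n h (u ws.2))%:C * (u ws.2)%:C)) +
    F ws * (bernstein n (h \o succn) (u ws.2))%:C * (u ws.2)%:C)).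
  move=> ws; rewrite -[bernstein n.+1 h _]/((1 - u ws.2) * bernstein n h (u ws.2) +
    u ws.2 * bernstein n (h \o succn) (u ws.2)).
  move: (u ws.2) (bernstein n h (u ws.2)) (bernstein n (h \o succn) (u ws.2)) => U B B'.
  by rewrite rmorphD !rmorphM rmorphB rmorph1; ring.
apply: poly_nullD; last by apply: poly_null_u; exact: IH.
apply: poly_nullD; first exact: IH.
by apply: poly_nullZ; apply: poly_null_u; exact: IH.
Qed.

Let u01 s : 0 <= u s <= 1.
Proof. by have := cos_geN1 (s * ln qR); have := cos_le1 (s * ln qR); rewrite /u /cosl; lra. Qed.

Let lnq0 := @lnq_gt0 R q q1.

Let u_dec s1 s2 : 0 <= s1 -> s1 < s2 -> s2 <= tau -> u s2 < u s1.
Proof.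
move=> s10 s12 s2t; rewrite /u ltr_pM2r// ltrD2l.
have H s : 0 <= s -> s <= tau -> s * ln qR \in `[0, pi].
  move=> s0 st; rewrite in_itv /= -ler_pdivlMr// st andbT mulr_ge0//.
  exact: ltW.
rewrite ltr_cos ?ltr_pM2r//; apply: H => //.
- exact: le_trans (ltW s12) s2t.
- exact: le_trans s10 (ltW s12).
Qed.

(** The point of [[0, tau]] at which [u] takes the value [k/n]; for [n = 0] the quotient is 0. *)
Let node n k : R := acos (2 * (k%:R / n%:R) - 1) / ln qR.

Let kn01 n k : (k <= n)%N -> 0 <= (k%:R / n%:R : R) <= 1.
Proof.
move=> kn; have [->|n0] := posnP n; first by rewrite invr0 mulr0 lexx ler01.
by rewrite divr_ge0//= ler_pdivrMr ?ltr0n// mul1r ler_nat.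
Qed.

Let node_seg n k : (k <= n)%N -> 0 <= node n k <= tau.
Proof.
move=> /kn01 kn.
have k1 : -1 <= (2 * (k%:R / n%:R) - 1 : R) <= 1 by lra.
apply/andP; split; first by apply: divr_ge0; [exact: acos_ge0|exact: ltW].
by rewrite /node /Defs.tau ler_pM2r ?invr_gt0// acos_lepi.
Qed.

Let u_node n k : (k <= n)%N -> u (node n k) = k%:R / n%:R.
Proof.
move=> /kn01; rewrite /u /cosl /node mulfVK ?gt_eqF//; move: (k%:R / n%:R : R) => x x01.
by rewrite acosK; [field|rewrite in_itv /=; lra].
Qed.

(** The polynomials in [u] that sample [g] at the nodes are bounded by the maximum of [g] and
    converge to it pointwise. Closeness of a node to [s] is read off from closeness of the values of
    [u], by monotonicity. *)
Lemma poly_null_real F (g : R -> R) : poly_null F -> continuous g ->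
  I (fun ws => F ws * (g ws.2)%:C) = 0.
Proof.
move=> F0 cg; have [Fi _] := F0.
have [M gM] : exists M, forall s, 0 <= s <= tau -> `|g s| <= M.
  have cn : {within `[0, tau], continuous (fun s => `|g s|)}.
    apply: continuous_subspaceT => s; apply: continuous_comp; first exact: cg.
    exact: norm_continuous.
  have [c _ cM] := EVT_max (ltW (tau_gt0 R q1)) cn.
  by exists `|g c| => s s0; apply: cM; rewrite in_itv.
apply: (@cintegral_eq0_limit _ _ _ _ _ mD F
  (fun n ws => (bernstein n (fun k => g (node n k)) (u ws.2))%:C) _ M Fi).
- move=> n; apply: (@cmeasurable_real_snd _ (fun s => bernstein n (fun k => g (node n k)) (u s))).
  have cu : continuous u.
    by move=> s; apply: cvgMr_tmp; apply: cvgD; [exact: cvg_cst|exact: cont_cosl].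
  move: (fun k => g (node n k)) => h; elim: n h => [|n IH] h s /=; first exact: cvg_cst.
  apply: cvgD; apply: cvgM; [|exact: IH|exact: cu|exact: IH].
  by apply: cvgB; [exact: cvg_cst|exact: cu].
- exact: cmeasurable_real_snd.
- move=> n ws Dws; rewrite normc_real; apply: bernstein_norm_le => // k kn.
  exact: gM (node_seg kn).
- apply: aeW => ws [_ /=]; rewrite in_itv /=; move: ws.2 => s s01.
  have c : bernstein n (fun k => g (node n k)) (u s) @[n --> \oo] --> g s.
    apply: (@bernstein_cvg _ (fun n k => g (node n k)) _ _ M) => //.
    - by move=> n k kn; exact: gM (node_seg kn).
    - exact: gM.
    move=> e e0.
    have /cvgrPdist_le/(_ e e0)/nbhs_ballP[eta /= eta0 He] := cg s.
    have [s0 st] := andP s01.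
    pose a := if 0 <= s - eta then u (s - eta) - u s else 1.
    pose b := if s + eta <= tau then u s - u (s + eta) else 1.
    have a0 : 0 < a.
      rewrite /a; case: ifPn => // h; rewrite subr_gt0; apply: u_dec => //.
      by rewrite ltrBlDr ltrDl.
    have b0 : 0 < b.
      by rewrite /b; case: ifPn => // h; rewrite subr_gt0; apply: u_dec => //; rewrite ltrDl.
    exists (Num.min a b); first by rewrite lt_min a0 b0.
    move=> n k n0 kn; rewrite -u_node// lt_min => /andP[ha hb].
    have /andP[t0 tt] := node_seg kn; rewrite distrC; apply: He.
    rewrite /ball /= distrC ltr_norml; apply/andP; split.
      rewrite ltrBrDr addrC ltNge; apply/negP => h.
      have h0 : 0 <= s - eta by apply: le_trans t0 _; lra.
      have h1 : u (s - eta) <= u (node n k).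
        have : node n k <= s - eta by lra.
        rewrite le_eqVlt => /predU1P[->//|h2]; apply/ltW/u_dec => //.
        by rewrite (le_trans _ st)// lerBlDr lerDl ltW.
      move: ha; rewrite /a h0 => /(le_lt_trans (ler_norm _)); lra.
    rewrite ltrBlDr addrC ltNge; apply/negP => h.
    have h0 : s + eta <= tau by apply: le_trans tt; lra.
    have h1 : u (node n k) <= u (s + eta).
      have : s + eta <= node n k by lra.
      rewrite le_eqVlt => /predU1P[->//|h2]; apply/ltW/u_dec => //.
      by rewrite addr_ge0// ltW.
    move: hb; rewrite /b h0 distrC => /(le_lt_trans (ler_norm _)); lra.
  have c' : bernstein n (fun k => g (node n k)) (u s) - g s @[n --> \oo] --> (0 : R).
    by rewrite -(subrr (g s)); apply: cvgB => //; exact: cvg_cst.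
  have e : (fun n => `|bernstein n (fun k => g (node n k)) (u s) - g s|) =
      (fun n => normc ((bernstein n (fun k => g (node n k)) (u s))%:C - (g s)%:C)).
    by apply/funext => n; rewrite -normc_real rmorphB.
  by rewrite -e -(normr0 R); apply: cvg_norm.
- move=> n; have [_ /(_ 0%N) e] := poly_null_bernstein n (fun k => g (node n k)) F0.
  by rewrite -[RHS]e; apply: cintegral_eq => ws _; rewrite expr0 mulr1.
Qed.

Definition ccont (f : R -> R[i]) :=
  continuous (fun s => complex.Re (f s)) /\ continuous (fun s => complex.Im (f s)).

Lemma ccont_cst c : ccont (fun=> c).
Proof. by split=> s; exact: cvg_cst. Qed.

Lemma ccontM f g : ccont f -> ccont g -> ccont (fun s => f s * g s).
Proof.
move=> [f1 f2] [g1 g2]; split.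
  rewrite (_ : (fun s => complex.Re _) = (fun s => complex.Re (f s) * complex.Re (g s) -
      complex.Im (f s) * complex.Im (g s))); last by apply/funext => s; rewrite ReM.
  by move=> s; apply: cvgB; apply: cvgM; [exact: f1|exact: g1|exact: f2|exact: g2].
rewrite (_ : (fun s => complex.Im _) = (fun s => complex.Re (f s) * complex.Im (g s) +
    complex.Im (f s) * complex.Re (g s))); last by apply/funext => s; rewrite ImM.
by move=> s; apply: cvgD; apply: cvgM; [exact: f1|exact: g2|exact: f2|exact: g1].
Qed.

Lemma ccontB f g : ccont f -> ccont g -> ccont (fun s => f s - g s).
Proof.
move=> [f1 f2] [g1 g2]; split.
  rewrite (_ : (fun s => complex.Re _) = (fun s => complex.Re (f s) - complex.Re (g s)));
    last by apply/funext => s; case: (f s) (g s) => [? ?] [? ?].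
  by move=> s; apply: cvgB; [exact: f1|exact: g1].
rewrite (_ : (fun s => complex.Im _) = (fun s => complex.Im (f s) - complex.Im (g s)));
  last by apply/funext => s; case: (f s) (g s) => [? ?] [? ?].
by move=> s; apply: cvgB; [exact: f2|exact: g2].
Qed.

Lemma ccontX f n : ccont f -> ccont (fun s => f s ^+ n).
Proof.
move=> cf; elim: n => [|n IH]; first exact: ccont_cst.
rewrite (_ : (fun s => _) = (fun s => f s * f s ^+ n)); first exact: ccontM.
by apply/funext => s; rewrite exprS.
Qed.

Lemma ccontV f : (forall s, f s != 0) -> ccont f -> ccont (fun s => (f s)^-1).
Proof.
move=> f0 [f1 f2].
pose n s := complex.Re (f s) ^+ 2 + complex.Im (f s) ^+ 2.
have n0 s : n s != 0.
  rewrite /n -sqr_normcE expf_neq0//; apply: contra (f0 s) => /eqP e.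
  by apply/eqP; exact: Normc.eq0_normc.
have cn : continuous n.
  move=> s; apply: cvgD; rewrite expr2; apply: cvgM;
    [exact: f1|exact: f1|exact: f2|exact: f2].
split.
  rewrite (_ : (fun s => complex.Re _) = (fun s => complex.Re (f s) / n s)).
    by move=> s; apply: cvgM; [exact: f1|apply: cvgV => //; exact: cn].
  by apply/funext => s; rewrite /n; case: (f s).
rewrite (_ : (fun s => complex.Im _) = (fun s => - (complex.Im (f s) / n s))).
  move=> s; apply: cvgN; apply: cvgM; [exact: f2|apply: cvgV => //; exact: cn].
by apply/funext => s; rewrite /n; case: (f s).
Qed.

Lemma ccont_zq : ccont zq.
Proof.
have ct : continuous (fun s : R => s * ln qR) by exact: mulrr_continuous.
split.
  rewrite (_ : (fun s => _) = (fun s => Num.sqrt qR * cos (s * ln qR))); last first.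
    by apply/funext => s; rewrite zqE.
  move=> s; apply: cvgMl_tmp; apply: continuous_comp; first exact: ct.
  exact: continuous_cos.
rewrite (_ : (fun s => _) = (fun s => Num.sqrt qR * sin (s * ln qR))); last first.
  by apply/funext => s; rewrite zqE.
move=> s; apply: cvgMl_tmp; apply: continuous_comp; first exact: ct.
exact: continuous_sin.
Qed.

Lemma ccont_bounded f : ccont f -> exists M, forall s, 0 <= s <= tau -> normc (f s) <= M.
Proof.
move=> [f1 f2].
have B (g : R -> R) : continuous g -> exists M, forall s, 0 <= s <= tau -> `|g s| <= M.
  move=> cg; have cn : {within `[0, tau], continuous (fun s => `|g s|)}.
    apply: continuous_subspaceT => s; apply: continuous_comp; first exact: cg.
    exact: norm_continuous.
  have [c _ cM] := EVT_max (ltW (tau_gt0 R q1)) cn.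
  by exists `|g c| => s s0; apply: cM; rewrite in_itv.
have [M1 H1] := B _ f1; have [M2 H2] := B _ f2.
exists (M1 + M2) => s s0; apply: le_trans (normc_le_ReIm _) _.
by rewrite lerD// ?H1 ?H2.
Qed.

Lemma cintegrable_ccont F f : cintegrable mu D F -> ccont f ->
  cintegrable mu D (fun ws => F ws * f ws.2).
Proof.
move=> Fi cf; have [M fM] := ccont_bounded cf.
apply: (@cintegrableM_bounded _ _ _ _ _ mD _ _ M Fi).
  apply: (@cmeasurable_snd R q X o D f); case: cf => f1 f2.
  by apply: cmeasurable_continuous.
by move=> ws [_ /=]; rewrite in_itv; exact: fM.
Qed.

Lemma poly_null_ccont F f : poly_null F -> ccont f ->
  I (fun ws => F ws * f ws.2) = 0.
Proof.
move=> F0 [f1 f2]; have [Fi _] := F0.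
have cr (g : R -> R) : continuous g -> ccont (fun s => (g s)%:C).
  by move=> cg; split => //= s; exact: cvg_cst.
have i1 := cintegrable_ccont Fi (cr _ f1).
have i2 := cintegrable_ccont Fi (cr _ f2).
rewrite (@cintegral_eq _ _ _ mu D _ (fun ws => F ws * (complex.Re (f ws.2))%:C +
    (0 +i* 1) * (F ws * (complex.Im (f ws.2))%:C))); last first.
  by move=> ws _; case: (F ws) (f ws.2) => [a b] [c d]; simpc => /=; congr (_ +i* _); ring.
rewrite (cintegralD mD i1 (cintegrableZ mD _ i2)) (cintegralZ mD _ i2).
by rewrite (poly_null_real F0 f1) (poly_null_real F0 f2) mulr0 addr0.
Qed.

Section kernel_annihilator.
Context (F : phase_space -> R[i]) (Fi : cintegrable mu D F).
Context (F0 : forall y, I (fun ws => F ws * kernel y ws) = 0).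

Let int_kernel y : cintegrable mu D (fun ws => F ws * kernel y ws).
Proof.
have [M kM] := kernel_bounded (R := R) (o := o) y.
apply: (@cintegrableM_bounded _ _ _ _ _ mD _ _ M Fi).
  by have [m n] := cmeasurable_kernel (R := R) (o := o) y; split; apply: measurable_funTS.
by move=> ws _; exact: kM.
Qed.

Lemma poly_null_kernel y : poly_null (fun ws => F ws * kernel y ws).
Proof.
split; first exact: int_kernel.
move=> k; elim: k y => [|k IH] y.
  by rewrite -[RHS](F0 y); apply: cintegral_eq => ws _; rewrite expr0 mulr1.
have fN : finite_set [set z | adj y z] by apply/finite_setP; exists q.+1; exact: tree_degree.
(* The sum over the neighbours multiplies the kernel by [2 q^(1/2) cos (s log q)]; [c] removes the
   constant, so one more cosine is traded for a sum over neighbours. *)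
pose c : R[i] := ((2 * Num.sqrt qR)^-1)%:C.
have sq0 : Num.sqrt qR != 0 by rewrite gt_eqF// sqrtr_gt0 ltr0n.
rewrite (@cintegral_eq _ _ _ mu D _ (fun ws => c *
    \sum_(z <- finmap.enum_fset (fset_set [set z | adj y z])) F ws * kernel z ws * ((cosl ws.2) ^+ k)%:C)).
  rewrite cintegralZ//; last by apply: cintegrable_sum => // z; exact: int_cosX.
  rewrite cintegral_sum//; last by move=> z; exact: int_cosX.
  by rewrite big1 ?mulr0.
move=> ws _; have lap : \sum_(z <- finmap.enum_fset (fset_set [set z | adj y z])) kernel z ws =
    (2 * Num.sqrt qR)%:C * (cosl ws.2)%:C * kernel y ws.
  by rewrite -fsbig_finite// kernel_nbrs zqD_conj rmorphM.
rewrite -mulr_suml -mulr_sumr lap exprS rmorphM.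
have cc : c * (2 * Num.sqrt qR)%:C = 1.
  by rewrite -rmorphM mulVf ?rmorph1// mulf_neq0.
transitivity ((c * (2 * Num.sqrt qR)%:C) *
  (F ws * kernel y ws * ((cosl ws.2)%:C * (cosl ws.2 ^+ k)%:C))); first by rewrite cc mul1r.
move: (cosl ws.2)%:C (cosl ws.2 ^+ k)%:C (2 * Num.sqrt qR)%:C => C Ck S; ring.
Qed.

(** The coefficient of the cylinder indicator in [kernel_child]. *)
Let w z s : R[i] := zq s ^+ dist o z * (1 - (zq s)^-1 ^+ 2).

Lemma annihilates_cylinder z f : ccont f ->
  I (fun ws => F ws * cyl_indic z ws * f ws.2) = 0.
Proof.
move=> cf; have [->|/eqP zo] := eqVneq z o.
  rewrite -[RHS](poly_null_ccont (poly_null_kernel o) cf).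
  apply: cintegral_eq => ws _; rewrite kernel_root /cyl_indic indicE mem_set ?mulr1//.
  by exists 0%N; exact: ray_start.
have [z' [zz oz]] := parent_exists zo.
have zn s : zq s != 0 by exact: zq_neq0.
have wn s : w z s != 0.
  rewrite mulf_neq0 ?expf_neq0// subr_eq0; apply/eqP => e.
  (* [zq^-2] has modulus [1/q], hence differs from 1. *)
  have := congr1 (fun c : R[i] => normc c) e.
  rewrite Normc.normc1 normcX Normc.normcV normc_zq exprVn sqr_sqrtr// => /esym/eqP.
  by rewrite invr_eq1 pnatr_eq1 => /eqP q_1; move: q1; rewrite q_1.
have cw : ccont (w z).
  apply: ccontM; first exact/ccontX/ccont_zq.
  apply: ccontB; first exact: ccont_cst.
  by apply: ccontX; apply: ccontV => //; exact: ccont_zq.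
have cg : ccont (fun s => (w z s)^-1 * f s) by apply: ccontM => //; exact: ccontV.
have cg' : ccont (fun s => (zq s)^-1 * ((w z s)^-1 * f s)).
  by apply: ccontM => //; apply: ccontV => //; exact: ccont_zq.
have n1 := poly_null_ccont (poly_null_kernel z) cg.
have n2 := poly_null_ccont (poly_null_kernel z') cg'.
rewrite (@cintegral_eq _ _ _ mu D _ (fun ws => F ws * kernel z ws * ((w z ws.2)^-1 * f ws.2) -
    F ws * kernel z' ws * ((zq ws.2)^-1 * ((w z ws.2)^-1 * f ws.2)))); last first.
  move=> ws _; rewrite (kernel_child ws zz oz) -/(w z ws.2).
  have := wn ws.2; have := zn ws.2.
  move: (w z ws.2) (zq ws.2) (kernel z' ws) (cyl_indic z ws) => W Z K C Z0 W0.
  by field; rewrite W0 Z0.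
rewrite (cintegralB mD (cintegrable_ccont (int_kernel z) cg)
  (cintegrable_ccont (int_kernel z') cg')).
by rewrite n1 n2 subrr.
Qed.
End kernel_annihilator.
End completeness.

(** * From cylinders times half-lines to all measurable sets *)

Section kernel_completeness.
Context {R : realType} {q : nat} {X : homogeneous_tree q} {o : X}.
Context (nu : probability (boundary o) R).
Implicit Types (x y z : X) (s : R).
Local Notation phase_space := (boundary o * measurableTypeR R)%type.
Local Notation kernel := (@kernel R q X o).
Local Notation tau := (tau R q).
Local Notation mu := (pmeas nu).
Local Notation D := (phase : set phase_space).
Local Notation I := (cintegral mu D).
Implicit Types (ws : phase_space).

Let mD : measurable D := measurable_phase.

Lemma cylinder_root : cylinder o = [set: ray o].
Proof. by apply/seteqP; split=> // w _; exists 0%N; exact: ray_start. Qed.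

(** If one ray meets [x] and then [y], then [x] lies on the geodesic from [o] to [y], so every ray
    through [y] meets [x]. Cylinders are thus nested or disjoint. *)
Lemma cylinder_meet x y :
  (dist o x <= dist o y)%N -> cylinder x `&` cylinder y = cylinder y :> set (boundary o) \/
  cylinder x `&` cylinder y = set0 :> set (boundary o).
Proof.
move=> xy; have [[w [wx wy]]|nw] := pselect (exists w : boundary o, cylinder x w /\ cylinder y w); last first.
  by right; apply/seteqP; split=> // w wxy; apply: nw; exists w.
left; apply/seteqP; split=> [w' []//|w' w'y]; split => //.
have dxy : dist x y = (dist o y - dist o x)%N.
  move: wx wy => /cylinderP {1}<- /cylinderP {1}<-; rewrite ray_geodesic; lia.
apply: (@ray_cylinder _ _ _ w' x (dist o y)).
by have /cylinderP -> := w'y; rewrite dxy subnKC.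
Qed.

(** The empty set is there for stability under intersection, since cylinders may be disjoint. *)
Definition boxes : set (set phase_space) :=
  [set A | A = set0 \/ exists z a, A = cylinder z `*` `]-oo, a[%classic].

Lemma boxesI : setI_closed boxes.
Proof.
move=> A B [->|[z [a ->]]]; first by left; rewrite set0I.
move=> [->|[y [b ->]]]; first by left; rewrite setI0.
rewrite -setXI.
have -> : `]-oo, a[%classic `&` `]-oo, b[%classic = `]-oo, Num.min a b[%classic :> set R.
  by apply/seteqP; split=> s /=; rewrite !in_itv /= lt_min; [move=> [-> ->]|move=> /andP].
wlog zy : z y a b / (dist o z <= dist o y)%N.
  move=> H; have [|/ltnW] := leqP (dist o z) (dist o y); first exact: H.
  by rewrite setIC minC; exact: H.
have [->|->] := cylinder_meet zy; last by left; rewrite set0X.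
by right; exists y, (Num.min a b).
Qed.

Lemma measurable_boxes : boxes `<=` measurable.
Proof.
move=> A [->|[z [a ->]]]; first exact: measurable0.
by apply: measurableX; [exact: measurable_cylinder|exact: measurable_itv].
Qed.

(** It suffices to reach the preimages of generators under both projections: a cylinder over the
    whole line is a countable union of boxes, and a half-line under all rays is the box over the
    cylinder of the root. *)
Lemma boxes_generate A : measurable A -> <<s boxes >> A.
Proof.
move: A; apply: smallest_sub; first exact: smallest_sigma_algebra.
have sb : sigma_algebra setT <<s boxes >> by exact: smallest_sigma_algebra.
have cyl z : <<s boxes >> (fst @^-1` (cylinder z : set (boundary o))).
  have -> : fst @^-1` (cylinder z : set (boundary o)) =
      \bigcup_n (cylinder z `*` (`]-oo, n%:R[%classic : set (measurableTypeR R))).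
    apply/seteqP; split=> [ws wz|ws [n _ []]//].
    exists (Num.truncn ws.2).+1 => //; split => //=.
    by rewrite in_itv /=; exact: truncnS_gt.
  case: sb => _ _; apply => n; apply: sub_sigma_algebra; right.
  by exists z, n%:R.
have itv a : <<s boxes >> (snd @^-1` (`]-oo, a[%classic : set (measurableTypeR R))).
  apply: sub_sigma_algebra; right; exists o, a; rewrite cylinder_root.
  by apply/seteqP; split=> ws //= [].
move=> A [[B mB <-]|[B mB <-]]; rewrite setTI.
  have : (range (@cylinder q X o)).-sigma.-measurable B by [].
  suff H : <<s range (@cylinder q X o) >> `<=`
      image_set_system setT (fst : phase_space -> boundary o) <<s boxes >>.
    by move=> /H; rewrite /image_set_system /= setTI.
  apply: smallest_sub; first exact: sigma_algebra_image.
  by move=> _ [z _ <-]; rewrite /image_set_system /= setTI; exact: cyl.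
have : (@RGenInftyO.G R).-sigma.-measurable B by rewrite -RGenInftyO.measurableE.
suff H : <<s @RGenInftyO.G R >> `<=`
    image_set_system setT (snd : phase_space -> measurableTypeR R) <<s boxes >>.
  by move=> /H; rewrite /image_set_system /= setTI.
apply: smallest_sub; first exact: sigma_algebra_image.
by move=> _ [a ->]; rewrite /image_set_system /= setTI; exact: itv.
Qed.

(** This is [n (a - s)] clamped to [[0, 1]], written with absolute values so that its continuity is
    immediate. At each [s] it eventually equals the indicator of []-oo, a[]. *)
Let ramp a n s : R := (`|n%:R * (a - s)| - `|n%:R * (a - s) - 1| + 1) / 2.

Let ramp01 a n s : `|ramp a n s| <= 1.
Proof.
rewrite /ramp; move: (n%:R * (a - s)) => x.
rewrite ler_norml; apply/andP; split.
  by have := ler_normB x 1; rewrite normr1; lra.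
by have := ler_normD (x - 1) 1; rewrite subrK normr1; lra.
Qed.

Let ramp_cont a n : continuous (ramp a n).
Proof.
have c0 : continuous (fun s : R => n%:R * (a - s)).
  by move=> s; apply: cvgMl_tmp; apply: cvgB; [exact: cvg_cst|exact: cvg_id].
have c1 (f : R -> R) : continuous f -> continuous (fun s => `|f s|).
  by move=> cf s; apply: continuous_comp; [exact: cf|exact: norm_continuous].
move=> s; apply: cvgMr_tmp; apply: cvgD; last exact: cvg_cst.
apply: cvgB; first exact: (c1 (fun s => n%:R * (a - s))).
by apply: (c1 (fun s => n%:R * (a - s) - 1)) => t; apply: cvgB; [exact: c0|exact: cvg_cst].
Qed.

Let ramp_cvg a s : \forall n \near \oo, ramp a n s = \1_(`]-oo, a[%classic) s.
Proof.
rewrite indicE; have [sa|sa] := ltP s a; last first.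
  rewrite memNset; last by rewrite /= in_itv /= => /(le_lt_trans sa); rewrite ltxx.
  apply: nearW => n; rewrite /ramp.
  have h : n%:R * (a - s) <= 0 by rewrite mulr_ge0_le0// subr_le0.
  move: (_ * _) h => x x0; rewrite ler0_norm// ler0_norm; last by lra.
  by rewrite /=; lra.
rewrite mem_set; last by rewrite /= in_itv.
near=> n; rewrite /ramp.
have h : 1 <= n%:R * (a - s).
  rewrite -ler_pdivrMr ?subr_gt0// mul1r.
  by near: n; exact: nbhs_infty_ger.
move: (_ * _) h => x x1; rewrite ger0_norm; last by lra.
by rewrite ger0_norm /=; lra.
Unshelve. all: by end_near.
Qed.

Context (F : phase_space -> R[i]) (Fi : cintegrable mu D F).
Context (F0 : forall y, I (fun ws => F ws * kernel y ws) = 0).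

Let int_cyl z : cintegrable mu D (fun ws => F ws * cyl_indic z ws).
Proof.
apply: (@cintegrableM_bounded _ _ _ _ _ mD _ _ 1 Fi); first exact: cmeasurable_cyl_indic.
by move=> ws _; rewrite /cyl_indic normc_real indicE; case: (_ \in _); rewrite ?normr1 ?normr0.
Qed.

Lemma annihilates_box z a :
  I (fun ws => F ws * cyl_indic z ws * (\1_(`]-oo, a[%classic) ws.2)%:C) = 0.
Proof.
apply: (@cintegral_eq0_limit _ _ _ _ _ mD _ (fun n ws => (ramp a n ws.2)%:C) _ 1 (int_cyl z)).
- by move=> n; apply: (@cmeasurable_real_snd _ _ _ _ _ (ramp a n)).
- split; apply: measurable_funTS; last exact: measurable_cst.
  apply: (measurableT_comp (measurable_indic _)); last exact: measurable_snd.
  exact: measurable_itv.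
- by move=> n ws _; rewrite normc_real.
- apply: aeW => ws _; apply: cvg_near_cst; apply: filterS (ramp_cvg a ws.2) => n ->.
  by rewrite subrr Normc.normc0.
- move=> n; apply: (@annihilates_cylinder _ _ _ _ nu F Fi F0 z (fun s => (ramp a n s)%:C)).
  by split => //= s; exact: cvg_cst.
Qed.

Let integral_box (h : phase_space -> R) A :
  mu.-integrable D (EFin \o h) -> (forall z a,
    Rintegral mu D (fun ws => h ws * (\1_(cylinder z) ws.1) * (\1_(`]-oo, a[%classic) ws.2)) = 0) ->
  boxes A -> (\int[mu]_(ws in D `&` A) (h ws)%:E = 0)%E.
Proof.
move=> hi h0 [->|[z [a ->]]]; first by rewrite setI0 integral_set0.
have mB : measurable (cylinder z `*` (`]-oo, a[%classic : set (measurableTypeR R)) : set phase_space).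
  by apply: measurable_boxes; right; exists z, a.
have fin : (\int[mu]_(ws in D `&` (cylinder z `*` `]-oo, a[%classic)) (h ws)%:E)%E \is a fin_num.
  apply: integrable_fin_num; first exact: measurableI.
  by apply: integrableS hi => //; exact: measurableI.
rewrite -(fineK fin); congr EFin; rewrite -[RHS](h0 z a).
rewrite -/(Rintegral _ _ _) Rintegral_mkcondr; apply: eq_Rintegral => ws _.
rewrite patchE !indicE in_setX.
by case: (ws.1 \in _); case: (ws.2 \in _); rewrite ?mulr1 ?mulr0 ?mul0r.
Qed.

Theorem kernel_complete : {ae mu, forall ws, D ws -> F ws = 0}.
Proof.
have key (h : phase_space -> R) : mu.-integrable D (EFin \o h) -> (forall z a,
    Rintegral mu D (fun ws => h ws * (\1_(cylinder z) ws.1) * (\1_(`]-oo, a[%classic) ws.2)) = 0) ->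
    {ae mu, forall ws, D ws -> h ws = 0}.
  move=> hi h0.
  have hD : (\int[mu]_(ws in D) (h ws)%:E = 0)%E.
    (* [D] lies inside the box over the root with bound [tau + 1], so the integral over all of [D]
       vanishes as well. *)
    rewrite -(@integral_box h (cylinder o `*` `]-oo, tau + 1[%classic) hi h0); last first.
      by right; exists o, (tau + 1).
    congr integral; apply/seteqP; split=> [ws [_ Ds]|ws []//]; split => //; split => /=.
      by rewrite cylinder_root.
    by move: Ds; rewrite /= !in_itv /= => /andP[_ h']; rewrite (le_lt_trans h')// ltrDl.
  have H A : measurable A -> (\int[mu]_(ws in D `&` A) (h ws)%:E = 0)%E.
    move=> /boxes_generate sA.
    by have [] := vanishing_dynkin mD hi hD boxesI measurable_boxes
      (fun A bA => integral_box hi h0 bA) sA.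
  have : ae_eq mu D (EFin \o h) (cst 0%E).
    apply: integral_ae_eq => // E ED mE.
    by rewrite integral0 -(setIidr ED) H.
  by apply: filterS => ws H' Dws; have /= [] := H' Dws.
have [fR fI] := (cintegrableP mu mD F).1 Fi.
have eR ws z a : F ws * cyl_indic z ws * (\1_(`]-oo, a[%classic) ws.2)%:C =
  (complex.Re (F ws) * \1_(cylinder z) ws.1 * \1_(`]-oo, a[%classic) ws.2) +i*
  (complex.Im (F ws) * \1_(cylinder z) ws.1 * \1_(`]-oo, a[%classic) ws.2).
  by rewrite /cyl_indic; case: (F ws) => u v /=; simpc.
have hR := key _ fR; have hI := key _ fI.
have a1 : {ae mu, forall ws, D ws -> complex.Re (F ws) = 0}.
  apply: hR => z a; have := annihilates_box z a; rewrite /cintegral => -[+ _].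
  by move=> <-; apply: eq_Rintegral => ws _; rewrite eR.
have a2 : {ae mu, forall ws, D ws -> complex.Im (F ws) = 0}.
  apply: hI => z a; have := annihilates_box z a; rewrite /cintegral => -[_ +].
  by move=> <-; apply: eq_Rintegral => ws _; rewrite eR.
apply: filterS2 a1 a2 => ws h1 h2 Dws.
by case: (F ws) (h1 Dws) (h2 Dws) => u v /= -> ->.
Qed.
End kernel_completeness.

(** * The Fourier-Helgason transform on l2 *)

Section series_convergence.
Context {R : realType}.
Implicit Types (u : nat -> R[i]) (l : R[i]).

Lemma sums_toP u l :
  sums_to u l <-> normc (\sum_(0 <= k < n) u k - l) @[n --> \oo] --> (0 : R).
Proof.
have nE (z : R[i]) : `|z| = (normc z)%:C by rewrite normc_def -normcE.
split=> [/cvgrPdist_lt H|/cvgrPdist_lt H].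
  apply/cvgrPdist_lt => e e0; have := H e%:C; rewrite ltcR => /(_ e0).
  apply: filterS => n; rewrite nE ltcR => h.
  by rewrite sub0r normrN ger0_norm ?normc_ge0// -normcN opprB.
apply/cvgrPdist_lt => -[e e'] e0.
(* In the order of [R[i]] a positive number is real. *)
have [e'0 {}e0] : e' = 0 /\ 0 < e by move: e0; rewrite ltcE /= => /andP[/eqP].
rewrite e'0; have := H e e0; apply: filterS => n.
rewrite sub0r normrN ger0_norm ?normc_ge0// => h.
have -> : e +i* 0 = e%:C by [].
by rewrite nE ltcR -normcN opprB.
Qed.

Lemma normc_cvg_eq u l l' :
  normc (u n - l) @[n --> \oo] --> (0 : R) -> normc (u n - l') @[n --> \oo] --> (0 : R) ->
  l = l'.
Proof.
move=> h h'; apply/eqP; rewrite -subr_eq0; apply/eqP/Normc.eq0_normc.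
apply/eqP; rewrite eq_le normc_ge0 andbT; apply/ler_addgt0Pr => e e0; rewrite add0r.
have e2 : 0 < e / 2 by rewrite divr_gt0.
move/cvgrPdist_lt: h => /(_ _ e2) h; move/cvgrPdist_lt: h' => /(_ _ e2) h'.
have [n [hn hn']] := filter_ex (filterI h h').
move: hn hn'; rewrite !sub0r !normrN !ger0_norm ?normc_ge0// => hn hn'.
have -> : l - l' = - (u n - l) + (u n - l') by ring.
rewrite (le_trans (le_normcD _ _))// normcN [leRHS](splitr e) lerD// ltW//.
Qed.

Lemma cvg_normc u l : normc (u n - l) @[n --> \oo] --> (0 : R) ->
  normc (u n) @[n --> \oo] --> (normc l : R).
Proof.
move=> h; apply/cvgrPdist_lt => e e0; move/cvgrPdist_lt : h => /(_ _ e0).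
apply: filterS => n; rewrite sub0r normrN ger0_norm ?normc_ge0//; apply: le_lt_trans.
have h1 := le_normcD (u n - l) l; have h2 := le_normcD (l - u n) (u n).
have h3 : normc (l - u n) = normc (u n - l) by rewrite -normcN opprB.
rewrite h3 in h2; rewrite !subrK in h1, h2.
by rewrite ler_norml; apply/andP; split; lra.
Qed.

Lemma cvg_Re u l : normc (u n - l) @[n --> \oo] --> (0 : R) ->
  complex.Re (u n) @[n --> \oo] --> (complex.Re l : R).
Proof.
move=> h; apply/cvgrPdist_lt => e e0; move/cvgrPdist_lt : h => /(_ _ e0).
apply: filterS => n; rewrite sub0r normrN ger0_norm ?normc_ge0//; apply: le_lt_trans.
by apply: le_trans (Re_le_normc _); rewrite distrC; case: (u n) l => [p r] [p' r'].
Qed.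

Lemma cvg_Im u l : normc (u n - l) @[n --> \oo] --> (0 : R) ->
  complex.Im (u n) @[n --> \oo] --> (complex.Im l : R).
Proof.
move=> h; apply/cvgrPdist_lt => e e0; move/cvgrPdist_lt : h => /(_ _ e0).
apply: filterS => n; rewrite sub0r normrN ger0_norm ?normc_ge0//; apply: le_lt_trans.
by apply: le_trans (Im_le_normc _); rewrite distrC; case: (u n) l => [p r] [p' r'].
Qed.

Lemma sums_to_unique u l l' : sums_to u l -> sums_to u l' -> l = l'.
Proof. by move=> /sums_toP h /sums_toP h'; exact: normc_cvg_eq h h'. Qed.

Lemma sums_toJ u l : sums_to u l -> sums_to (fun k => (u k)^*%C) l^*%C.
Proof.
move=> /sums_toP h; apply/sums_toP.
suff -> : (fun n => normc (\sum_(0 <= k < n) (u k)^*%C - l^*%C)) =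
  (fun n => normc (\sum_(0 <= k < n) u k - l)) by [].
apply/funext => n; rewrite -[RHS]normcJ conjcB; congr (normc (_ - _)).
by rewrite (raddf_sum (@conjc R)).
Qed.

Lemma summable_sums_to u : (\sum_(k <oo) (normc (u k))%:E < +oo)%E -> exists l, sums_to u l.
Proof.
move=> ufin; have u0 k : (0 <= (normc (u k))%:E)%E by rewrite lee_fin normc_ge0.
have cabs : cvgn (series (fun k => normc (u k))).
  apply: nondecreasing_is_cvgn.
    by apply: nondecreasing_series => k *; exact: normc_ge0.
  exists (fine (\sum_(k <oo) (normc (u k))%:E)%E) => _ [n _ <-].
  rewrite /series /= -lee_fin fineK; last by rewrite ge0_fin_numE// nneseries_ge0.
  by rewrite -sumEFin; apply: nneseries_lim_ge => k _ _.
have cdom (f : nat -> R) : (forall k, `|f k| <= normc (u k)) -> cvgn (series f).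
  move=> fu; apply: normed_cvg; apply: series_le_cvg cabs => k.
  - exact: normr_ge0.
  - exact: normc_ge0.
  - exact: fu.
have cR := cdom _ (fun k => Re_le_normc (u k)).
have cI := cdom _ (fun k => Im_le_normc (u k)).
exists (limn (series (fun k => complex.Re (u k))) +i*
        limn (series (fun k => complex.Im (u k)))).
apply/sums_toP/cvgrPdist_le => e e0; have e2 : 0 < e / 2 by rewrite divr_gt0.
move/cvgrPdist_lt : cR => /(_ _ e2) cR; move/cvgrPdist_lt : cI => /(_ _ e2) cI.
apply: filterS2 cR cI => n nR nI; rewrite sub0r normrN ger0_norm ?normc_ge0//.
apply: le_trans (normc_le_ReIm _) _; rewrite [e]splitr; apply: lerD.
  rewrite ReD -[complex.Re (- _)]/(- limn (series (fun k => complex.Re (u k)))).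
  rewrite (raddf_sum (@complex.Re R : Rcomplex R -> R)) distrC; exact: ltW.
rewrite ImD -[complex.Im (- _)]/(- limn (series (fun k => complex.Im (u k)))).
rewrite (raddf_sum (@complex.Im R : Rcomplex R -> R)) distrC; exact: ltW.
Qed.

Lemma sum_tail_le (a : nat -> R) (e : R) : (forall k, 0 <= a k) ->
  (\sum_(k <oo) (a k)%:E < +oo)%E -> 0 < e ->
  exists N, forall n m, (N <= n)%N -> \sum_(n <= k < n + m) a k <= e.
Proof.
move=> a0 afin e0; have a0' k : (0 <= (a k)%:E)%E by rewrite lee_fin.
have /fine_cvgP[tf /cvgrPdist_lt tc] := nneseries_tail_cvg afin (fun k _ => a0' k).
have [N _ HN] := filterI tf (tc _ e0).
exists N => n m /HN /= [nf]; rewrite sub0r normrN ger0_norm; last first.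
  by rewrite fine_ge0// nneseries_ge0.
move=> /ltW; apply: le_trans; rewrite -lee_fin fineK// -sumEFin.
by apply: (nneseries_lim_ge (m := n)) => k _ _.
Qed.
End series_convergence.

(** * Square-integrable functions and absolutely summable series *)

Section square_integrable.
Context {R : realType} d (T : measurableType d) (mu : {measure set T -> \bar R}).
Context (D : set T) (mD : measurable D) (muD : (mu D < +oo)%E).
Implicit Types (F G : T -> R[i]) (a b : R).

Definition sqint F : \bar R := (\int[mu]_(x in D) ((normc (F x)) ^+ 2)%:E)%E.

Lemma measurable_sqnormc F : cmeasurable_fun D F ->
  measurable_fun D (fun x => ((normc (F x)) ^+ 2)%:E).
Proof. by move=> mF; apply/measurable_EFinP/measurable_funX/measurable_normc. Qed.

Lemma sqint_ge0 F : (0 <= sqint F)%E.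
Proof. by apply: integral_ge0 => x _; rewrite lee_fin sqr_ge0. Qed.

Lemma eq_sqint F G : {in D, forall x, normc (F x) = normc (G x)} -> sqint F = sqint G.
Proof. by move=> FG; apply: eq_integral => x xD; rewrite FG. Qed.

Lemma sqintZ (c : R[i]) F a : cmeasurable_fun D F -> (sqint F <= (a ^+ 2)%:E)%E ->
  (sqint (fun x => (c * F x)%R) <= ((normc c * a) ^+ 2)%:E)%E.
Proof.
move=> mF Fa; rewrite /sqint.
under eq_integral do rewrite Normc.normcM exprMn EFinM.
rewrite ge0_integralZl//; last 3 first.
- exact: measurable_sqnormc.
- by move=> x _; rewrite lee_fin sqr_ge0.
- by rewrite lee_fin sqr_ge0.
have -> : ((normc c * a) ^+ 2)%:E = ((normc c ^+ 2)%:E * (a ^+ 2)%:E)%E by rewrite exprMn.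
by rewrite lee_wpmul2l// lee_fin sqr_ge0.
Qed.

(** Minkowski's inequality for upper bounds of the norms, which avoids square roots of extended
    reals. The weights in [(u + v)^2 <= (1 + b/a) u^2 + (1 + a/b) v^2] are those giving exactly
    [(a + b)^2]; they force [a] and [b] to be positive. *)
Lemma sqintD F G a b : cmeasurable_fun D F -> cmeasurable_fun D G ->
  0 < a -> 0 < b -> (sqint F <= (a ^+ 2)%:E)%E -> (sqint G <= (b ^+ 2)%:E)%E ->
  (sqint (fun x => (F x + G x)%R) <= ((a + b) ^+ 2)%:E)%E.
Proof.
move=> mF mG a0 b0 Fa Gb.
have ca : 0 <= 1 + b / a by rewrite addr_ge0 ?divr_ge0 ?ltW.
have cb : 0 <= 1 + a / b by rewrite addr_ge0 ?divr_ge0 ?ltW.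
have mF2 := measurable_sqnormc mF; have mG2 := measurable_sqnormc mG.
apply: (@le_trans _ _ (\int[mu]_(x in D) ((1 + b / a)%:E * ((normc (F x)) ^+ 2)%:E +
    (1 + a / b)%:E * ((normc (G x)) ^+ 2)%:E))%E).
  apply: ge0_le_integral => //.
  - by move=> x _; rewrite lee_fin sqr_ge0.
  - exact/measurable_sqnormc/cmeasurableD.
  - by apply: emeasurable_funD; exact: measurable_funeM.
  move=> x _; rewrite -!EFinM -EFinD lee_fin.
  apply: (@le_trans _ _ ((normc (F x) + normc (G x)) ^+ 2)).
    by rewrite ler_sqr ?nnegrE ?addr_ge0 ?normc_ge0//; exact: le_normcD.
  move: (normc (F x)) (normc (G x)) => u v.
  rewrite -subr_ge0.
  have -> : (1 + b / a) * u ^+ 2 + (1 + a / b) * v ^+ 2 - (u + v) ^+ 2 =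
      (b * u - a * v) ^+ 2 / (a * b) by field; rewrite !gt_eqF.
  by rewrite divr_ge0 ?sqr_ge0// mulr_ge0 ?ltW.
rewrite ge0_integralD//; last 4 first.
- by move=> x _; rewrite mule_ge0// lee_fin ?sqr_ge0.
- exact: measurable_funeM.
- by move=> x _; rewrite mule_ge0// lee_fin ?sqr_ge0.
- exact: measurable_funeM.
rewrite !ge0_integralZl//; try by move=> x _; rewrite lee_fin sqr_ge0.
have -> : (((a + b) ^+ 2)%:E = (1 + b / a)%:E * (a ^+ 2)%:E + (1 + a / b)%:E * (b ^+ 2)%:E)%E.
  by rewrite -!EFinM -EFinD; congr EFin; field; rewrite !gt_eqF.
by apply: leeD; rewrite lee_wpmul2l// lee_fin.
Qed.

Lemma sqint_sum (G : nat -> T -> R[i]) (a : nat -> R) n m :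
  (forall k, cmeasurable_fun D (G k)) -> (forall k, 0 < a k) ->
  (forall k, (sqint (G k) <= (a k ^+ 2)%:E)%E) ->
  (sqint (fun x => (\sum_(n <= k < n + m) G k x)%R) <=
    ((\sum_(n <= k < n + m) a k)%R ^+ 2)%:E)%E.
Proof.
move=> mG a0 Ga; elim: m => [|m IH].
  rewrite addn0 big_geq// expr0n /sqint integral0_eq// => x _.
  by rewrite big_geq// Normc.normc0 expr0n.
(* A single term is treated apart: [sqintD] needs a positive bound, and the empty sum has bound
   0. *)
have [m0|m0] := posnP m.
  rewrite m0 addn1 big_nat1; apply: le_trans (Ga n).
  by rewrite /sqint; under eq_integral do rewrite big_nat1.
have s0 : 0 < \sum_(n <= k < n + m) a k.
  case: m m0 {IH} => // m _; rewrite addnS big_nat_recr ?leq_addr//=.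
  by rewrite ltr_wpDl// sumr_ge0// => k _; exact: ltW.
rewrite addnS [in leRHS]big_nat_recr ?leq_addr//=.
have := sqintD (cmeasurable_sum (index_iota n (n + m)) mG) (mG (n + m)%N) s0 (a0 _) IH (Ga (n + m)%N).
apply: le_trans; rewrite le_eqVlt; apply/orP; left; apply/eqP.
by apply: eq_sqint => x _; rewrite big_nat_recr ?leq_addr.
Qed.

(** A crude form of the Cauchy-Schwarz inequality, from [|F| <= |F|^2 / a + a]; what matters is that
    the bound is linear in [a]. *)
Lemma integral_normc_le F a : cmeasurable_fun D F -> 0 < a -> (sqint F <= (a ^+ 2)%:E)%E ->
  (\int[mu]_(x in D) (normc (F x))%:E <= (a * (1 + fine (mu D)))%:E)%E.
Proof.
move=> mF a0 Fa; have mF2 := measurable_sqnormc mF.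
apply: (@le_trans _ _ (\int[mu]_(x in D) ((a^-1)%:E * ((normc (F x)) ^+ 2)%:E + a%:E))%E).
  apply: ge0_le_integral => //.
  - by move=> x _; rewrite lee_fin normc_ge0.
  - exact/measurable_EFinP/measurable_normc.
  - by apply: emeasurable_funD => //; exact: measurable_funeM.
  move=> x _; rewrite -EFinM -EFinD lee_fin; move: (normc (F x)) (normc_ge0 (F x)) => u u0.
  rewrite -subr_ge0.
  have -> : a^-1 * u ^+ 2 + a - u = ((u - a) ^+ 2 + u * a) / a by field; rewrite gt_eqF.
  by rewrite divr_ge0 ?addr_ge0 ?sqr_ge0 ?mulr_ge0// ltW.
have aV : 0 <= a^-1 by rewrite invr_ge0 ltW.
rewrite ge0_integralD//; last 3 first.
- by move=> x _; rewrite mule_ge0// lee_fin ?sqr_ge0.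
- exact: measurable_funeM.
- by move=> x _; rewrite lee_fin ltW.
rewrite ge0_integralZl//; last by move=> x _; rewrite lee_fin sqr_ge0.
rewrite integral_cst// mulrDr mulr1 EFinD; apply: leeD.
  apply: (@le_trans _ _ ((a^-1)%:E * (a ^+ 2)%:E)%E); first by rewrite lee_wpmul2l// lee_fin.
  by rewrite -EFinM lee_fin expr2 mulKf ?gt_eqF.
by rewrite EFinM fineK// ge0_fin_numE// measure_ge0.
Qed.

Lemma sqint_eq0 F : cmeasurable_fun D F -> sqint F = 0%E ->
  {ae mu, forall x, D x -> F x = 0}.
Proof.
move=> mF F0; have mF2 := measurable_sqnormc mF.
have : (\int[mu]_(x in D) `|((normc (F x)) ^+ 2)%:E| = 0)%E.
  by rewrite -[RHS]F0; apply: eq_integral => x _; rewrite gee0_abs// lee_fin sqr_ge0.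
move=> /(ae_eq_integral_abs mu mD mF2); apply: filterS => x H Dx.
have /= [/eqP] := H Dx; rewrite sqrf_eq0 => /eqP; exact: Normc.eq0_normc.
Qed.

Section riesz_fischer.
Context (G : nat -> T -> R[i]) (a : nat -> R).
Context (mG : forall k, cmeasurable_fun D (G k)) (a0 : forall k, 0 < a k).
Context (Ga : forall k, (sqint (G k) <= (a k ^+ 2)%:E)%E).
Context (a_sum : (\sum_(k <oo) (a k)%:E < +oo)%E).

Let total x : \bar R := (\sum_(k <oo) (normc (G k x))%:E)%E.

Let mnG k : measurable_fun D (fun x => (normc (G k x))%:E).
Proof. exact/measurable_EFinP/measurable_normc. Qed.

Let total_ge0 x : (0 <= total x)%E.
Proof. by apply: nneseries_ge0 => k _ _; rewrite lee_fin normc_ge0. Qed.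

Let total_fin : {ae mu, forall x, D x -> total x \is a fin_num}.
Proof.
apply: integrable_ae => //; apply/integrableP; split.
  apply: ge0_emeasurable_sum => // k x _ _; by rewrite lee_fin normc_ge0.
rewrite (eq_integral total); last by move=> x _; rewrite gee0_abs.
rewrite integral_nneseries//; last by move=> k x _; rewrite lee_fin normc_ge0.
have m0 : 0 <= 1 + fine (mu D) by rewrite addr_ge0// fine_ge0// measure_ge0.
apply: (@le_lt_trans _ _ (\sum_(k <oo) ((1 + fine (mu D))%:E * (a k)%:E))%E).
  apply: lee_nneseries => [k _ _|k _].
    by apply: integral_ge0 => x _; rewrite lee_fin normc_ge0.
  by rewrite -EFinM mulrC; exact: integral_normc_le.
rewrite nneseriesZl//; last by move=> k _; rewrite lee_fin ltW.
by rewrite lte_mul_pinfty// lee_fin.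
Qed.

Let S n x := \sum_(0 <= k < n) G k x.

(** The L^1 norms of the terms are summable too, so the sum of the moduli is finite almost
    everywhere and the series converges there. The L^2 error of a partial sum is at most the
    corresponding tail of the bounds. *)
Lemma riesz_fischer : exists F, [/\ cmeasurable_fun D F,
  {ae mu, forall x, D x -> sums_to (G ^~ x) (F x)} &
  sqint (fun x => (\sum_(0 <= k < n) G k x)%R - F x)%R @[n --> \oo] --> 0%E].
Proof.
have [N [mN N0 subN]] := total_fin.
have mI : cmeasurable_fun D (fun x => (\1_(~` N) x : R)%:C).
  split; last exact: measurable_cst.
  by apply: measurable_funTS; apply: measurable_indic; exact: measurableC.
(* Killing the terms on the null set [N] makes the series converge everywhere on [D], so that its
   limit is measurable. *)
have sumF x : exists l, D x -> sums_to (fun k => (\1_(~` N) x : R)%:C * G k x) l.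
  have [Dx|nDx] := pselect (D x); last by exists 0.
  suff [l ul] : exists l, sums_to (fun k => (\1_(~` N) x : R)%:C * G k x) l by exists l.
  apply: summable_sums_to; rewrite indicE; have [/set_mem nNx|_] := boolP (x \in ~` N).
    have tx : total x \is a fin_num.
      by apply: contrapT => h; apply: nNx; apply: subN => H; exact: h (H Dx).
    rewrite (eq_eseriesr (g := fun k => (normc (G k x))%:E)); last by move=> k _; rewrite mul1r.
    by move: tx; rewrite ge0_fin_numE.
  rewrite eseries0 ?ltry// => k _ _; by rewrite mul0r Normc.normc0.
have {sumF} /choice[F sumF] := sumF.
have mF : cmeasurable_fun D F.
  pose h n x := \sum_(0 <= k < n) (\1_(~` N) x : R)%:C * G k x.
  have mh n : cmeasurable_fun D (h n).
    by apply: cmeasurable_sum => k; exact: cmeasurableM.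
  split.
    apply: (@measurable_fun_cvg _ _ _ _ (fun n x => complex.Re (h n x))) => [m|x Dx].
      by have [] := mh m.
    by apply: cvg_Re; exact/sums_toP/sumF.
  apply: (@measurable_fun_cvg _ _ _ _ (fun n x => complex.Im (h n x))) => [m|x Dx].
    by have [] := mh m.
  by apply: cvg_Im; exact/sums_toP/sumF.
have SF x : D x -> ~ N x -> normc (S n x - F x) @[n --> \oo] --> (0 : R).
  move=> Dx nNx; apply/sums_toP; have := sumF x Dx; congr sums_to; apply/funext => k.
  by rewrite indicE mem_set// mul1r.
have mS n : cmeasurable_fun D (S n) by exact: cmeasurable_sum.
exists F; split => //.
  exists N; split => // x nS; apply: contrapT => nNx; apply: nS => Dx.
  by apply/sums_toP; exact: SF.
pose t n : \bar R := (\sum_(n <= k <oo) (a k)%:E)%E.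
have t0 n : (0 <= t n)%E by apply: nneseries_ge0 => k _ _; rewrite lee_fin ltW.
have tfin n : t n \is a fin_num.
  rewrite ge0_fin_numE//; apply: le_lt_trans a_sum.
  rewrite [leRHS](nneseries_split 0%N n) ?add0n; last by move=> k _; rewrite lee_fin ltW.
  by rewrite leeDr// sume_ge0// => k _; rewrite lee_fin ltW.
have tcvg : fine (t n) @[n --> \oo] --> (0 : R).
  apply: fine_cvg; apply: nneseries_tail_cvg => // k _; by rewrite lee_fin ltW.
have bound n : (sqint (fun x => S n x - F x)%R <= (fine (t n) ^+ 2)%:E)%E.
  (* Squares of partial sums of moduli starting at [n]: they increase with [m], and their limit
     dominates [|S n - F|^2] off [N]. Minkowski bounds their integrals uniformly by the squared
     tail. *)
  pose P m x := (\sum_(n <= k < n + m) normc (G k x)) ^+ 2.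
  have s0 m x : 0 <= \sum_(n <= k < n + m) normc (G k x).
    by apply: sumr_ge0 => k _; exact: normc_ge0.
  have Pnd x : {homo (fun m => (P m x)%:E) : m p / (m <= p)%N >-> (m <= p)%E}.
    move=> m p mp; rewrite lee_fin /P ler_sqr ?nnegrE//.
    rewrite (@big_cat_nat _ _ _ (n + m)%N n (n + p)%N)//= ?leq_addr ?leq_add2l//.
    by rewrite lerDl; apply: sumr_ge0 => k _; exact: normc_ge0.
  have mP m : measurable_fun D (fun x => (P m x)%:E).
    apply/measurable_EFinP/measurable_funX; apply: measurable_sum => k.
    exact: measurable_normc.
  have Pc x : cvgn (fun m => (P m x)%:E) by exact: ereal_nondecreasing_is_cvgn.
  have mlim : measurable_fun D (fun x => limn (fun m => (P m x)%:E)).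
    by apply: (@emeasurable_fun_cvg _ _ _ _ (fun m x => (P m x)%:E)) => // x _; exact: Pc.
  apply: (@le_trans _ _ (\int[mu]_(x in D) (limn (fun m => (P m x)%:E)))%E).
    apply: ae_ge0_le_integral => //.
    - by move=> x _; rewrite lee_fin sqr_ge0.
    - by apply: measurable_sqnormc; exact: cmeasurableB.
    - by move=> x _; apply: lime_ge => //; apply: nearW => m; rewrite lee_fin sqr_ge0.
    exists N; split => // x nle; apply: contrapT => nNx; apply: nle => Dx.
    have c1 : normc (S n x - S m x) @[m --> \oo] --> normc (S n x - F x).
      apply: cvg_normc.
      suff -> : (fun m => normc (S n x - S m x - (S n x - F x))) =
        (fun m => normc (S m x - F x)) by exact: SF.
      by apply/funext => m; rewrite -normcN; congr normc; ring.
    have c2 : (normc (S n x - S m x) ^+ 2)%:E @[m --> \oo] --> (normc (S n x - F x) ^+ 2)%:E.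
      by apply: cvg_EFin; [exact: nearW|rewrite expr2; under eq_fun do rewrite expr2; exact: cvgM].
    have c3 : (normc (S n x - S (n + m)%N x) ^+ 2)%:E @[m --> \oo] -->
        (normc (S n x - F x) ^+ 2)%:E.
      by have := c2; rewrite -(cvg_shiftn n); under eq_fun do rewrite addnC.
    rewrite -(cvg_lim _ c3)//; apply: lee_lim; [exact: cvgP c3|exact: Pc|].
    apply: nearW => m; rewrite lee_fin /P ler_sqr ?nnegrE ?normc_ge0//.
    have -> : S n x - S (n + m)%N x = - \sum_(n <= k < n + m) G k x.
      by rewrite /S (@big_cat_nat _ _ _ n 0 (n + m)%N)//= ?leq_addr// opprD addrA subrr add0r.
    rewrite normcN; elim/big_ind2 : _ => //; first by rewrite Normc.normc0.
    by move=> z1 r1 z2 r2 h1 h2; rewrite (le_trans (le_normcD _ _))// lerD.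
  rewrite monotone_convergence//; last first.
    by move=> m x _; rewrite lee_fin sqr_ge0.
  apply: lime_le; first apply: ereal_nondecreasing_is_cvgn => m p mp.
    by apply: ge0_le_integral => // x _; [rewrite lee_fin sqr_ge0|exact: Pnd].
  apply: nearW => m.
  pose G' k x := (normc (G k x))%:C.
  have mG' k : cmeasurable_fun D (G' k).
    by split; [exact: measurable_normc|exact: measurable_cst].
  have nG' z : normc (z%:C) = `|z| :> R by rewrite normcE /= expr0n addr0 sqrtr_sqr.
  have Ga' k : (sqint (G' k) <= (a k ^+ 2)%:E)%E.
    apply: le_trans (Ga k); rewrite le_eqVlt; apply/orP; left; apply/eqP.
    by apply: eq_sqint => x _; rewrite /G' nG' ger0_norm ?normc_ge0.
  have e1 : sqint (fun x => (\sum_(n <= k < n + m) G' k x)%R) =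
      (\int[mu]_(x in D) (P m x)%:E)%E.
    apply: eq_integral => x _; rewrite /P /G'.
    have -> : \sum_(n <= k < n + m) (normc (G k x))%:C =
        (\sum_(n <= k < n + m) normc (G k x))%:C by rewrite rmorph_sum.
    by rewrite nG' ger0_norm.
  rewrite -e1; apply: le_trans (sqint_sum n m mG' a0 Ga') _.
  rewrite lee_fin ler_sqr ?nnegrE ?fine_ge0//; last by apply: sumr_ge0 => k _; exact: ltW.
  rewrite -lee_fin fineK// -sumEFin; apply: nneseries_lim_ge => k _ _.
  by rewrite lee_fin ltW.
apply: (@squeeze_cvge _ _ _ _ (cst 0%E) _ (fun n => (fine (t n) ^+ 2)%:E)).
- by apply: nearW => n; rewrite sqint_ge0 bound.
- exact: cvg_cst.
- apply: cvg_EFin; first exact: nearW.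
  by rewrite -(mulr0 (0 : R)); under eq_fun do rewrite expr2; exact: cvgM.
Qed.
End riesz_fischer.
End square_integrable.

(** * The Plancherel formula for finitely supported functions *)

Section plancherel_finite.
Context {R : realType} {q : nat} {X : homogeneous_tree q} {o : X}.
Context (nu : probability (boundary o) R).
Context (nu_cylinder : forall x : X, x <> o ->
  nu (cylinder x) = (q%:R / (q.+1%:R * q%:R ^+ dist o x))%:E).
Implicit Types (x y z : X) (s : R).
Local Notation phase_space := (boundary o * measurableTypeR R)%type.
Local Notation kernel := (@kernel R q X o).
Local Notation tau := (tau R q).
Local Notation mu := (pmeas nu).
Local Notation D := (phase : set phase_space).
Implicit Types (ws : phase_space) (f g : X -> R[i]).

Let mD : measurable D := measurable_phase.
Let muD : (mu D < +oo)%E := pmeas_phase_fin nu.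

(** Orthonormality was obtained on the whole line, while the transform lives on [phase]; the
    complement carries no mass. *)
Lemma pmeas_phaseC : mu (~` D) = 0%E.
Proof.
have ms : measurable (`[0%R, tau]%classic : set (measurableTypeR R)) by exact: measurable_itv.
have -> : ~` D = [set: boundary o] `*` ~` (`[0%R, tau]%classic : set (measurableTypeR R)).
  by apply/seteqP; split=> ws /= h; [split => // h'; apply: h|move=> [_ h']; case: h => _; apply].
have p0 : plancherel R q (~` (`[0%R, tau]%classic : set (measurableTypeR R))) = 0%E.
  by rewrite /plancherel setICl integral_set0.
apply: (etrans (product_measure1E _ _ measurableT (measurableC ms))).
by apply: (etrans (congr1 (fun u => (nu setT * u)%E) p0)); rewrite mule0.
Qed.

Lemma Rintegral_phase (h : phase_space -> R) : mu.-integrable setT (EFin \o h) ->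
  Rintegral mu D h = Rintegral mu setT h.
Proof.
move=> hi; rewrite /Rintegral; congr fine.
rewrite [RHS](@negligible_integral _ _ _ mu setT (~` D))//.
- by rewrite setTD setCK.
- exact: measurableC.
- exact: pmeas_phaseC.
Qed.

Let muT : (mu [set: phase_space] < +oo)%E.
Proof.
rewrite -(setvU D); apply: le_lt_trans (measureU2 _ (measurableC mD) mD) _.
by apply: lte_add_pinfty; rewrite ?[X in (X < _)%E]pmeas_phaseC ?ltry.
Qed.

Lemma kernel_pairing x y :
  cintegral mu D (fun ws => kernel x ws * (kernel y ws)^*%C) = (x == y)%:R.
Proof.
rewrite -(kernel_orthonormal nu_cylinder x y).
have [M1 H1] := kernel_bounded (R := R) (o := o) x.
have [M2 H2] := kernel_bounded (R := R) (o := o) y.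
have i1 : cintegrable mu setT (fun ws => kernel x ws * (kernel y ws)^*%C).
  apply: (@cintegrable_bounded _ _ _ _ _ measurableT _ _ (M1 * M2)).
  - exact: muT.
  - by apply: cmeasurableM; [|apply: cmeasurableJ]; exact: cmeasurable_kernel.
  - by move=> ws _; rewrite Normc.normcM normcJ ler_pM ?normc_ge0.
have [iR iI] := (cintegrableP mu measurableT _).1 i1.
by rewrite /cintegral (Rintegral_phase iR) (Rintegral_phase iI).
Qed.

Lemma fourier0_sum f (fs : finitely_supported f) ws : fourier0 f ws =
  \sum_(y <- finmap.enum_fset (fset_set [set y | f y != 0])) f y * kernel y ws.
Proof.
rewrite fourier0E -fsbig_finite//; apply/esym/fsbig_widen => //.
by move=> y [_ /=] /negP/negPn/eqP ->; rewrite mul0r.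
Qed.

Let cm_kernel y : cmeasurable_fun D (kernel y).
Proof.
by have [m n] := cmeasurable_kernel (R := R) (o := o) y; split; apply: measurable_funTS.
Qed.

Lemma cmeasurable_fourier0 f : finitely_supported f -> cmeasurable_fun D (fourier0 f).
Proof.
move=> fs; have -> : fourier0 f = (fun ws : phase_space => \sum_(y <- finmap.enum_fset (fset_set [set y | f y != 0])) f y * kernel y ws).
  by apply/funext => ws; exact: fourier0_sum.
by apply: cmeasurable_sum => y; apply: cmeasurableM => //; exact: cmeasurable_cst.
Qed.

Let int_kernelJ x y : cintegrable mu D (fun ws => kernel x ws * (kernel y ws)^*%C).
Proof.
have [M1 H1] := kernel_bounded (R := R) (o := o) x.
have [M2 H2] := kernel_bounded (R := R) (o := o) y.
apply: (@cintegrable_bounded _ _ _ _ _ mD muD _ (M1 * M2)).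
- by apply: cmeasurableM => //; exact: cmeasurableJ.
- by move=> ws _; rewrite Normc.normcM normcJ ler_pM ?normc_ge0.
Qed.

Let fourier0_kernelE f (fs : finitely_supported f) y :
  {in D, (fun ws => fourier0 f ws * (kernel y ws)^*%C) =1
    (fun ws => \sum_(x <- finmap.enum_fset (fset_set [set y | f y != 0]))
      f x * (kernel x ws * (kernel y ws)^*%C))}.
Proof.
move=> ws _; rewrite fourier0_sum// mulr_suml; apply: eq_bigr => x _.
by rewrite mulrA.
Qed.

Lemma cintegrable_fourier0_kernel f y : finitely_supported f ->
  cintegrable mu D (fun ws => fourier0 f ws * (kernel y ws)^*%C).
Proof.
move=> fs; apply: cintegrable_eq.
  by move=> ws wsD; exact/esym/(fourier0_kernelE fs y wsD).
by apply: cintegrable_sum => // x; apply: cintegrableZ.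
Qed.

Lemma fourier0_pairing f y : finitely_supported f ->
  cintegral mu D (fun ws => fourier0 f ws * (kernel y ws)^*%C) = f y.
Proof.
move=> fs; rewrite (cintegral_eq mu (fourier0_kernelE fs y)) cintegral_sum//; last first.
  by move=> x; apply: cintegrableZ.
rewrite (eq_bigr (fun x => f x * (x == y)%:R)); last first.
  by move=> x _; rewrite cintegralZ// kernel_pairing.
rewrite -fsbig_finite// (@fsbig_widen _ _ _ _ _ setT)//; last first.
  by move=> x [_ /=] /negP/negPn/eqP ->; rewrite mul0r.
rewrite -(@fsbig_widen _ _ _ _ [set y])//; last first.
  by move=> x [_ /=] /eqP/negbTE ->; rewrite mulr0.
by rewrite fsbig_set1 eqxx mulr1.
Qed.

Theorem plancherel_fs f : finitely_supported f -> sqint mu D (fourier0 f) = sqnorm f.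
Proof.
move=> fs.
pose s := finmap.enum_fset (fset_set [set y | f y != 0]).
have E : {in D, (fun ws => fourier0 f ws * (fourier0 f ws)^*%C) =1
    (fun ws => \sum_(y <- s) (f y)^*%C * (fourier0 f ws * (kernel y ws)^*%C))}.
  move=> ws _; rewrite {2}(fourier0_sum fs) (raddf_sum (@conjc R)) mulr_sumr.
  apply: eq_bigr => y _; rewrite [X in _ * X](conjcM (f y)).
  by rewrite mulrCA.
have i1 y : cintegrable mu D (fun ws => (f y)^*%C * (fourier0 f ws * (kernel y ws)^*%C)).
  by apply: cintegrableZ => //; exact: cintegrable_fourier0_kernel.
have i2 : cintegrable mu D (fun ws => fourier0 f ws * (fourier0 f ws)^*%C).
  by apply: cintegrable_eq (cintegrable_sum mD s i1) => ws wsD; rewrite E.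
have zz (z : R[i]) : z * z^*%C = (normc z ^+ 2)%:C.
  by rewrite sqr_normcE; case: z => a b; simpc; congr (_ +i* _); ring.
have cE : cintegral mu D (fun ws => fourier0 f ws * (fourier0 f ws)^*%C) =
    (\sum_(y <- s) normc (f y) ^+ 2)%:C.
  rewrite (cintegral_eq mu E) cintegral_sum// rmorph_sum; apply: eq_bigr => y _.
  rewrite cintegralZ//; last exact: cintegrable_fourier0_kernel.
  by rewrite fourier0_pairing// mulrC zz.
have [iR _] := (cintegrableP mu mD _).1 i2.
have -> : sqint mu D (fourier0 f) =
    (Rintegral mu D (fun ws => complex.Re (fourier0 f ws * (fourier0 f ws)^*%C)))%:E.
  rewrite /Rintegral fineK; last exact: integrable_fin_num.
  by apply: eq_integral => ws _; rewrite zz.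
have -> : Rintegral mu D (fun ws => complex.Re (fourier0 f ws * (fourier0 f ws)^*%C)) =
    \sum_(y <- s) normc (f y) ^+ 2.
  by move: cE; rewrite /cintegral => -[].
have fpos y : (0 <= (normc (f y) ^+ 2)%:E)%E by rewrite lee_fin sqr_ge0.
rewrite /sqnorm -sumEFin -fsbig_finite// -esum_fset//.
rewrite esum_mkcond; apply: eq_esum => y _.
case: ifPn => //; rewrite notin_setE /= => /negP/negPn/eqP ->.
by rewrite Normc.normc0 expr0n.
Qed.
End plancherel_finite.

Section l2_approximation.
Context {R : realType} {V : choiceType}.
Implicit Types (f g : l2 R V) (e : R).

Lemma l2_normE f : `|f| = (l2norm f)%:C :> R[i].
Proof. by []. Qed.

Lemma l2normN f : l2norm (- f) = l2norm f.
Proof. by rewrite -scaleN1r l2normZ normcN Normc.normc1 mul1r. Qed.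

Lemma l2norm_dist f g : l2norm (f - g) = l2norm (g - f).
Proof. by rewrite -l2normN opprB. Qed.

Lemma l2norm0 : l2norm (0 : l2 R V) = 0.
Proof. by rewrite -(scale0r (0 : l2 R V)) l2normZ Normc.normc0 mul0r. Qed.

Lemma l2norm_sum (I : Type) (r : seq I) (P : pred I) (F : I -> l2 R V) :
  l2norm (\sum_(i <- r | P i) F i) <= \sum_(i <- r | P i) l2norm (F i).
Proof.
elim/big_ind2 : _ => //; first by rewrite l2norm0.
by move=> f a g b fa gb; rewrite (le_trans (l2normD _ _))// lerD.
Qed.

Lemma l2_coord_le f x : normc (f x) <= l2norm f.
Proof.
rewrite -ler_sqr ?nnegrE ?normc_ge0 ?l2norm_ge0// -lee_fin -sqnorm_fin.
apply: ereal_sup_ubound; exists [set x]; first by split => //; exact: finite_set1.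
by rewrite fsbig_set1.
Qed.

Lemma l2_cvgP (phi : nat -> l2 R V) f :
  phi @ \oo --> f <-> l2norm (phi n - f) @[n --> \oo] --> (0 : R).
Proof.
split=> [/cvgrPdist_lt H|/cvgrPdist_lt H].
  apply/cvgrPdist_lt => e e0; have := H e%:C; rewrite ltcR => /(_ e0).
  apply: filterS => n; rewrite l2_normE ltcR => h.
  by rewrite sub0r normrN ger0_norm ?l2norm_ge0// l2norm_dist.
apply/cvgrPdist_lt => -[e e'] e0.
have [e'0 {}e0] : e' = 0 /\ 0 < e by move: e0; rewrite ltcE /= => /andP[/eqP].
rewrite e'0; have := H e e0; apply: filterS => n.
rewrite sub0r normrN ger0_norm ?l2norm_ge0// => h.
have -> : e +i* 0 = e%:C by [].
by rewrite l2_normE ltcR l2norm_dist.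
Qed.

Lemma restrict_square_summable f (A : set V) :
  (fun x => if x \in A then f x else 0) \in square_summable.
Proof.
have /asboolP f2 := l2_in f; apply/asboolP; apply: le_lt_trans f2.
apply: le_esum => x _; rewrite lee_fin; case: ifP => // _.
by rewrite Normc.normc0 expr0n sqr_ge0.
Qed.

Lemma fs_approx f e : 0 < e ->
  exists phi : l2 R V, finite_set [set y | phi y != 0] /\ l2norm (phi - f) <= e.
Proof.
move=> e0; have e20 : 0 < e ^+ 2 by rewrite exprn_gt0.
have fin : sqnorm f \is a fin_num by rewrite sqnorm_fin.
have [_ [A [fA _] <-] hA] := ub_ereal_sup_adherent e20 fin.
pose phi : l2 R V := L2 (restrict_square_summable f A).
exists phi; split.
  apply: sub_finite_set fA => x /=; case: ifPn => [/set_mem //|_]; by rewrite eqxx.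
(* Pythagoras for disjoint supports. As [A] almost attains the supremum defining the norm of [f],
   the part of [f] outside [A] is small. *)
have E : (sqnorm f = sqnorm (phi - f)%R + sqnorm phi)%E.
  rewrite /sqnorm -esumD; [|by move=> x _; rewrite lee_fin sqr_ge0..].
  apply: eq_esum => x _; rewrite -EFinD; congr EFin.
  have -> : (phi - f) x = (if x \in A then f x else 0) - f x by [].
  have -> : phi x = if x \in A then f x else 0 by [].
  case: ifP => _; first by rewrite subrr Normc.normc0 expr0n add0r.
  by rewrite sub0r normcN Normc.normc0 expr0n addr0.
have hphi : (\sum_(x \in A) (normc (f x) ^+ 2)%:E <= sqnorm phi)%E.
  apply: ereal_sup_ubound; exists A => //.
  by apply: eq_fsbigr => x xA /=; rewrite xA.
have : (sqnorm f - (e ^+ 2)%:E < sqnorm phi)%E by exact: lt_le_trans hA hphi.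
rewrite {1}E !sqnorm_fin -!EFinD lte_fin => h.
rewrite -ler_sqr ?nnegrE ?l2norm_ge0 ?ltW//; lra.
Qed.
End l2_approximation.

(** * Extension of the transform to l2 *)

Section fourier_extension.
Context {R : realType} {q : nat} {X : homogeneous_tree q} {o : X}.
Context (nu : probability (boundary o) R).
Context (nu_cylinder : forall x : X, x <> o ->
  nu (cylinder x) = (q%:R / (q.+1%:R * q%:R ^+ dist o x))%:E).
Local Notation phase_space := (boundary o * measurableTypeR R)%type.
Local Notation kernel := (@kernel R q X o).
Local Notation mu := (pmeas nu).
Local Notation D := (phase : set phase_space).
Local Notation fourier := (fourier nu).
Implicit Types (x y : X) (f g u v phi psi : l2 R X) (F G H : phase_space -> R[i]).
Implicit Types (a b e : R) (c : R[i]) (ws : phase_space).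

Let mD : measurable D := measurable_phase.
Let muD : (mu D < +oo)%E := pmeas_phase_fin nu.

Let linE c f g y : (c *: f + g : l2 R X) y = c * f y + g y.
Proof. by []. Qed.

Lemma finitely_supported_lin c f g : finitely_supported f -> finitely_supported g ->
  finitely_supported (c *: f + g : l2 R X).
Proof.
move=> ff fg.
have : finite_set ([set y | f y != 0] `|` [set y | g y != 0]) by rewrite finite_setU.
apply: sub_finite_set => y; rewrite /setU /mkset linE => fgy.
apply/orP; apply: contraNT fgy; rewrite negb_or !negbK => /andP[/eqP -> /eqP ->].
by rewrite mulr0 addr0.
Qed.

Lemma finitely_supported0 : finitely_supported (0 : l2 R X).
Proof.
have l0 y : (0 : l2 R X) y = 0 by [].
by apply: (@sub_finite_set _ _ set0) => // y; rewrite /mkset l0 eqxx.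
Qed.

Lemma fourier0_lin c f g ws : finitely_supported f -> finitely_supported g ->
  fourier0 (c *: f + g : l2 R X) ws = c * fourier0 f ws + fourier0 g ws.
Proof.
move=> ff fg; pose s := [set y | f y != 0] `|` [set y | g y != 0].
have fs : finite_set s by rewrite finite_setU.
have W (h : X -> R[i]) : (forall y, ~ s y -> h y = 0) ->
    fourier0 h ws = \sum_(y \in s) h y * kernel y ws.
  move=> h0; rewrite fourier0E; apply/esym/fsbig_widen => // y [_ /= nsy].
  by rewrite h0// mul0r.
have f0 y : ~ s y -> f y = 0 by move=> ns; apply/eqP/negPn/negP => h; apply: ns; left.
have g0 y : ~ s y -> g y = 0 by move=> ns; apply/eqP/negPn/negP => h; apply: ns; right.
have fg0 y : ~ s y -> (c *: f + g : l2 R X) y = 0.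
  by move=> ns; rewrite linE f0// g0// mulr0 addr0.
rewrite (W _ fg0) (W _ f0) (W _ g0) !fsbig_finite// mulr_sumr -big_split.
apply: eq_bigr => y _.
by rewrite linE mulrDl mulrA.
Qed.

Lemma fourier00 ws : fourier0 (0 : l2 R X) ws = 0.
Proof.
by rewrite fourier0E fsbig1// => y _; exact: mul0r.
Qed.

Lemma fourier0B f g ws : finitely_supported f -> finitely_supported g ->
  fourier0 (f - g : l2 R X) ws = fourier0 f ws - fourier0 g ws.
Proof.
move=> ff fg; rewrite addrC -scaleN1r fourier0_lin// mulN1r addrC; done.
Qed.

Lemma finitely_supportedB f g : finitely_supported f -> finitely_supported g ->
  finitely_supported (f - g : l2 R X).
Proof. by move=> ff fg; rewrite addrC -scaleN1r; exact: finitely_supported_lin. Qed.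

Lemma sqint_fourier0B f g : finitely_supported f -> finitely_supported g ->
  sqint mu D (fun ws => fourier0 f ws - fourier0 g ws) = (l2norm (f - g) ^+ 2)%:E.
Proof.
move=> ff fg; rewrite -sqnorm_fin -(plancherel_fs nu_cylinder (finitely_supportedB ff fg)).
by apply: eq_sqint => ws _; rewrite fourier0B.
Qed.

Let sqr_mono a b : 0 <= a -> a <= b -> ((a ^+ 2)%:E <= (b ^+ 2)%:E)%E.
Proof. by move=> a0 ab; rewrite lee_fin ler_sqr ?nnegrE// (le_trans a0). Qed.

Let sqint_trans F G H a b : cmeasurable_fun D F -> cmeasurable_fun D G ->
  cmeasurable_fun D H -> 0 < a -> 0 < b ->
  (sqint mu D (fun ws => F ws - G ws)%R <= (a ^+ 2)%:E)%E ->
  (sqint mu D (fun ws => G ws - H ws)%R <= (b ^+ 2)%:E)%E ->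
  (sqint mu D (fun ws => F ws - H ws)%R <= ((a + b) ^+ 2)%:E)%E.
Proof.
move=> mF mG mH a0 b0 FG GH.
rewrite (_ : sqint _ _ _ = sqint mu D (fun ws => (F ws - G ws) + (G ws - H ws))).
  by apply: sqintD => //; exact: cmeasurableB.
by apply: eq_sqint => ws _; congr normc; ring.
Qed.

Let sqint_sym F G : sqint mu D (fun ws => F ws - G ws)%R = sqint mu D (fun ws => G ws - F ws)%R.
Proof. by apply: eq_sqint => ws _; rewrite -normcN opprB. Qed.

Lemma sqint_to0P (F : nat -> phase_space -> R[i]) :
  sqint mu D (F n) @[n --> \oo] --> 0%E <->
  forall e, 0 < e -> \forall n \near \oo, (sqint mu D (F n) <= (e ^+ 2)%:E)%E.
Proof.
have e20 e : 0 < e -> 0 < e ^+ 2 by move=> ?; rewrite exprn_gt0.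
split=> [/fine_cvgP[hf /cvgrPdist_lt h] e e0|h].
  apply: filterS2 hf (h _ (e20 _ e0)) => n fn.
  by rewrite sub0r normrN ger0_norm ?fine_ge0 ?sqint_ge0// => /ltW; rewrite -lee_fin fineK.
apply/fine_cvgP; split.
  apply: filterS (h _ ltr01) => n hn; rewrite ge0_fin_numE ?sqint_ge0//.
  exact: le_lt_trans hn (ltry _).
apply/cvgrPdist_le => e e0; have se0 : 0 < Num.sqrt e by rewrite sqrtr_gt0.
apply: filterS (h _ se0) => n; rewrite sqr_sqrtr ?(ltW e0)// => hn.
have fn : sqint mu D (F n) \is a fin_num.
  by rewrite ge0_fin_numE ?sqint_ge0//; exact: le_lt_trans hn (ltry _).
by rewrite sub0r normrN ger0_norm ?fine_ge0 ?sqint_ge0// -lee_fin fineK.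
Qed.

(** One summable rate for all approximating sequences; its sum is 1. *)
Let d n : R := 1 / (2 ^ n.+1)%:R.
Let d0 n : 0 < d n. Proof. by rewrite divr_gt0// ltr0n expn_gt0. Qed.

Let d_small e : 0 < e -> \forall n \near \oo, d n <= e.
Proof.
move=> e0; apply: filterS (near_infty_natSinv_lt (PosNum e0)) => n /= /ltW; apply: le_trans.
by rewrite /d mul1r lef_pV2 ?posrE ?ltr0n ?expn_gt0// ler_nat ltnW// ltn_expl.
Qed.

Lemma fs_sequence f : exists phi : nat -> l2 R X,
  (forall n, finitely_supported (phi n)) /\ forall n, l2norm (phi n - f) <= d n.
Proof.
have /choice[phi H] n : exists phi : l2 R X, finitely_supported phi /\ l2norm (phi - f) <= d n.
  exact: fs_approx.
by exists phi; split=> n; have [] := H n.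
Qed.

Lemma l2norm_trans f g h : l2norm (f - h : l2 R X) <= l2norm (f - g) + l2norm (g - h).
Proof. by have -> : f - h = (f - g) + (g - h); [rewrite addrA subrK|exact: l2normD]. Qed.

(** A rapidly converging sequence of finitely supported functions makes the increments of the
    transforms summable in norm, so [riesz_fischer] supplies a limit. The isometry shows that every
    other approximating sequence has the same limit. *)
Lemma is_fourier_exists f : exists F, is_fourier nu f F.
Proof.
have [phi [fphi phid]] := fs_sequence f.
have mphi n : cmeasurable_fun D (fourier0 (phi n)) by exact: cmeasurable_fourier0.
pose G k ws := fourier0 (phi k.+1) ws - fourier0 (phi k) ws.
(* Consecutive approximants differ by at most [d (k+1) + d k]. *)
pose a k := 2 * d k.
have mG k : cmeasurable_fun D (G k) by exact: cmeasurableB.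
have a0 k : 0 < a k by rewrite mulr_gt0.
have Ga k : (sqint mu D (G k) <= (a k ^+ 2)%:E)%E.
  rewrite sqint_fourier0B//; apply: sqr_mono; first exact: l2norm_ge0.
  apply: le_trans (l2norm_trans _ f _) _; rewrite [X in _ + X]l2norm_dist /a mulr2n mulrDl !mul1r.
  apply: lerD => //; apply: le_trans (phid _) _.
  by rewrite /d !mul1r lef_pV2 ?posrE ?ltr0n ?expn_gt0// ler_nat leq_exp2l.
have sa : (\sum_(k <oo) (a k)%:E < +oo)%E.
  apply: (@le_lt_trans _ _ 2%:E); last exact: ltry.
  rewrite (eq_eseriesr (g := fun k => (2 / (2 ^ k.+1)%:R)%:E)); last first.
    by move=> k _; rewrite /a /d mul1r.
  by apply: epsilon_trick0.
have [F' [mF' _ F'l]] := riesz_fischer mD muD mG a0 Ga sa.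
pose F ws := F' ws + fourier0 (phi 0%N) ws.
have mF : cmeasurable_fun D F by exact: cmeasurableD.
have Fl : sqint mu D (fun ws => fourier0 (phi n) ws - F ws) @[n --> \oo] --> 0%E.
  suff -> : (fun n => sqint mu D (fun ws => fourier0 (phi n) ws - F ws)) =
    (fun n => sqint mu D (fun ws => \sum_(0 <= k < n) G k ws - F' ws)) by [].
  apply/funext => n; apply: eq_sqint => ws _; rewrite /F /G telescope_sumr//.
  by congr normc; ring.
exists F; split => // psi fpsi /l2_cvgP/cvgrPdist_lt psif.
apply/sqint_to0P => e e0; have e2 : 0 < e / 2 by rewrite divr_gt0.
have e4 : 0 < e / 4 by rewrite divr_gt0.
move/sqint_to0P : Fl => /(_ _ e2) Fl; near=> n.
rewrite [e]splitr; apply: (sqint_trans (G := fourier0 (phi n))) => //.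
- exact: cmeasurable_fourier0.
- rewrite sqint_fourier0B//; apply: sqr_mono; first exact: l2norm_ge0.
  apply: le_trans (l2norm_trans _ f _) _; rewrite [X in _ + X]l2norm_dist.
  have -> : e / 2 = e / 4 + e / 4 by field.
  apply: lerD.
    have : `|0 - l2norm (psi n - f)| < e / 4 by near: n; exact: psif.
    by rewrite sub0r normrN ger0_norm ?l2norm_ge0// => /ltW.
  by apply: le_trans (phid n) _; near: n; exact: d_small.
- by near: n.
Unshelve. all: by end_near.
Qed.

Lemma fourierP f : is_fourier nu f (fourier f).
Proof. by have [F HF] := is_fourier_exists f; exact: (xgetPex (fun=> 0) (ex_intro _ F HF)). Qed.

Lemma cmeasurable_fourier f : cmeasurable_fun D (fourier f).
Proof. by have [] := fourierP f. Qed.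

Lemma fourier_approx f e : 0 < e -> exists phi, [/\ finitely_supported phi,
  l2norm (phi - f) <= e &
  (sqint mu D (fun ws => fourier0 phi ws - fourier f ws)%R <= (e ^+ 2)%:E)%E].
Proof.
move=> e0; have [phi [fphi phid]] := fs_sequence f.
have phif : phi @ \oo --> f.
  apply/l2_cvgP/cvgrPdist_le => r r0; apply: filterS (d_small r0) => n dr.
  by rewrite sub0r normrN ger0_norm ?l2norm_ge0// (le_trans (phid n)).
have [_ /(_ phi fphi phif)/sqint_to0P/(_ _ e0) H] := fourierP f.
have [n [h1 h2]] := filter_ex (filterI H (d_small e0)).
by exists (phi n); split=> //; exact: le_trans h2.
Qed.

(** The isometry on finitely supported functions, carried over by an approximant [psi] of [f]. The
    strict inequality leaves room for the errors of [psi] and of its transform. *)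
Lemma fourier_dist f phi a : finitely_supported phi -> l2norm (phi - f) < a ->
  (sqint mu D (fun ws => fourier0 phi ws - fourier f ws)%R <= (a ^+ 2)%:E)%E.
Proof.
move=> fphi phia; pose e := (a - l2norm (phi - f)) / 3.
have e0 : 0 < e by rewrite divr_gt0// subr_gt0.
have [psi [fpsi psif psiF]] := fourier_approx f e0.
have n0 : 0 <= l2norm (phi - f) by exact: l2norm_ge0.
have -> : a = (l2norm (phi - f) + 2 * e) + e by rewrite /e; field.
apply: (sqint_trans (G := fourier0 psi)) => //; try exact: cmeasurable_fourier0.
- exact: cmeasurable_fourier.
- by rewrite ltr_wpDl// mulr_gt0.
rewrite sqint_fourier0B//; apply: sqr_mono; first exact: l2norm_ge0.
apply: le_trans (l2norm_trans _ f _) _; rewrite lerD2l l2norm_dist.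
by apply: le_trans psif _; rewrite ler_peMl ?ltW// ltr1n.
Qed.

Lemma sqint_fourier_lt f a : l2norm f < a -> (sqint mu D (fourier f) <= (a ^+ 2)%:E)%E.
Proof.
move=> fa; have := @fourier_dist f 0 a finitely_supported0.
rewrite sub0r l2normN => /(_ fa); congr (_ <= _)%E; apply: eq_sqint => ws _.
by rewrite fourier00 sub0r normcN.
Qed.

(** Chosen representatives are linear only almost everywhere. Instead of comparing them directly,
    one finitely supported function, on whose transform linearity is exact, approximates both the
    combination and the combination of transforms. *)
Lemma fourier_comb (c : nat -> R[i]) (u : nat -> l2 R X) n e : 0 < e ->
  exists phi, [/\ finitely_supported phi,
    l2norm (phi - \sum_(0 <= k < n) c k *: u k) <= e &
    (sqint mu D (fun ws => fourier0 phi ws - \sum_(0 <= k < n) c k * fourier (u k) ws)%R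
      <= (e ^+ 2)%:E)%E].
Proof.
elim: n e => [|n IH] e e0.
  exists 0; split; first exact: finitely_supported0.
    by rewrite big_geq// subrr l2norm0 ltW.
  have -> : sqint mu D (fun ws => fourier0 (0 : l2 R X) ws -
      \sum_(0 <= k < 0) c k * fourier (u k) ws)%R = 0%E.
    rewrite /sqint integral0_eq// => ws _.
    by rewrite big_geq// subr0 fourier00 Normc.normc0 expr0n.
  by rewrite lee_fin sqr_ge0.
have e2 : 0 < e / 2 by rewrite divr_gt0.
have nc : 0 < normc (c n) + 1 by rewrite ltr_wpDl ?normc_ge0.
(* The added 1 covers a vanishing coefficient. *)
have e' : 0 < e / 2 / (normc (c n) + 1) by rewrite divr_gt0.
have ce : normc (c n) * (e / 2 / (normc (c n) + 1)) <= e / 2.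
  by rewrite mulrA ler_pdivrMr// mulrC ler_wpM2l ?(ltW e2)// lerDl.
have [phi [fphi phiS phiF]] := IH _ e2.
have [psi [fpsi psiu psiF]] := fourier_approx (u n) e'.
exists (c n *: psi + phi); split; first exact: finitely_supported_lin.
  rewrite big_nat_recr//.
  have -> (S : l2 R X) : c n *: psi + phi - (S + c n *: u n) = c n *: (psi - u n) + (phi - S).
    by rewrite scalerBr [in X in _ - X]addrC opprD addrACA.
  rewrite [e]splitr; apply: le_trans (l2normD _ _) _; apply: lerD.
    by rewrite l2normZ; apply: le_trans ce; rewrite ler_wpM2l ?normc_ge0.
  by [].
rewrite [e]splitr.
rewrite (_ : sqint _ _ _ = sqint mu D (fun ws => (c n * (fourier0 psi ws - fourier (u n) ws)) +
    (fourier0 phi ws - \sum_(0 <= k < n) c k * fourier (u k) ws))).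
  apply: sqintD => //.
  - apply: cmeasurableM; first exact: cmeasurable_cst.
    by apply: cmeasurableB; [exact: cmeasurable_fourier0|exact: cmeasurable_fourier].
  - apply: cmeasurableB; first exact: cmeasurable_fourier0.
    apply: cmeasurable_sum => k; apply: cmeasurableM; first exact: cmeasurable_cst.
    exact: cmeasurable_fourier.
  apply: le_trans (sqintZ mD (c n) _ psiF) _.
    by apply: cmeasurableB; [exact: cmeasurable_fourier0|exact: cmeasurable_fourier].
  by apply: sqr_mono => //; rewrite mulr_ge0 ?normc_ge0// ltW.
apply: eq_sqint => ws _; congr normc.
rewrite fourier0_lin// big_nat_recr//=; ring.
Qed.

Lemma fourier_comb_dist (c : nat -> R[i]) (u : nat -> l2 R X) v n a :
  l2norm (\sum_(0 <= k < n) c k *: u k - v) < a ->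
  (sqint mu D (fun ws => \sum_(0 <= k < n) c k * fourier (u k) ws - fourier v ws)%R
      <= (a ^+ 2)%:E)%E.
Proof.
set S := \sum_(0 <= k < n) c k *: u k => Sa; pose e := (a - l2norm (S - v)) / 3.
have e0 : 0 < e by rewrite divr_gt0// subr_gt0.
have n0 : 0 <= l2norm (S - v) by exact: l2norm_ge0.
have [phi [fphi phiS phiF]] := fourier_comb c u n e0.
have -> : a = e + (l2norm (S - v) + 2 * e) by rewrite /e; field.
have b0 : 0 < l2norm (S - v) + 2 * e by rewrite ltr_wpDl// mulr_gt0.
apply: (sqint_trans (G := fourier0 phi)) => //.
- apply: cmeasurable_sum => k; apply: cmeasurableM; first exact: cmeasurable_cst.
  exact: cmeasurable_fourier.
- exact: cmeasurable_fourier0.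
- exact: cmeasurable_fourier.
- by rewrite sqint_sym.
apply: fourier_dist => //; apply: le_lt_trans (l2norm_trans _ S _) _.
rewrite addrC ltrD2l; apply: le_lt_trans phiS _.
by rewrite ltr_pMl// ltr1n.
Qed.

(** Partial sums of the transforms converge in L^2 to the almost everywhere sum, by [riesz_fischer],
    and to the transform of [v], by [fourier_comb_dist]; the two limits coincide almost
    everywhere. *)
Lemma fourier_series (c : nat -> R[i]) (u : nat -> l2 R X) v :
  (\sum_(k <oo) (normc (c k) * l2norm (u k))%:E < +oo)%E ->
  series (fun k => c k *: u k) @ \oo --> v ->
  {ae mu, forall ws, phase ws -> sums_to (fun k => c k * fourier (u k) ws) (fourier v ws)}.
Proof.
move=> sfin sv.
(* The summable [d k] makes the bounds positive even for vanishing terms, as [riesz_fischer]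
   requires. *)
pose a k := normc (c k) * l2norm (u k) + d k.
have a0 k : 0 < a k by rewrite ltr_wpDl// mulr_ge0 ?normc_ge0 ?l2norm_ge0.
pose G k ws := c k * fourier (u k) ws.
have mG k : cmeasurable_fun D (G k).
  by apply: cmeasurableM; [exact: cmeasurable_cst|exact: cmeasurable_fourier].
have Ga k : (sqint mu D (G k) <= (a k ^+ 2)%:E)%E.
  have nc : 0 < normc (c k) + 1 by rewrite ltr_wpDl ?normc_ge0.
  pose b := l2norm (u k) + d k / (normc (c k) + 1).
  have ub : l2norm (u k) < b by rewrite ltrDl divr_gt0.
  apply: le_trans (sqintZ mD (c k) (cmeasurable_fourier (u k)) (sqint_fourier_lt ub)) _.
  apply: sqr_mono.
    by rewrite mulr_ge0 ?normc_ge0// (le_trans (l2norm_ge0 (u k)))// ltW.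
  rewrite /b mulrDr lerD2l mulrA ler_pdivrMr// mulrC ler_wpM2l ?(ltW (d0 k))// lerDl; exact: ler01.
have sa : (\sum_(k <oo) (a k)%:E < +oo)%E.
  rewrite (eq_eseriesr (g := fun k => ((normc (c k) * l2norm (u k))%:E + (d k)%:E)%E)); last first.
    by move=> k _; rewrite -EFinD.
  rewrite nneseriesD; last 2 first.
  - by move=> k _ _; rewrite lee_fin mulr_ge0 ?normc_ge0 ?l2norm_ge0.
  - by move=> k _ _; rewrite lee_fin ltW.
  apply: lte_add_pinfty => //; apply: (@le_lt_trans _ _ 1%:E); last exact: ltry.
  exact: epsilon_trick0.
have [F [mF Fs Fl]] := riesz_fischer mD muD mG a0 Ga sa.
have Fv0 : sqint mu D (fun ws => F ws - fourier v ws) = 0%E.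
  apply/eqP; rewrite eq_le sqint_ge0 andbT; apply/lee_addgt0Pr => e e0; rewrite add0e.
  have r0 : 0 < Num.sqrt e by rewrite sqrtr_gt0.
  rewrite -[e]sqr_sqrtr ?(ltW e0)//; move: (Num.sqrt e) r0 => {e0} {}e e0.
  have e2 : 0 < e / 2 by rewrite divr_gt0.
  move/sqint_to0P : Fl => /(_ _ e2) Fl.
  move/l2_cvgP/cvgrPdist_lt : sv => /(_ _ e2) sv.
  have [n [Fn vn]] := filter_ex (filterI Fl sv).
  rewrite [e]splitr; apply: (sqint_trans (G := fun ws => \sum_(0 <= k < n) G k ws)) => //.
  - exact: cmeasurable_sum.
  - exact: cmeasurable_fourier.
  - by rewrite sqint_sym.
  by apply: fourier_comb_dist; move: vn; rewrite sub0r normrN ger0_norm ?l2norm_ge0.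
have Fv : {ae mu, forall ws, D ws -> F ws - fourier v ws = 0}.
  by apply: sqint_eq0 => //; apply: cmeasurableB => //; exact: cmeasurable_fourier.
apply: filterS2 Fs Fv => ws Fs Fv wsD; move/eqP : (Fv wsD); rewrite subr_eq0 => /eqP <-.
exact: Fs.
Qed.

Lemma cintegrable_fourier f : cintegrable mu D (fourier f).
Proof.
have fa : l2norm f < l2norm f + 1 by rewrite ltrDl.
split; first exact: cmeasurable_fourier.
apply: le_lt_trans (integral_normc_le mD muD (cmeasurable_fourier f) _ (sqint_fourier_lt fa)) _.
  by rewrite (le_lt_trans _ fa)// l2norm_ge0.
exact: ltry.
Qed.

Let cm_kernel y : cmeasurable_fun D (kernel y).
Proof.
by have [m n] := cmeasurable_kernel (R := R) (o := o) y; split; apply: measurable_funTS.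
Qed.

Lemma cintegrable_fourier_kernel f y :
  cintegrable mu D (fun ws => (fourier f ws)^*%C * kernel y ws).
Proof.
have [M HM] := kernel_bounded (R := R) (o := o) y.
apply: (cintegrableM_bounded mD (M := M)) => //.
exact/cintegrableJ/cintegrable_fourier.
Qed.

Lemma fourier_pairing f y :
  cintegral mu D (fun ws => (fourier f ws)^*%C * kernel y ws) = (f y)^*%C.
Proof.
have [M HM] := kernel_bounded (R := R) (o := o) y.
have M0 : 0 <= M by apply: le_trans (HM (point, 0)); exact: normc_ge0.
(* The 2 is that of [normc_cintegral_le], [M] bounds the kernel, [1 + fine (mu D)] passes from L^2
   to L^1, and the last 1 pays for the value at [y] of the approximation error. *)
pose C : R := 2 * (M * (1 + fine (mu D))) + 1.
have C0 : 0 < C.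
  by rewrite ltr_wpDl// !mulr_ge0// addr_ge0// fine_ge0// measure_ge0.
apply/eqP; rewrite -subr_eq0; apply/eqP/Normc.eq0_normc/eqP.
rewrite eq_le normc_ge0 andbT; apply/ler_addgt0Pr => e e0; rewrite add0r.
have e' : 0 < e / C by rewrite divr_gt0.
have -> : e = e / C * C by rewrite mulfVK// gt_eqF.
move: (e / C) e' => {e0} {}e e0.
have [phi [fphi phif phiF]] := fourier_approx f e0.
have fi : cintegrable mu D (fun ws => (fourier0 phi ws)^*%C * kernel y ws).
  apply: cintegrable_eq (cintegrableJ (cintegrable_fourier0_kernel nu y fphi)) => ws _.
  by rewrite conjcM conjcK.
have fE : cintegral mu D (fun ws => (fourier0 phi ws)^*%C * kernel y ws) = (phi y)^*%C.
  rewrite -(fourier0_pairing nu_cylinder y fphi) -cintegralJ//.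
    by apply: cintegral_eq => ws _; rewrite conjcM conjcK.
  exact: cintegrable_fourier0_kernel.
pose g ws := (fourier f ws)^*%C * kernel y ws - (fourier0 phi ws)^*%C * kernel y ws.
have gi : cintegrable mu D g.
  by apply: cintegrableB => //; exact: cintegrable_fourier_kernel.
have -> : cintegral mu D (fun ws => (fourier f ws)^*%C * kernel y ws) - (f y)^*%C =
    cintegral mu D g + (phi y - f y)^*%C.
  rewrite cintegralB//; last exact: cintegrable_fourier_kernel.
  by rewrite fE conjcB; ring.
apply: le_trans (le_normcD _ _) _; rewrite /C mulrDr mulr1; apply: lerD; last first.
  by rewrite normcJ; apply: le_trans phif; exact: (l2_coord_le (phi - f)).
rewrite -lee_fin; apply: le_trans (normc_cintegral_le mD gi) _.
have mdif : cmeasurable_fun D (fun ws => fourier0 phi ws - fourier f ws).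
  by apply: cmeasurableB; [exact: cmeasurable_fourier0|exact: cmeasurable_fourier].
have I1 := integral_normc_le mD muD mdif e0 phiF.
rewrite mulrCA EFinM lee_wpmul2l//.
apply: (@le_trans _ _ (\int[mu]_(ws in D) (M%:E * (normc (fourier0 phi ws - fourier f ws))%:E))%E).
  apply: ge0_le_integral => //.
  - by move=> ws _; rewrite lee_fin normc_ge0.
  - by apply/measurable_EFinP/measurable_normc; have [] := gi.
  - by apply: measurable_funeM; exact/measurable_EFinP/measurable_normc.
  move=> ws _; rewrite -EFinM lee_fin /g -mulrBl -conjcB Normc.normcM normcJ mulrC.
  rewrite -[X in _ <= _ * X]normcN opprB; apply: ler_wpM2r; first exact: normc_ge0.
  exact: HM.
rewrite ge0_integralZl//.
- by rewrite mulrCA EFinM lee_wpmul2l// lee_fin.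
- exact/measurable_EFinP/measurable_normc.
by move=> ws _; rewrite lee_fin normc_ge0.
Qed.
End fourier_extension.

(** * The Hilbert space l2 *)

Section absolute_sums.
Context {R : realType} {V : choiceType}.
Implicit Types (a b u w : V -> R) (c : V -> R[i]).

Local Notation esumR a := (\esum_(x in [set: V]) (a x)%:E)%E.

(** The sum does not depend on how the family is written as a difference of nonnegative summable
    ones; additivity follows, positive and negative parts not being additive themselves. *)
Lemma rsum_split a u w : (forall x, 0 <= u x) -> (forall x, 0 <= w x) ->
  (forall x, a x = u x - w x) -> (esumR u < +oo)%E -> (esumR w < +oo)%E ->
  rsum a = fine (esumR u) - fine (esumR w).
Proof.
move=> u0 w0 auw ufin wfin; rewrite /rsum.
have pu x : a^\+ x <= u x.
  by rewrite /funrpos ge_max u0 auw lerBlDr lerDl w0.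
have nw x : a^\- x <= w x.
  by rewrite /funrneg ge_max w0 auw opprB lerBlDr lerDl u0.
have pfin : (esumR (a^\+) < +oo)%E.
  by apply: le_lt_trans ufin; apply: le_esum => x _; rewrite lee_fin.
have nfin : (esumR (a^\-) < +oo)%E.
  by apply: le_lt_trans wfin; apply: le_esum => x _; rewrite lee_fin.
have fin (v : V -> R) : (forall x, 0 <= v x) -> (esumR v < +oo)%E -> esumR v \is a fin_num.
  by move=> v0 vf; rewrite ge0_fin_numE// esum_ge0// => x _; rewrite lee_fin.
have E : (esumR (a^\+) + esumR w = esumR u + esumR (a^\-))%E.
  rewrite -!esumD; last first.
  - by move=> x _; rewrite lee_fin.
  - by move=> x _; rewrite lee_fin funrpos_ge0.
  - by move=> x _; rewrite lee_fin funrneg_ge0.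
  - by move=> x _; rewrite lee_fin.
  apply: eq_esum => x _; rewrite -!EFinD; congr EFin.
  apply/eqP; rewrite -subr_eq addrAC -addrA; apply/eqP.
  have := congr1 (fun f => f x) (funrposBneg a); rewrite auw => h.
  have -> : a^\+ x = a^\- x + (u x - w x) by rewrite -h addrC subrK.
  by ring.
have := congr1 fine E; rewrite !fineD ?fin// => h.
by apply/eqP; rewrite subr_eq addrAC eq_sym subr_eq h.
Qed.

Let pos (v : V -> R) x : v^\+ x <= `|v x| :> R.
Proof. by rewrite -[leRHS]/((Num.norm \o v) x) -funrposDneg lerDl funrneg_ge0. Qed.

Let neg (v : V -> R) x : v^\- x <= `|v x| :> R.
Proof. by rewrite -[leRHS]/((Num.norm \o v) x) -funrposDneg lerDr funrpos_ge0. Qed.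

Lemma rsumD a b : (esumR (fun x => `|a x|) < +oo)%E -> (esumR (fun x => `|b x|) < +oo)%E ->
  rsum (fun x => a x + b x) = rsum a + rsum b.
Proof.
move=> afin bfin.
have le u v : (forall x, u x <= v x) -> (esumR v < +oo)%E -> (esumR u < +oo)%E.
  by move=> uv; apply: le_lt_trans; apply: le_esum => x _; rewrite lee_fin.
have p0 v x : 0 <= v^\+ x :> R by exact: funrpos_ge0.
have n0 v x : 0 <= v^\- x :> R by exact: funrneg_ge0.
have fin (v : V -> R) : (forall x, 0 <= v x) -> (esumR v < +oo)%E -> esumR v \is a fin_num.
  by move=> v0 vf; rewrite ge0_fin_numE// esum_ge0// => x _; rewrite lee_fin.
have ap := le _ _ (pos a) afin; have an := le _ _ (neg a) afin.
have bp := le _ _ (pos b) bfin; have bn := le _ _ (neg b) bfin.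
have D u v : (forall x, 0 <= u x) -> (forall x, 0 <= v x) ->
    (esumR (fun x => u x + v x)%R = esumR u + esumR v)%E.
  by move=> u0 v0; rewrite -esumD//; move=> x _; rewrite lee_fin.
rewrite (@rsum_split _ (fun x => a^\+ x + b^\+ x) (fun x => a^\- x + b^\- x)).
- rewrite !D//; try exact: p0; try exact: n0.
  rewrite !fineD ?fin//; try exact: p0; try exact: n0.
  by rewrite /rsum; ring.
- by move=> x; rewrite addr_ge0.
- by move=> x; rewrite addr_ge0.
- move=> x; have ha := congr1 (fun f => f x) (funrposBneg a).
  have hb := congr1 (fun f => f x) (funrposBneg b).
  by rewrite -{1}ha -{1}hb opprD addrACA.
- by rewrite D//; exact: lte_add_pinfty.
- by rewrite D//; exact: lte_add_pinfty.
Qed.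

Lemma rsum_le a (M : R) : (esumR (fun x => `|a x|) <= M%:E)%E -> `|rsum a| <= M.
Proof.
move=> aM.
have bound v : (forall x, 0 <= v x) -> (forall x, v x <= `|a x|) ->
    0 <= fine (esumR v) <= M.
  move=> v0 va; have vM : (esumR v <= M%:E)%E.
    by apply: le_trans aM; apply: le_esum => x _; rewrite lee_fin.
  have e0 : (0 <= esumR v)%E by apply: esum_ge0 => x _; rewrite lee_fin.
  by rewrite fine_ge0//= -lee_fin fineK// ge0_fin_numE//; exact: le_lt_trans vM (ltry _).
have /andP[p0 pM] := bound _ (funrpos_ge0 a) (pos a).
have /andP[n0 nM] := bound _ (funrneg_ge0 a) (neg a).
rewrite ler_norml /rsum; apply/andP; split; lra.
Qed.

Lemma rsum1 a y : (forall x, x != y -> a x = 0) -> rsum a = a y.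
Proof.
move=> ay; have E (v : V -> R) : (forall x, 0 <= v x) -> (forall x, x != y -> v x = 0) ->
    fine (esumR v) = v y.
  move=> v0 vy; have -> : (esumR v = \esum_(x in [set y]) (v x)%:E)%E.
    rewrite [RHS]esum_mkcond; apply: eq_esum => x _.
    by case: ifPn => //; rewrite notin_setE /= => /eqP/vy ->.
  by rewrite esum_set1// lee_fin.
rewrite /rsum !E.
- exact: (congr1 (fun f => f y) (funrposBneg a)).
- exact: funrneg_ge0.
- by move=> x /ay ax; rewrite /funrneg ax oppr0 maxxx.
- exact: funrpos_ge0.
- by move=> x /ay ax; rewrite /funrpos ax maxxx.
Qed.
End absolute_sums.

Section l2_product.
Context {R : realType} {V : choiceType}.
Implicit Types (f g h : l2 R V) (a b : R).
Local Notation esumR a := (\esum_(x in [set: V]) (a x)%:E)%E.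

Let prod f g x := normc (f x) * normc (g x).

(** Cauchy-Schwarz up to the factor 2. Only continuity of the inner product is drawn from it. *)
Let esum_prod f g a b : 0 < a -> 0 < b -> l2norm f <= a -> l2norm g <= b ->
  (esumR (prod f g) <= (2 * (a * b))%:E)%E.
Proof.
move=> a0 b0 fa gb.
have E (r : R) (F : l2 R V) : 0 <= r ->
    (esumR (fun x => r * normc (F x) ^+ 2)%R = (r * l2norm F ^+ 2)%:E)%E.
  move=> r0; rewrite -(sqr_sqrtr r0) -exprMn -{2}(ger0_norm (sqrtr_ge0 r)) -normc_real -l2normZ.
  rewrite -sqnorm_fin; apply: eq_esum => x _; congr EFin.
  have -> : ((Num.sqrt r)%:C *: F) x = (Num.sqrt r)%:C * F x by [].
  by rewrite Normc.normcM exprMn normc_real ger0_norm ?sqrtr_ge0.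
apply: (@le_trans _ _ (esumR (fun x => b / a * normc (f x) ^+ 2) +
    esumR (fun x => a / b * normc (g x) ^+ 2))%E).
  rewrite -esumD; last 2 first.
  - by move=> x _; rewrite lee_fin mulr_ge0 ?sqr_ge0// divr_ge0// ltW.
  - by move=> x _; rewrite lee_fin mulr_ge0 ?sqr_ge0// divr_ge0// ltW.
  apply: le_esum => x _; rewrite -EFinD lee_fin /prod.
  move: (normc (f x)) (normc (g x)) (normc_ge0 (f x)) (normc_ge0 (g x)) => u v u0 v0.
  rewrite -subr_ge0.
  have -> : b / a * u ^+ 2 + a / b * v ^+ 2 - u * v =
      ((b * u - a * v) ^+ 2 + a * b * (u * v)) / (a * b) by field; rewrite !gt_eqF.
  by rewrite divr_ge0 ?addr_ge0 ?sqr_ge0 ?mulr_ge0// ltW.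
have ba0 : 0 <= b / a by rewrite divr_ge0 ?(ltW a0) ?(ltW b0).
have ab0 : 0 <= a / b by rewrite divr_ge0 ?(ltW a0) ?(ltW b0).
rewrite !E// -EFinD lee_fin.
have -> : 2 * (a * b) = b / a * a ^+ 2 + a / b * b ^+ 2 by field; rewrite !gt_eqF.
by apply: lerD; rewrite ler_wpM2l// ler_sqr ?nnegrE ?l2norm_ge0 ?(ltW a0) ?(ltW b0).
Qed.

Let Re_prod f g x : `|complex.Re (f x * (g x)^*%C)| <= prod f g x.
Proof. by rewrite /prod -(normcJ (g x)) -Normc.normcM; exact: Re_le_normc. Qed.

Let Im_prod f g x : `|complex.Im (f x * (g x)^*%C)| <= prod f g x.
Proof. by rewrite /prod -(normcJ (g x)) -Normc.normcM; exact: Im_le_normc. Qed.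

Let esum_Re f g a b : 0 < a -> 0 < b -> l2norm f <= a -> l2norm g <= b ->
  (esumR (fun x => `|complex.Re (f x * (g x)^*%C)|%R) <= (2 * (a * b))%:E)%E.
Proof.
move=> a0 b0 fa gb; apply: le_trans (esum_prod a0 b0 fa gb).
by apply: le_esum => x _; rewrite lee_fin Re_prod.
Qed.

Let esum_Im f g a b : 0 < a -> 0 < b -> l2norm f <= a -> l2norm g <= b ->
  (esumR (fun x => `|complex.Im (f x * (g x)^*%C)|%R) <= (2 * (a * b))%:E)%E.
Proof.
move=> a0 b0 fa gb; apply: le_trans (esum_prod a0 b0 fa gb).
by apply: le_esum => x _; rewrite lee_fin Im_prod.
Qed.

Let norm1_gt0 f : 0 < l2norm f + 1. Proof. by rewrite ltr_wpDl ?l2norm_ge0. Qed.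
Let norm1_ge f : l2norm f <= l2norm f + 1. Proof. by rewrite lerDl. Qed.

Let Re_fin f g : (esumR (fun x => `|complex.Re (f x * (g x)^*%C)|%R) < +oo)%E.
Proof. by apply: le_lt_trans (esum_Re _ _ (norm1_ge f) (norm1_ge g)) (ltry _). Qed.
Let Im_fin f g : (esumR (fun x => `|complex.Im (f x * (g x)^*%C)|%R) < +oo)%E.
Proof. by apply: le_lt_trans (esum_Im _ _ (norm1_ge f) (norm1_ge g)) (ltry _). Qed.

Lemma l2dot_le f g a b : 0 < a -> 0 < b -> l2norm f <= a -> l2norm g <= b ->
  normc (l2dot f g) <= 4 * (a * b).
Proof.
move=> a0 b0 fa gb; apply: le_trans (normc_le_ReIm _) _.
have -> : 4 * (a * b) = 2 * (a * b) + 2 * (a * b) by ring.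
by apply: lerD; apply: rsum_le; [exact: esum_Re|exact: esum_Im].
Qed.

Let csumD (c c' : V -> R[i]) :
  (esumR (fun x => `|complex.Re (c x)|%R) < +oo)%E ->
  (esumR (fun x => `|complex.Im (c x)|%R) < +oo)%E ->
  (esumR (fun x => `|complex.Re (c' x)|%R) < +oo)%E ->
  (esumR (fun x => `|complex.Im (c' x)|%R) < +oo)%E ->
  csum (fun x => c x + c' x) = csum c + csum c'.
Proof.
move=> cR cI dR dI; rewrite /csum.
have addE (a b a' b' : R) : (a +i* b) + (a' +i* b') = (a + a') +i* (b + b') by [].
rewrite addE -!rsumD//; congr Complex; congr rsum; apply/funext => x; first exact: ReD.
exact: ImD.
Qed.

Lemma l2dotDl f f' g : l2dot (f + f') g = l2dot f g + l2dot f' g.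
Proof.
rewrite -csumD//; congr csum; apply/funext => x.
by rewrite -mulrDl.
Qed.

Lemma l2dotDr f g g' : l2dot f (g + g') = l2dot f g + l2dot f g'.
Proof.
rewrite -csumD//; congr csum; apply/funext => x.
by rewrite -mulrDr -conjcD.
Qed.

Lemma l2dot_single_r f g y : (forall x, x != y -> g x = 0) -> l2dot f g = f y * (g y)^*%C.
Proof.
move=> gy; rewrite /l2dot /csum !(@rsum1 _ _ _ y); first by case: (f y * _).
- by move=> x /gy ->; rewrite conjc0 mulr0.
- by move=> x /gy ->; rewrite conjc0 mulr0.
Qed.

Lemma l2dot_single_l f g y : (forall x, x != y -> f x = 0) -> l2dot f g = f y * (g y)^*%C.
Proof.
move=> fy; rewrite /l2dot /csum !(@rsum1 _ _ _ y); first by case: (f y * _).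
- by move=> x /fy ->; rewrite mul0r.
- by move=> x /fy ->; rewrite mul0r.
Qed.

Let cvg_of_bound (C : R) (u : nat -> R[i]) (phi : nat -> l2 R V) f : 0 < C ->
  (forall n e, 0 < e -> l2norm (phi n - f) <= e -> normc (u n) <= C * e) ->
  phi @ \oo --> f -> normc (u n) @[n --> \oo] --> (0 : R).
Proof.
move=> C0 uC /l2_cvgP/cvgrPdist_lt H; apply/cvgrPdist_le => e e0.
have e' : 0 < e / C by rewrite divr_gt0.
apply: filterS (H _ e') => n; rewrite !sub0r !normrN !ger0_norm ?normc_ge0 ?l2norm_ge0// => h.
have -> : e = C * (e / C) by rewrite mulrC divfK// gt_eqF.
by rewrite uC// ltW.
Qed.

Lemma l2dot_cvgl (phi : nat -> l2 R V) f g : phi @ \oo --> f ->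
  normc (l2dot (phi n) g - l2dot f g) @[n --> \oo] --> (0 : R).
Proof.
apply: (cvg_of_bound (C := 4 * (l2norm g + 1))) => [|n e e0 h]; first by rewrite mulr_gt0.
have -> : l2dot (phi n) g - l2dot f g = l2dot (phi n - f) g.
  by apply/eqP; rewrite subr_eq -l2dotDl subrK.
by rewrite -mulrA (mulrC _ e) l2dot_le.
Qed.

Lemma l2dot_cvgr f (phi : nat -> l2 R V) g : phi @ \oo --> g ->
  normc (l2dot f (phi n) - l2dot f g) @[n --> \oo] --> (0 : R).
Proof.
apply: (cvg_of_bound (C := 4 * (l2norm f + 1))) => [|n e e0 h]; first by rewrite mulr_gt0.
have -> : l2dot f (phi n) - l2dot f g = l2dot f (phi n - g).
  by apply/eqP; rewrite subr_eq -l2dotDr subrK.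
by rewrite -mulrA l2dot_le.
Qed.
End l2_product.

(** * Delta functions and arguments by density *)

Section l2_series.
Context {R : realType} {V : choiceType}.
Implicit Types (f g h u v : l2 R V) (a b e : R) (x y : V) (c : R[i]).

Lemma delta_square_summable y : (fun x => (x == y)%:R : R[i]) \in square_summable.
Proof.
apply/asboolP; rewrite /sqnorm.
have -> : (\esum_(x in [set: V]) (normc ((x == y)%:R : R[i]) ^+ 2)%:E =
    \esum_(x in [set y]) (normc ((x == y)%:R : R[i]) ^+ 2)%:E)%E.
  rewrite [RHS]esum_mkcond; apply: eq_esum => x _.
  case: ifPn => //; rewrite notin_setE /= => /eqP/negbTE ->.
  by rewrite Normc.normc0 expr0n.
by rewrite esum_set1 ?ltry// lee_fin sqr_ge0.
Qed.

Definition l2delta y : l2 R V := L2 (delta_square_summable y).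

Lemma l2deltaE y x : l2delta y x = (x == y)%:R.
Proof. by []. Qed.

Lemma l2_sumE (I : Type) (s : seq I) (F : I -> l2 R V) x :
  (\sum_(i <- s) F i) x = \sum_(i <- s) F i x.
Proof.
by elim: s => [|i s IH]; rewrite ?big_nil// !big_cons -IH.
Qed.

Lemma l2_ext f g : (forall x, f x = g x) -> f = g.
Proof. by move=> fg; apply: val_inj; apply/funext. Qed.

Lemma fs_decomposition f (A : set V) : finite_set A -> (forall y, ~ A y -> f y = 0) ->
  f = \sum_(y <- finmap.enum_fset (fset_set A)) f y *: l2delta y.
Proof.
move=> fA f0; apply: l2_ext => x; rewrite l2_sumE.
rewrite (eq_bigr (fun y => f y * (x == y)%:R))//.
rewrite -(fsbig_finite _ _ fA).
have [xA|nxA] := pselect (A x); last first.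
  by rewrite f0// fsbig1// => y yA; case: eqP => [xy|_]; rewrite ?mulr0//; case: nxA; rewrite xy.
rewrite -(@fsbig_widen _ _ _ _ [set x])//; last 2 first.
- by move=> y /= ->.
- by move=> y [_ /= /eqP]; rewrite eq_sym => /negbTE ->; rewrite mulr0.
by rewrite fsbig_set1 eqxx mulr1.
Qed.

(** An induction principle expressing that finite combinations of deltas are dense. *)
Lemma l2_ind (P : l2 R V -> Prop) : P 0 -> (forall c y, P (c *: l2delta y)) ->
  (forall f g, P f -> P g -> P (f + g)) ->
  (forall (phi : nat -> l2 R V) f, (forall n, P (phi n)) -> phi @ \oo --> f -> P f) ->
  forall f, P f.
Proof.
move=> P0 P1 PD Pl f.
have /choice[phi H] (n : nat) : exists phi : l2 R V, finite_set [set y | phi y != 0] /\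
    l2norm (phi - f) <= n.+1%:R^-1.
  by apply: fs_approx; rewrite invr_gt0.
apply: (Pl phi).
  move=> n; rewrite (fs_decomposition (f := phi n) (H n).1); last first.
    by move=> y /negP/negPn/eqP.
  by apply: big_ind.
apply/l2_cvgP/cvgrPdist_lt => e e0.
apply: filterS (near_infty_natSinv_lt (PosNum e0)) => n /= ne.
rewrite sub0r normrN ger0_norm ?l2norm_ge0//; exact: le_lt_trans (H n).2 ne.
Qed.

(** Both sides of the identity are additive and continuous in each argument, so two nested
    inductions reduce it to multiples of deltas, where it says that the matrix is hermitian. *)
Lemma hermitian_selfadjoint (T : {linear l2 R V -> l2 R V}) : continuous T ->
  (forall x y, T (l2delta y) x = (T (l2delta x) y)^*%C) -> selfadjoint T.
Proof.
move=> cT herm.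
have cvgT (phi : nat -> l2 R V) f : phi @ \oo --> f -> (fun n => T (phi n)) @ \oo --> T f.
  by move=> phif; apply: continuous_cvg => //; exact: cT.
have singleE c y x : x != y -> (c *: l2delta y) x = 0.
  by move=> /negbTE xy; have -> : (c *: l2delta y) x = c * (x == y)%:R by []; rewrite xy mulr0.
have single0 c y : (c *: l2delta y) y = c.
  by have -> : (c *: l2delta y) y = c * (y == y)%:R by []; rewrite eqxx mulr1.
have lim (F G : nat -> R[i]) l l' : (forall n, F n = G n) ->
    normc (F n - l) @[n --> \oo] --> (0 : R) -> normc (G n - l') @[n --> \oo] --> (0 : R) ->
    l = l'.
  by move=> /funext <-; exact: normc_cvg_eq.
have dot0l g : l2dot 0 g = 0.
  by have /eqP := l2dotDl 0 0 g; rewrite addr0 -subr_eq0 opprD addNKr oppr_eq0 => /eqP.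
have dot0r g : l2dot g 0 = 0.
  by have /eqP := l2dotDr g 0 0; rewrite addr0 -subr_eq0 opprD addNKr oppr_eq0 => /eqP.
apply: l2_ind.
- by move=> g; rewrite linear0 !dot0l.
- move=> c y; apply: l2_ind.
  + by rewrite linear0 !dot0r.
  + move=> c' x; rewrite (l2dot_single_r _ (singleE c' x)) (l2dot_single_l _ (singleE c y)).
    rewrite !single0 !linearZ; have -> : (c *: T (l2delta y)) x = c * T (l2delta y) x by [].
    have -> : (c' *: T (l2delta x)) y = c' * T (l2delta x) y by [].
    by rewrite conjcM -herm; ring.
  + by move=> f g hf hg; rewrite linearD !l2dotDr hf hg.
  + move=> phi f H phif; apply: lim H _ _; first exact: l2dot_cvgr.
    exact/l2dot_cvgr/cvgT.
- by move=> f f' hf hf' g; rewrite linearD !l2dotDl hf hf'.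
- move=> phi f H phif g; apply: lim (fun n => H n g) _ _; first exact/l2dot_cvgl/cvgT.
  exact: l2dot_cvgl.
Qed.

Lemma selfadjoint_hermitian (T : l2 R V -> l2 R V) : selfadjoint T ->
  forall x y, T (l2delta y) x = (T (l2delta x) y)^*%C.
Proof.
move=> sT x y; have := sT (l2delta y) (l2delta x).
rewrite (@l2dot_single_r _ _ _ _ x); last by move=> z /negbTE; rewrite l2deltaE => ->.
rewrite (@l2dot_single_l _ _ _ _ y); last by move=> z /negbTE; rewrite l2deltaE => ->.
by rewrite !l2deltaE !eqxx conjc1 mulr1 mul1r.
Qed.
End l2_series.

(** * Series in l2 and rows of continuous functionals *)

Section l2_convergence.
Context {R : realType} {V : choiceType}.
Implicit Types (f g : l2 R V) (x y : V).

(** Lower semicontinuity of the norm: each finite partial sum passes to the limit. *)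
Lemma l2_fatou (h : nat -> l2 R V) (w : V -> R[i]) (a : R) :
  (\forall m \near \oo, l2norm (h m) <= a) ->
  (forall y, normc (h m y - w y) @[m --> \oo] --> (0 : R)) ->
  (sqnorm w <= (a ^+ 2)%:E)%E.
Proof.
move=> ha hw; apply: ge_ereal_sup => _ [A [fA _] <-].
rewrite fsbig_finite// sumEFin lee_fin.
have cvg_norm y : normc (h m y) ^+ 2 @[m --> \oo] --> (normc (w y) ^+ 2 : R).
  have c := cvg_normc (hw y).
  by rewrite expr2; under eq_fun do rewrite expr2; exact: cvgM.
have S : \sum_(y <- finmap.enum_fset (fset_set A)) normc (h m y) ^+ 2 @[m --> \oo] -->
    (\sum_(y <- finmap.enum_fset (fset_set A)) normc (w y) ^+ 2 : R).
  by apply: cvg_big => //; exact: add_continuous.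
apply: cvgr_to_le S _; apply: filterS ha => m hma.
have a0 : 0 <= a by apply: le_trans hma; exact: l2norm_ge0.
rewrite -lee_fin; apply: (@le_trans _ _ (sqnorm (h m))).
  by apply: ereal_sup_ubound; exists A => //; rewrite fsbig_finite// sumEFin.
by rewrite sqnorm_fin lee_fin ler_sqr ?nnegrE ?l2norm_ge0.
Qed.

(** With the pointwise sum [w] already known, completeness of l2 is not invoked: [l2_fatou] bounds
    the distance of [w] to a partial sum by the tail of the norms, whence both square summability
    and convergence. *)
Lemma l2_series (c : nat -> R[i]) (u : nat -> l2 R V) (w : V -> R[i]) :
  (\sum_(k <oo) (normc (c k) * l2norm (u k))%:E < +oo)%E ->
  (forall y, sums_to (fun k => c k * u k y) (w y)) ->
  exists v : l2 R V, (forall y, v y = w y) /\ series (fun k => c k *: u k) @ \oo --> v.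
Proof.
move=> fin cw; pose S n : l2 R V := \sum_(0 <= k < n) c k *: u k.
have SE n y : S n y = \sum_(0 <= k < n) c k * u k y by rewrite /S l2_sumE.
have tail (e : R) : 0 < e -> exists N, forall n, (N <= n)%N ->
    (sqnorm (fun y => (w y - S n y)%R) <= (e ^+ 2)%:E)%E.
  move=> e0; have t0 k : 0 <= normc (c k) * l2norm (u k).
    by rewrite mulr_ge0 ?normc_ge0 ?l2norm_ge0.
  have [N HN] := sum_tail_le t0 fin e0.
  exists N => n Nn; apply: (l2_fatou (h := fun m => S m - S n)).
    exists n => // m /= nm; rewrite /S.
    have -> : \sum_(0 <= k < m) c k *: u k - \sum_(0 <= k < n) c k *: u k =
        \sum_(n <= k < n + (m - n)) c k *: u k.
      by rewrite subnKC// (big_cat_nat (leq0n n) nm) [LHS]addrC addKr.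
    apply: le_trans (l2norm_sum _ _ _) _; apply: le_trans (HN n _ Nn).
    by apply: ler_sum => k _; rewrite l2normZ.
  move=> y; have /sums_toP := cw y.
  suff -> : (fun m => normc (\sum_(0 <= k < m) c k * u k y - w y)) =
      (fun m => normc ((S m - S n) y - (w y - S n y))) by [].
  apply/funext => m; have -> : (S m - S n) y = S m y - S n y by [].
  by rewrite SE; congr normc; ring.
have [N0 HN0] := tail 1 ltr01.
have w2 : (fun y => w y - S N0 y) \in square_summable.
  by apply/asboolP; apply: le_lt_trans (HN0 _ (leqnn _)) (ltry _).
pose v : l2 R V := L2 w2 + S N0.
have vE y : v y = w y by have -> : v y = (w y - S N0 y) + S N0 y by []; exact: subrK.
exists v; split => //; apply/l2_cvgP/cvgrPdist_le => e e0.
have [N HN] := tail e e0; exists N => // n /= Nn.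
rewrite sub0r normrN ger0_norm ?l2norm_ge0// -ler_sqr ?nnegrE ?l2norm_ge0 ?(ltW e0)//.
rewrite l2norm_dist -lee_fin -sqnorm_fin; apply: le_trans (HN n Nn).
by apply: le_esum => y _; rewrite -vE.
Qed.

Lemma l2_cvg_pointwise (u : nat -> l2 R V) (v : l2 R V) y :
  series u @ \oo --> v -> sums_to (fun k => u k y) (v y).
Proof.
move=> /l2_cvgP H; apply/sums_toP/cvgrPdist_le => e e0.
move/cvgrPdist_le : H => /(_ _ e0); apply: filterS => n.
rewrite !sub0r !normrN !ger0_norm ?normc_ge0 ?l2norm_ge0//; apply: le_trans.
by rewrite -l2_sumE; exact: (l2_coord_le (series u n - v)).
Qed.

Lemma l2norm_conj f : l2norm (l2conj f) = l2norm f.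
Proof.
rewrite /l2norm; congr (Num.sqrt (fine _)); apply: eq_esum => x _.
by congr ((_ ^+ 2)%:E); exact: normcJ.
Qed.

Lemma sqnorm_fs (w : V -> R[i]) (A : set V) : finite_set A -> (forall y, ~ A y -> w y = 0) ->
  sqnorm w = (\sum_(y \in A) normc (w y) ^+ 2)%:E.
Proof.
move=> fA w0; rewrite fsbig_finite// -sumEFin -fsbig_finite// -esum_fset//; last first.
  by move=> y _; rewrite lee_fin sqr_ge0.
rewrite /sqnorm [RHS]esum_mkcond; apply: eq_esum => y _; case: ifPn => //.
by rewrite notin_setE => /w0 ->; rewrite Normc.normc0 expr0n.
Qed.

(** [opnorm] is a supremum in [R], meaningful for bounded sets only; continuity provides the bound,
    as a number of [R[i]] whose real part is taken. *)
Lemma normc_le_opnorm (phi : {linear l2 R V -> R[i]^o}) f : continuous phi ->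
  l2norm f <= 1 -> normc (phi f) <= opnorm phi.
Proof.
move=> cphi f1; have norm_le1 g : (`|g| <= 1 :> R[i]) = (l2norm g <= 1).
  by rewrite l2_normE -(rmorph1 (real_complex R)) lecR.
apply: ub_le_sup; last by exists f => //; rewrite /mkset norm_le1.
have /linear_boundedP [r [_ Hr]] := @continuous_linear_bounded _ _ _ 0 phi (cphi 0).
have := Hr (r + 1); rewrite ltrDl ltr01 => /(_ isT) {}Hr.
exists `|complex.Re (r + 1)| => _ [g /= g1 <-]; rewrite norm_le1 in g1.
have h : (normc (phi g))%:C <= (r + 1) * (l2norm g)%:C.
  by apply: le_trans (Hr g); rewrite normc_def -normcE.
have : normc (phi g) <= complex.Re (r + 1) * l2norm g.
  by move: h; rewrite lecE => /andP[_]; rewrite ReM /= mulr0 subr0.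
move=> /le_trans; apply; apply: le_trans (ler_norm _) _.
by rewrite normrM ler_piMr// ger0_norm ?l2norm_ge0.
Qed.

Lemma opnorm_le (phi : {linear l2 R V -> R[i]^o}) f : continuous phi ->
  normc (phi f) <= opnorm phi * l2norm f.
Proof.
move=> cphi; have [/l2norm_eq0 ->|f0] := eqVneq (l2norm f) 0.
  by rewrite linear0 Normc.normc0 l2norm0 mulr0.
have fp : 0 < l2norm f by rewrite lt_neqAle eq_sym f0 l2norm_ge0.
pose z : R[i] := (l2norm f)^-1%:C.
have nz : normc z = (l2norm f)^-1 by rewrite /z normc_real ger0_norm// invr_ge0 l2norm_ge0.
have : normc (phi (z *: f)) <= opnorm phi.
  by apply: normc_le_opnorm => //; rewrite l2normZ nz mulVf.
rewrite linearZ [normc _]Normc.normcM nz => h.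
by rewrite -ler_pdivrMr// mulrC.
Qed.

Let conj_mul_normc (z : R[i]) : z^*%C * z = (normc z ^+ 2)%:C.
Proof. by rewrite sqr_normcE; case: z => p r; simpc; congr (_ +i* _); ring. Qed.

(** The elementary half of the Riesz representation. Testing [phi] on the conjugated row cut off to
    a finite set, [h], gives [phi h = ||h||^2], so [||h||] is at most the norm of [phi]; then the
    finite set grows. *)
Lemma functional_row (phi : {linear l2 R V -> R[i]^o}) : continuous phi ->
  exists g : l2 R V, (forall y, g y = phi (l2delta y)) /\ l2norm g <= opnorm phi.
Proof.
move=> cphi; pose w y : R[i] := phi (l2delta y).
have op0 : 0 <= opnorm phi.
  by apply: le_trans (normc_le_opnorm (f := 0) cphi _); rewrite ?normc_ge0// l2norm0.
have wop : (sqnorm w <= (opnorm phi ^+ 2)%:E)%E.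
  apply: ge_ereal_sup => _ [A [fA _] <-].
  rewrite fsbig_finite// sumEFin -fsbig_finite// lee_fin; set N := \sum_(_ \in _) _.
  have N0 : 0 <= N by apply: fsumr_ge0 => y _; exact: sqr_ge0.
  pose h0 y := if y \in A then (w y)^*%C else 0.
  have h00 y : ~ A y -> h0 y = 0 by move=> nA; rewrite /h0 memNset.
  have h0N : sqnorm h0 = N%:E.
    rewrite (sqnorm_fs fA h00); congr EFin; apply: eq_fsbigr => y yA.
    by rewrite /h0 yA normcJ.
  have h2 : h0 \in square_summable by apply/asboolP; rewrite h0N ltry.
  pose h : l2 R V := L2 h2.
  have phih : phi h = N%:C.
    rewrite {1}(@fs_decomposition R V h A fA h00) linear_sum /N fsbig_finite// rmorph_sum.
    rewrite -!fsbig_finite//; apply: eq_fsbigr => y yA.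
    have -> : phi (h y *: l2delta y) = h0 y * w y by rewrite linearZ.
    by rewrite /h0 yA; exact: conj_mul_normc.
  have hN : l2norm h ^+ 2 = N by apply: EFin_inj; rewrite -sqnorm_fin.
  have := opnorm_le h cphi; rewrite phih normc_real ger0_norm// => hop.
  have [N00|Nn0] := eqVneq N 0; first by rewrite N00 sqr_ge0.
  have l0 : l2norm h != 0 by apply: contraNneq Nn0 => l0; rewrite -hN l0 expr0n.
  have lp : 0 < l2norm h by rewrite lt_neqAle eq_sym l0 l2norm_ge0.
  have lop : l2norm h <= opnorm phi by rewrite -(ler_pM2r lp) -expr2 hN.
  by rewrite -hN ler_sqr ?nnegrE ?l2norm_ge0.
have w2 : w \in square_summable.
  by apply/asboolP; apply: le_lt_trans wop (ltry _).
exists (L2 w2); split => //.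
by rewrite -ler_sqr ?nnegrE ?l2norm_ge0// -lee_fin -sqnorm_fin.
Qed.
End l2_convergence.

(** * The symbol as the transform of the matrix rows *)

Section symbol.
Context {R : realType} {q : nat} {X : homogeneous_tree q} {o : X}.
Context (nu : probability (boundary o) R).
Context (nu_cylinder : forall x : X, x <> o ->
  nu (cylinder x) = (q%:R / (q.+1%:R * q%:R ^+ dist o x))%:E).
Context (sigma : X -> boundary o * measurableTypeR R -> R[i]).
Context (T : {linear l2 R X -> l2 R X}) (T_sigma : extends_psdo nu sigma T).
Implicit Types (x y : X) (u v w : l2 R X).
Local Notation phase_space := (boundary o * measurableTypeR R)%type.
Local Notation kernel := (@kernel R q X o).
Local Notation mu := (pmeas nu).
Local Notation D := (phase : set phase_space).
Local Notation fourier := (fourier nu).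

Let mD : measurable D := measurable_phase.

Definition twisted_symbol x (ws : phase_space) : R[i] :=
  qpow q ((2^-1 -i* ws.2) * (height ws.1 x)%:C) * sigma x ws.
Local Notation a := twisted_symbol.

Lemma finitely_supported_delta y : finitely_supported (l2delta y : l2 R X).
Proof.
apply: (@sub_finite_set _ _ [set y]); last exact: finite_set1.
by move=> x; rewrite /mkset l2deltaE pnatr_eq0 eqb0 negbK => /eqP.
Qed.

Lemma fourier0_delta y (ws : phase_space) : fourier0 (l2delta y) ws = kernel y ws.
Proof.
have d0 x : x <> y -> l2delta y x * kernel x ws = 0.
  by move=> /eqP/negbTE xy; rewrite l2deltaE xy mul0r.
have -> : fourier0 (l2delta y) ws = \sum_(x \in [set y]) l2delta y x * kernel x ws.
  by rewrite fourier0E; apply/esym/fsbig_widen => // x [_ /d0].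
by rewrite fsbig_set1 l2deltaE eqxx mul1r.
Qed.

Lemma twisted_symbol_pairing x y :
  cintegrable mu D (fun ws => a x ws * kernel y ws) /\
  T (l2delta y) x = cintegral mu D (fun ws => a x ws * kernel y ws).
Proof.
have [i1 i2] := T_sigma (finitely_supported_delta y) x.
have E : {in D, psdo_integrand sigma (l2delta y) x =1 (fun ws => a x ws * kernel y ws)}.
  by move=> ws _; rewrite /psdo_integrand fourier0_delta.
by split; [exact: cintegrable_eq i1|rewrite i2; exact: cintegral_eq].
Qed.

Lemma cintegrable_twisted_symbol x : cintegrable mu D (a x).
Proof.
apply: cintegrable_eq (twisted_symbol_pairing x o).1 => ws _.
by rewrite kernel_root mulr1.
Qed.

Lemma twisted_symbol_fourierP x v :
  (forall y, T (l2delta y) x = (v y)^*%C) <->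
  {ae mu, forall ws, phase ws -> a x ws = (fourier v ws)^*%C}.
Proof.
have vi := cintegrableJ (cintegrable_fourier nu_cylinder v).
split=> [Tv|av y].
  pose F ws := a x ws - (fourier v ws)^*%C.
  have Fi : cintegrable mu D F.
    by apply: cintegrableB => //; exact: cintegrable_twisted_symbol.
  have F0 y : cintegral mu D (fun ws => F ws * kernel y ws) = 0.
    have -> : (fun ws => F ws * kernel y ws) =
        (fun ws => a x ws * kernel y ws - (fourier v ws)^*%C * kernel y ws).
      by apply/funext => ws; rewrite /F mulrBl.
    have [i1 i2] := twisted_symbol_pairing x y.
    rewrite cintegralB//; last exact: cintegrable_fourier_kernel.
    by rewrite -i2 fourier_pairing// Tv subrr.
  apply: filterS (kernel_complete Fi F0) => ws H wsD.
  by apply/eqP; rewrite -subr_eq0; apply/eqP/H.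
have [i1 ->] := twisted_symbol_pairing x y.
rewrite -(fourier_pairing nu_cylinder); apply: cintegral_ae => //.
- exact: i1.1.
- by have [] := cintegrable_fourier_kernel nu_cylinder v y.
by apply: filterS av => ws H wsD; rewrite H.
Qed.

Lemma twisted_symbolP x ws l : a x ws = l <->
  sigma x ws = qpow q (- (2^-1 -i* ws.2) * (height ws.1 x)%:C) * l.
Proof.
have q0 : (0 < q)%N by exact: tree_gt0.
rewrite /twisted_symbol mulNr qpowN//.
by split=> [<-|->]; rewrite ?mulKf ?mulVKf// qpow_neq0.
Qed.

Section kernel_expansions.
Context (f g : nat -> l2 R X).
Context (fg_sum : (\sum_(k <oo) (l2norm (f k) * l2norm (g k))%:E < +oo)%E).

Lemma summable_dominated (b : nat -> R) : (forall k, 0 <= b k) ->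
  (forall k, b k <= l2norm (f k) * l2norm (g k)) -> (\sum_(k <oo) (b k)%:E < +oo)%E.
Proof.
move=> b0 bfg; apply: le_lt_trans fg_sum; apply: lee_nneseries => k *.
  by rewrite lee_fin.
by rewrite lee_fin.
Qed.

Lemma rows_summable x : (\sum_(k <oo) (normc (g k x) * l2norm (f k))%:E < +oo)%E.
Proof.
apply: summable_dominated => k; first by rewrite mulr_ge0 ?normc_ge0 ?l2norm_ge0.
by rewrite mulrC ler_wpM2l ?l2norm_ge0// l2_coord_le.
Qed.

Lemma columns_summable x :
  (\sum_(k <oo) (normc (f k x)^*%C * l2norm (l2conj (g k)))%:E < +oo)%E.
Proof.
apply: summable_dominated => k; first by rewrite mulr_ge0 ?normc_ge0 ?l2norm_ge0.
by rewrite l2norm_conj normcJ ler_wpM2r ?l2norm_ge0// l2_coord_le.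
Qed.

(** With [K(x, y)] the sum of [f_k(x) g_k(y)], the function [w] is [y -> K(y, x)]. *)
Lemma fourier_rows x w : series (fun k => g k x *: f k) @ \oo --> w ->
  {ae mu, forall ws, phase ws ->
    sums_to (fun k => (fourier (f k) ws)^*%C * (g k x)^*%C) (fourier w ws)^*%C}.
Proof.
move=> sw; apply: filterS (fourier_series nu_cylinder (rows_summable x) sw) => ws H wsD.
have := sums_toJ (H wsD); congr sums_to; apply/funext => k.
by rewrite conjcM mulrC.
Qed.

(** With the same [K], the function [v] is [y -> conj K(x, y)]; the two conjugations cancel in the
    terms of the series. *)
Lemma fourier_columns x v : series (fun k => (f k x)^*%C *: l2conj (g k)) @ \oo --> v ->
  {ae mu, forall ws, phase ws ->
    sums_to (fun k => f k x * (fourier (l2conj (g k)) ws)^*%C) (fourier v ws)^*%C}.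
Proof.
move=> sv; apply: filterS (fourier_series nu_cylinder (columns_summable x) sv) => ws H wsD.
have := sums_toJ (H wsD); congr sums_to; apply/funext => k.
by rewrite conjcM conjcK.
Qed.
End kernel_expansions.
End symbol.

(** * Self-adjointness read off from the symbol *)

Theorem corollary5p2 (R : realType) (q : nat) (X : homogeneous_tree q) (o : X)
  (nu : probability (boundary o) R)
  (nu_cylinder : forall x : X, x <> o ->
     nu (cylinder x) = (q%:R / (q.+1%:R * q%:R ^+ dist o x))%:E)
  (sigma : X -> boundary o * measurableTypeR R -> R[i])
  (sigma_measurable : measurable_symbol sigma)
  (T : {linear l2 R X -> l2 R X})
  (T_sigma : extends_psdo nu sigma T)
  (T_nuclear : nuclear T) :
  selfadjoint T <->
  exists g f : nat -> l2 R X,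
    (\sum_(k <oo) (l2norm (f k) * l2norm (g k))%:E < +oo)%E /\
    forall x : X, {ae pmeas nu, forall ws, phase ws ->
      exists l : R[i],
        [/\ sums_to (fun k => f k x * (fourier nu (l2conj (g k)) ws)^*%C) l,
            sums_to (fun k => (fourier nu (f k) ws)^*%C * (g k x)^*%C) l &
            sigma x ws =
              qpow q (- (2^-1 -i* ws.2) * (height ws.1 x)%:C) * l]}.
Proof.
have [cT [phi [f [cphi f_sum Tf]]]] := T_nuclear; split=> [selfT|].
  have herm := selfadjoint_hermitian selfT.
  (* The functionals of the nuclear expansion enter only through their values at deltas: the matrix
     of [T] is the sum of [f_k(x) g_k(y)]. *)
  have /choice[g gP] k : exists g : l2 R X,
      (forall y, g y = phi k (l2delta y)) /\ l2norm g <= opnorm (phi k).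
    exact: functional_row.
  have fg_sum : (\sum_(k <oo) (l2norm (f k) * l2norm (g k))%:E < +oo)%E.
    apply: le_lt_trans f_sum; apply: lee_nneseries => k *.
      by rewrite lee_fin mulr_ge0 ?l2norm_ge0.
    by rewrite lee_fin mulrC ler_wpM2r ?l2norm_ge0// (gP k).2.
  have rows x : series (fun k => g k x *: f k) @ \oo --> T (l2delta x).
    have -> : (fun k => g k x *: f k) = (fun k => phi k (l2delta x) *: f k).
      by apply/funext => k; rewrite (gP k).1.
    exact: Tf.
  exists g, f; split => // x.
  (* This is where self-adjointness acts: the conjugate of [y -> K(x, y)] is [y -> K(y, x)], that is
     [T (l2delta x)], so both series of the statement have the transform of the same function behind
     them. *)
  have columns : series (fun k => (f k x)^*%C *: l2conj (g k)) @ \oo --> T (l2delta x).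
    have pointwise y : sums_to (fun k => (f k x)^*%C * l2conj (g k) y) (T (l2delta x) y).
      have -> : T (l2delta x) y = (T (l2delta y) x)^*%C by rewrite herm.
      have := sums_toJ (l2_cvg_pointwise (y := x) (rows y)); congr sums_to; apply/funext => k.
      by rewrite mulrC -conjcM.
    have [v [vT cv]] := l2_series (columns_summable fg_sum x) pointwise.
    by rewrite -(l2_ext vT).
  have symbol := (twisted_symbol_fourierP nu_cylinder T_sigma x _).1 (herm x).
  apply: filterS3 (fourier_columns nu_cylinder fg_sum columns)
    (fourier_rows nu_cylinder fg_sum (rows x)) symbol => ws H1 H2 H3 wsD.
  exists (fourier nu (T (l2delta x)) ws)^*%C; split; [exact: H1|exact: H2|].
  by apply/twisted_symbolP; exact: H3.
move=> {f f_sum Tf} [g [f [fg_sum H]]].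
(* The given [f] and [g] have no known relation to [T] yet. [W (y, x)] is the kernel
   [sum_k f_k(x) g_k(y)] they define; that it is the matrix of [T] must come from the symbol. *)
have /choice[W WP] (p : X * X) : exists l, sums_to (fun k => g k p.1 * f k p.2) l.
  apply: summable_sums_to; apply: (summable_dominated fg_sum) => k.
    exact: normc_ge0.
  by rewrite Normc.normcM mulrC ler_pM ?normc_ge0 ?l2_coord_le.
(* The two series for the symbol are two expansions of the same row of [T]: pairing with [e_y]
   evaluates the second to the conjugate of [W (x, y)] and the first to [W (y, x)]. Together they
   make the matrix hermitian. *)
have rowsP x y : T (l2delta y) x = (W (x, y))^*%C /\ T (l2delta y) x = W (y, x).
  have [w [wE rows]] := l2_series (rows_summable fg_sum x) (fun y => WP (x, y)).
  have pointwise y' : sums_to (fun k => (f k x)^*%C * l2conj (g k) y') (W (y', x))^*%C.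
    have := sums_toJ (WP (y', x)); congr sums_to; apply/funext => k.
    by rewrite mulrC -conjcM.
  have [v [vE columns]] := l2_series (columns_summable fg_sum x) pointwise.
  have symbol u : {ae pmeas nu, forall ws, phase ws ->
        twisted_symbol sigma x ws = (fourier nu u ws)^*%C} ->
      T (l2delta y) x = (u y)^*%C.
    by move=> /(twisted_symbol_fourierP nu_cylinder T_sigma x u).2.
  split.
    rewrite -(wE y); apply: symbol.
    apply: filterS2 (fourier_rows nu_cylinder fg_sum rows) (H x) => ws H1 H2 wsD.
    have [l [_ l2 /twisted_symbolP ->]] := H2 wsD.
    exact: sums_to_unique l2 (H1 wsD).
  rewrite -[W (y, x)]conjcK -(vE y); apply: symbol.
  apply: filterS2 (fourier_columns nu_cylinder fg_sum columns) (H x) => ws H1 H2 wsD.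
  have [l [l1 _ /twisted_symbolP ->]] := H2 wsD.
  exact: sums_to_unique l1 (H1 wsD).
apply: hermitian_selfadjoint => // x y.
by rewrite (rowsP x y).2 (rowsP y x).1 conjcK.
Qed.
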